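(* Let $\mu$ be any Borel probability measure on the unit circle $\mathbb{T}$. Then for $\mathbb{P}_{K_{\mathbb{D}}}$-almost every $X\in\mathrm{Conf}(\mathbb{D})$, simultaneously for all $f\in\mathcal{H}^2(\mathbb{D};\mu)$ and all $z\in\mathbb{D}$, we have $$f(z)=\lim_{s\to1^+}\frac{g_X(s,z;f)}{g_X(s,z)},$$ where the convergence is uniform for $f\in\{P[h\mu]:\|h\|_{L^2(\mu)}\le1\}$ and locally uniform in $z\in\mathbb{D}$, that is, for any relatively compact $D\subset\mathbb{D}$, $$\lim_{s\to1^+}\ \sup_{f=P[h\mu],\ \|h\|_{L^2(\mu)}\le1}\ \sup_{z\in D}\Big|\frac{g_X(s,z;f)}{g_X(s,z)}-f(z)\Big|=0.$$
   Context: $\mathbb{D}$ is the open unit disk in $\mathbb{C}$, $\mathbb{T}=\partial\mathbb{D}$, $dA$ is Lebesgue measure on $\mathbb{D}$ normalized so that $A(\mathbb{D})=1$, and $K_{\mathbb{D}}(z,w)=(1-z\bar w)^{-2}$ is the Bergman kernel. $\mathrm{Conf}(\mathbb{D})$ is the space of (locally finite) configurations $X$ on $\mathbb{D}$, and $\mathbb{P}_{K_{\mathbb{D}}}$ is the determinantal point process induced by $K_{\mathbb{D}}$: the unique simple point process (Borel probability measure on $\mathrm{Conf}(\mathbb{D})$) whose $n$-th correlation function with respect to $dA$ is $\det(K_{\mathbb{D}}(x_i,x_j))_{1\le i,j\le n}$ for all $n\ge1$. The Poincaré metric is $d_{\mathbb{D}}(x,z)=\log\frac{1+|\varphi_x(z)|}{1-|\varphi_x(z)|}$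 with $\varphi_x(z)=\frac{z-x}{1-\bar x z}$. For $h\in L^2(\mathbb{T},\mu)$, $P[h\mu](z)=\int_{\mathbb{T}}\frac{1-|z|^2}{|1-\bar\zeta z|^2}h(\zeta)\,d\mu(\zeta)$, and $\mathcal{H}^2(\mathbb{D};\mu)=\{P[h\mu]:h\in L^2(\mathbb{T},\mu)\}$. For $s>1$: $g_X(s,z)=\sum_{x\in X}e^{-s d_{\mathbb{D}}(x,z)}$ and $g_X(s,z;f)=\sum_{x\in X}e^{-s d_{\mathbb{D}}(x,z)}f(x)$; for $\mathbb{P}_{K_{\mathbb{D}}}$-almost every $X$ the latter series converges absolutely simultaneously for all $f\in\mathcal{H}^2(\mathbb{D};\mu)$, all $z\in\mathbb{D}$ and all $s>1$. *)

(* Defs.v *)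
From HB Require Import structures.
From mathcomp Require Import all_boot all_order all_algebra.
From mathcomp Require Import all_classical all_reals all_analysis.
From mathcomp Require Import measurable_realfun complex.

Set Implicit Arguments.
Unset Strict Implicit.
Unset Printing Implicit Defensive.

Import Order.TTheory GRing.Theory Num.Theory.
Import ComplexField.Normc.
Import numFieldNormedType.Exports.

Local Open Scope classical_set_scope.
Local Open Scope ring_scope.
Local Open Scope complex_scope.

(* R[i] carries its topology through the alias R[i]^o; borelC R is R[i] with
   the sigma-algebra generated by the open sets.  The modulus used throughout
   is normc : R[i] -> R, since `|z| is an element of R[i]. *)
Definition openC (R : realType) : set (set R[i]^o) := [set A | open A].
Arguments openC R : clear implicits.

Notation borelC R := (g_sigma_algebraType (openC R)).

Definition disc (R : realType) : set R[i] := [set z | normc z < 1].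
Arguments disc R : clear implicits.

Definition circle (R : realType) : set R[i] := [set z | normc z = 1].
Arguments circle R : clear implicits.

Definition relatively_compact_in_disc (R : realType) (B : set R[i]) : Prop :=
  compact (closure (B : set R[i]^o)) /\
  closure (B : set R[i]^o) `<=` disc R.

Section area.
Variable R : realType.

Definition of_plane (p : R * R) : borelC R := p.1 +i* p.2.

Let box (q : rat * rat * nat) : set (R * R) :=
  [set p | `|p.1 - ratr q.1.1| < q.2.+1%:R^-1 /\
           `|p.2 - ratr q.1.2| < q.2.+1%:R^-1].

Let measurable_box q : measurable (box q).
Proof.
have -> : box q = ball (ratr q.1.1 : R) q.2.+1%:R^-1 `*`
                  ball (ratr q.1.2 : R) q.2.+1%:R^-1.
  by apply/seteqP; split => -[x y]; rewrite /box/= -!ball_normE/=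
    (distrC x) (distrC y).
by apply: measurableX; apply: open_measurable; exact: ball_open.
Qed.

Let open_of_plane (A : set R[i]) (p : R * R) : openC R A ->
  A (of_plane p) ->
  exists q, box q p /\ box q `<=` of_plane @^-1` A.
Proof.
move=> oA Ap.
have /nbhs_ballP[e /= e0 eA] : nbhs (of_plane p : R[i]^o) A.
  by apply: open_nbhs_nbhs; split.
have [r r0 rA] : exists2 r : R, 0 < r & forall p' : R * R,
    `|p'.1 - p.1| < r -> `|p'.2 - p.2| < r -> A (of_plane p').
  move: e0 eA; case: e => a b; rewrite ltcE/= => /andP[/eqP b0 a0] eA.
  exists (a / 2); first by rewrite divr_gt0.
  move=> [x y] /= xp yp; apply: eA.
  rewrite -ball_normE/= ltcE/= b0 eqxx/=.
  apply: (@le_lt_trans _ _ (`|p.1 - x| + `|p.2 - y|)).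
    rewrite -(ler_pXn2r (n := 2)) ?nnegrE ?addr_ge0// ?sqrtr_ge0//.
    rewrite sqr_sqrtr ?addr_ge0 ?sqr_ge0// [leRHS]sqrrD !real_normK ?num_real//.
    by rewrite -addrA (addrC (_ *+ 2)) addrA lerDl mulrn_wge0// mulr_ge0.
  by rewrite [ltRHS](splitr a) ltrD// distrC.
have [n nr] : exists n : nat, n.+1%:R^-1 < r / 2.
  have r20 : 0 < r / 2 by rewrite divr_gt0.
  have [n] := near_infty_natSinv_lt (PosNum r20).
  by move=> _ /(_ n (leqnn n)); exists n.
have rd (x : R) : exists q : rat, `|x - ratr q| < n.+1%:R^-1.
  have xx : x - n.+1%:R^-1 < x + n.+1%:R^-1 by rewrite ltrD2l gtrN ?invr_gt0.
  have [q qx] := rat_in_itvoo xx.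
  by exists q; rewrite ltr_distlC; move: qx; rewrite in_itv.
have [q1 q1p] := rd p.1; have [q2 q2p] := rd p.2.
exists (q1, q2, n); split => //= p' [/= p1 p2]; apply: rA.
  rewrite (le_lt_trans (ler_distD (ratr q1) _ _))// [ltRHS]splitr.
  by rewrite ltrD// ?(lt_trans p1)// distrC (lt_trans q1p).
rewrite (le_lt_trans (ler_distD (ratr q2) _ _))// [ltRHS]splitr.
by rewrite ltrD// ?(lt_trans p2)// distrC (lt_trans q2p).
Qed.

Lemma measurable_of_plane : measurable_fun [set: R * R] of_plane.
Proof.
apply: (@measurability _ _ (R * R)%type (borelC R) _ _ (openC R)) => //.
move=> _ [A oA <-].
rewrite setTI.
have -> : of_plane @^-1` A =
    \bigcup_q (if `[< box q `<=` of_plane @^-1` A >] then box q else set0).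
  apply/seteqP; split => [p Ap|p [q _]]; last by case: asboolP => // + bp; exact.
  have [q [qp qA]] := open_of_plane oA Ap.
  by exists q => //; case: asboolP.
apply: countable_bigcupT_measurable => [|q]; first exact: countableP.
by case: ifP.
Qed.

Let invpi_ge0 : 0 <= (pi : R)^-1. Proof. by rewrite invr_ge0 pi_ge0. Qed.

(* Lebesgue measure on the plane divided by pi; integrals against it are
   always taken over subsets of the disc, which has mass 1. *)
Definition area : set (borelC R) -> \bar R :=
  pushforward (mscale (NngNum invpi_ge0)
                 (lebesgue_measure \x lebesgue_measure)%E) of_plane.

Let area0 : area set0 = 0%E.
Proof. by rewrite /area /pushforward preimage_set0 measure0. Qed.

Let area_ge0 A : (0 <= area A)%E.
Proof. by rewrite /area /pushforward; exact: measure_ge0. Qed.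

Let area_sigma_additive : semi_sigma_additive area.
Proof.
move=> F mF tF mUF; rewrite /area /pushforward preimage_bigcup.
have mp B : measurable B -> measurable (of_plane @^-1` B).
  by move=> mB; rewrite -[X in measurable X]setTI; exact: measurable_of_plane.
apply: measure_semi_sigma_additive => [n||]; first exact: mp.
- by apply/trivIsetP => i j _ _ ij; rewrite -preimage_setI;
    move/trivIsetP : tF => ->//; rewrite preimage_set0.
- by rewrite -preimage_bigcup; exact: mp.
Qed.

HB.instance Definition _ := isMeasure.Build _ _ _ area
  area0 area_ge0 area_sigma_additive.

End area.

(* Iterated integral over disc^n; it is only applied to nonnegative functions,
   for which it is the integral against the n-fold product measure. *)
Fixpoint area_integral (R : realType) (n : nat) :
    (n.-tuple (borelC R) -> \bar R) -> \bar R :=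
  match n with
  | 0 => fun F => F [tuple]
  | m.+1 => fun F =>
      (\int[@area R]_(x in disc R)
         area_integral (fun t : m.-tuple (borelC R) => F [tuple of x :: t]))%E
  end.

(* Simple configurations on the disc: locally finite subsets. *)
Record conf (R : realType) := Conf {
  points : set R[i] ;
  points_disc : points `<=` disc R ;
  points_locally_finite : forall B : set R[i],
    relatively_compact_in_disc B -> finite_set (points `&` B) }.

HB.instance Definition _ (R : realType) := gen_eqMixin (conf R).
HB.instance Definition _ (R : realType) := gen_choiceMixin (conf R).

Section empty_conf.
Variable R : realType.

Let empty_locally_finite (B : set R[i]) :
  relatively_compact_in_disc B -> finite_set (set0 `&` B).
Proof. by rewrite set0I. Qed.

Definition empty_conf : conf R := Conf (@sub0set _ _) empty_locally_finite.

HB.instance Definition _ := isPointed.Build (conf R) empty_conf.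

End empty_conf.

(* The Borel sigma-algebra of the vague topology is generated by the numbers of
   points in relatively compact Borel sets. *)
Definition counting_events (R : realType) : set (set (conf R)) :=
  [set E | exists (B : set (borelC R)) (n : nat),
     [/\ measurable B, relatively_compact_in_disc B &
         E = [set X | ((points X `&` B) #= `I_n)%card]]].
Arguments counting_events R : clear implicits.

Notation Conf_space R := (g_sigma_algebraType (counting_events R)).

(* rho is the n-th correlation function, with respect to area, of the simple
   point process P: the sum is over ordered n-tuples of distinct points. *)
Definition is_correlation_function (R : realType)
    (P : probability (Conf_space R) R) (n : nat)
    (rho : n.-tuple (borelC R) -> R) : Prop :=
  forall phi : n.-tuple (borelC R) -> R,
    measurable_fun [set: n.-tuple (borelC R)] phi -> (forall t, 0 <= phi t) ->
    ((\int[P]_X \esum_(t in [set t : n.-tuple (borelC R) |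
                             uniq t /\ forall i, points X (tnth t i)])
                 (phi t)%:E)
     = area_integral (fun t => (phi t * rho t)%:E))%E.

Definition bergman_kernel (R : realType) (z w : R[i]) : R[i] :=
  ((1 - z * w^*) ^+ 2)^-1.

(* The determinant is real since the kernel is Hermitian. *)
Definition is_bergman_dpp (R : realType)
    (P : probability (Conf_space R) R) : Prop :=
  forall n : nat, (0 < n)%N ->
    is_correlation_function P (fun t : n.-tuple (borelC R) =>
      complex.Re (\det (\matrix_(i < n, j < n)
                          bergman_kernel (tnth t i) (tnth t j)))).

Definition mobius (R : realType) (x z : R[i]) : R[i] :=
  (z - x) / (1 - x^* * z).

Definition poincare_dist (R : realType) (x z : R[i]) : R :=
  ln ((1 + normc (mobius x z)) / (1 - normc (mobius x z))).

Definition complex_integral d (T : measurableType d) (R : realType)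
    (mu : {measure set T -> \bar R}) (D : set T) (f : T -> R[i]) : R[i] :=
  (\int[mu]_(x in D) complex.Re (f x)) +i*
  (\int[mu]_(x in D) complex.Im (f x)).

(* In what follows a Borel probability measure on the circle is a Borel
   probability measure mu on R[i] such that mu (circle R) = 1. *)
Section poisson.
Variables (R : realType) (mu : probability (borelC R) R).

Definition L2norm (h : borelC R -> borelC R) : \bar R :=
  ((\int[mu]_(zeta in circle R) ((normc (h zeta) ^+ 2)%:E)) `^ 2^-1)%E.

Definition L2 : set (borelC R -> borelC R) :=
  [set h | measurable_fun (circle R : set (borelC R)) h /\ (L2norm h < +oo)%E].

Definition poisson (h : borelC R -> borelC R) (z : R[i]) : R[i] :=
  complex_integral mu (circle R) (fun zeta : borelC R =>
    ((1 - normc z ^+ 2) / normc (1 - (zeta : R[i])^* * z) ^+ 2)%:C *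
    (h zeta : R[i])).

(* Elements are functions on the disc: values outside are irrelevant. *)
Definition harmonic_hardy : set (R[i] -> R[i]) :=
  [set f | exists2 h, L2 h & forall z, disc R z -> f z = poisson h z].

Definition harmonic_hardy_ball : set (R[i] -> R[i]) :=
  [set f | exists2 h, L2 h /\ (L2norm h <= 1)%E &
                      forall z, disc R z -> f z = poisson h z].

End poisson.

(* Sum of an absolutely summable family. *)
Definition real_sum (R : realType) (T : choiceType) (X : set T)
    (u : T -> R) : R :=
  fine (\esum_(x in X) (u^\+ x)%:E) - fine (\esum_(x in X) (u^\- x)%:E).

Definition complex_sum (R : realType) (T : choiceType) (X : set T)
    (u : T -> R[i]) : R[i] :=
  real_sum X (fun x => complex.Re (u x)) +i*
  real_sum X (fun x => complex.Im (u x)).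

Definition gweight (R : realType) (s : R) (z x : R[i]) : R :=
  expR (- s * poincare_dist x z).

Definition g (R : realType) (X : conf R) (s : R) (z : R[i]) : R :=
  real_sum (points X) (gweight s z).

Definition gf (R : realType) (X : conf R) (s : R) (z : R[i])
    (f : R[i] -> R[i]) : R[i] :=
  complex_sum (points X) (fun x => (gweight s z x)%:C * f x).

Definition gf_summable (R : realType) (X : conf R) (s : R) (z : R[i])
    (f : R[i] -> R[i]) : Prop :=
  summable (points X) (fun x => (normc ((gweight s z x)%:C * f x))%:E).

Definition gratio (R : realType) (X : conf R) (s : R) (z : R[i])
    (f : R[i] -> R[i]) : R[i] :=
  gf X s z f / (g X s z)%:C.

(* Supremum in [0, +oo], so that the supremum over the empty set is 0. *)
Definition sup_nneg (R : realType) (T : Type) (A : set T) (F : T -> \bar R) :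
    \bar R :=
  ereal_sup (0%E |` [set F x | x in A]).

(* Main.v *)
Require Import Defs.
From HB Require Import structures.
From mathcomp Require Import all_boot all_order all_algebra.
From mathcomp Require Import all_classical all_reals all_analysis.
From mathcomp Require Import measurable_realfun complex.
From mathcomp Require Import ring lra.

(** Let v(x) = (1 - |x|) / (1 + |x|), the exponential of minus the distance from
    x to the origin (hyp), and let p_eta(x) be the Poisson kernel with pole eta,
    extended to |eta| <= 1 by
    (1 - |eta|^2 |x|^2) / |1 - conj(eta) x|^2 (pker at the point conj(eta) x).

    The weights exp (- t d(x, z)) behave like v(x)^t p_z(x) for x near the boundary
    and t near 1,
    so everything depends on the statistics
    Y_t(eta), the sum over x in X of v(x)^t p_eta(x) (kersum).
    Their expectation m(t) does not depend on eta: p_eta is harmonic with value 1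
    at the origin, and v^t times the intensity is rotation invariant
    (mean_value). It tends to infinity as t decreases to 1 (mass_large). The
    second correlation function is at most the product of the first ones, so the
    variance of Y_t(eta) is at most the integral of the square of v^t p_eta
    against the intensity (second_moment), which is at most m(t) because
    v p_eta <= 1 (deviation_mean). Choose exponents s_n, decreasing to 1, at
    which m is the square of N + n + 1 (mass_level). The mean of
    (Y / m - 1)^2 at s_n is then at most the inverse of that square, which is
    summable. So almost surely Y / m tends to 1 along s_n at every rational
    point eta and, by Fubini, in mean square on the circle with respect to mu
    (ae_rational_concentration, ae_circle_concentration).

    Nothing probabilistic is left; fix such an X. Let h >= 0 have norm at most 1
    in L^2(mu), and let p[h] be its Poisson integral. The sum of v^t p[h] over X
    is the integral of h Y_t over the circle. At t = s_n it differs from m times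
    the integral of h by at most m times the root mean square error, for all h
    (psum_levels); this is why a single null set serves all functions. The sums
    are monotone in t and consecutive squares have ratio tending to 1, so the
    asymptotics hold as t tends to 1 through all values (interpolation).

    The denominator exp (- t d(x, z)), summed over X, is compared with Y_t(z) by
    gweight_pker; as Y_t is Lipschitz in z in units of Y_t(0), it is equivalent
    to m(t) uniformly in |z| <= r (gsum_bounds). In the numerator, p[h](x) is an
    integral of p_zeta(x) h(zeta), and p_zeta(x) is concentrated at the zeta
    close to x (pker_concentration), for which p_z(x) is close to p_zeta(z).
    Hence the numerator is asymptotic to the sum of v^t times the Poisson
    integral of zeta -> p_zeta(z) h(zeta), that is, to m(t) times the integral
    of the latter density, which is p[h](z) (nsum_bounds). Dividing gives the
    theorem for h >= 0, uniformly in h and locally uniformly in z, and a complex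
    h is a combination of four such densities (poisson_represented). *)

Set Implicit Arguments.
Unset Strict Implicit.
Unset Printing Implicit Defensive.

Import Order.TTheory GRing.Theory Num.Theory.
Import ComplexField.Normc.
Import numFieldNormedType.Exports.

Local Open Scope classical_set_scope.
Local Open Scope ring_scope.
Local Open Scope complex_scope.

(** * The complex plane and its discs *)

Section complex_plane.
Context {R : realType}.
Implicit Types x y z w : R[i].

Lemma normc_sqr x : normc x ^+ 2 = complex.Re x ^+ 2 + complex.Im x ^+ 2.
Proof. by case: x => a b /=; rewrite sqr_sqrtr// addr_ge0 ?sqr_ge0. Qed.

Lemma normc_ge0 x : 0 <= normc x.
Proof. by case: x => a b; exact: sqrtr_ge0. Qed.

Lemma normcC x y : normc (x - y) = normc (y - x).
Proof. by rewrite -opprB normcN. Qed.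

Lemma normc_conj x : normc (x^*) = normc x.
Proof. by case: x => a b /=; rewrite sqrrN. Qed.

Lemma Re_le_normc x : `|complex.Re x| <= normc x.
Proof.
rewrite -(ler_pXn2r (n := 2))// ?nnegrE ?normc_ge0// normc_sqr.
by rewrite real_normK ?num_real// lerDl sqr_ge0.
Qed.

Lemma Im_le_normc x : `|complex.Im x| <= normc x.
Proof.
rewrite -(ler_pXn2r (n := 2))// ?nnegrE ?normc_ge0// normc_sqr.
by rewrite real_normK ?num_real// lerDr sqr_ge0.
Qed.

Lemma normc_le_ReIm x : normc x <= `|complex.Re x| + `|complex.Im x|.
Proof.
rewrite -(ler_pXn2r (n := 2))// ?nnegrE ?normc_ge0 ?addr_ge0//.
rewrite normc_sqr [leRHS]sqrrD !real_normK ?num_real//.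
by rewrite -addrA (addrC (_ *+ 2)) addrA lerDl mulrn_wge0// mulr_ge0.
Qed.

Lemma normc_real (r : R) : normc r%:C = `|r|.
Proof. by rewrite /= expr0n addr0 sqrtr_sqr. Qed.

Lemma ler_normc_dist x y : `|normc x - normc y| <= normc (x - y).
Proof.
have h u v : normc u - normc v <= normc (u - v).
  by rewrite lerBlDr -{1}(subrK v u) le_normcD.
by rewrite ler_norml h andbT lerNl opprB normcC h.
Qed.

Lemma normc_lt_near (r : R) x y : normc (x - y) < r - normc x -> normc y < r.
Proof.
have := ler_normc_dist x y; rewrite ler_norml => /andP[h _] xy; lra.
Qed.

(** The norm that defines the topology of R[i]^o takes its values in R[i]; all
    estimates below use the real-valued modulus instead. *)
Lemma nbhs_normcP x (A : set R[i]) :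
  nbhs (x : R[i]^o) A <->
  exists2 e : R, 0 < e & forall y, normc (x - y) < e -> A y.
Proof.
split => [/nbhs_ballP[[a b]/=]|[e e0 eA]].
  rewrite ltcE/= => /andP[/eqP b0 a0] aA; exists a => // y xy; apply: aA.
  by rewrite -ball_normE/= ltcE/= b0 eqxx.
apply/nbhs_ballP; exists e%:C; first by rewrite /= ltcR.
move=> y; rewrite -ball_normE/= ltcE/= eqxx/= => xy; apply: eA.
by move: xy; case: (x - y).
Qed.

Lemma openC_normcP (A : set R[i]) :
  Defs.openC R A <->
  forall x, A x -> exists2 e : R, 0 < e & forall y, normc (x - y) < e -> A y.
Proof.
split => [oA x Ax|h].
  by apply/nbhs_normcP; apply: open_nbhs_nbhs; split.
by rewrite /Defs.openC/= openE => x /h /nbhs_normcP.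
Qed.

Lemma measurable_openC (A : set (borelC R)) : Defs.openC R A -> measurable A.
Proof. exact: sub_sigma_algebra. Qed.

Lemma lipschitz_measurable (f : R[i] -> R) :
  (forall x y, `|f x - f y| <= normc (x - y)) ->
  measurable_fun [set: borelC R] (f : borelC R -> R).
Proof.
move=> lf; move=> mT; apply: (measurability _ (RGenOInfty.measurableE R)) => //.
move=> _ [_ [r ->] <-]; rewrite setTI; apply: measurable_openC.
apply/openC_normcP => x /=; rewrite in_itv/= andbT => rx.
exists (f x - r); first by rewrite subr_gt0.
move=> y xy; rewrite /= in_itv/= andbT.
have := lf x y; rewrite ler_norml => /andP[_ h]; lra.
Qed.

Lemma measurable_Re : measurable_fun [set: borelC R] (@complex.Re R).
Proof.
apply: lipschitz_measurable => x y; rewrite (le_trans _ (Re_le_normc _))//.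
by case: x y => [a b] [c d].
Qed.

Lemma measurable_Im : measurable_fun [set: borelC R] (@complex.Im R).
Proof.
apply: lipschitz_measurable => x y; rewrite (le_trans _ (Im_le_normc _))//.
by case: x y => [a b] [c d].
Qed.

Lemma measurable_normc : measurable_fun [set: borelC R] (@normc R).
Proof. by apply: lipschitz_measurable; exact: ler_normc_dist. Qed.

Lemma measurable_normc_lt (r : R) :
  measurable ([set x | normc x < r] : set (borelC R)).
Proof.
rewrite -[X in measurable X]setTI.
rewrite (_ : [set x | _] = @normc R @^-1` `]-oo, r[%classic); last first.
  by apply/seteqP; split => x /=; rewrite in_itv.
exact: measurable_normc.
Qed.

Lemma measurable_normc_le (r : R) :
  measurable ([set x | normc x <= r] : set (borelC R)).
Proof.
rewrite -[X in measurable X]setTI.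
rewrite (_ : [set x | _] = @normc R @^-1` `]-oo, r]%classic); last first.
  by apply/seteqP; split => x /=; rewrite in_itv.
exact: measurable_normc.
Qed.

Lemma measurable_disc : measurable (disc R : set (borelC R)).
Proof. exact: measurable_normc_lt. Qed.

Lemma measurable_circle : measurable (circle R : set (borelC R)).
Proof.
rewrite -[X in measurable X]setTI.
rewrite (_ : circle R = @normc R @^-1` [set 1]); last by [].
exact: measurable_normc.
Qed.

(** Such a map factors through the measurable identification of the plane with
    R * R. *)
Lemma measurable_complex d (T : measurableType d) (f : T -> borelC R) :
  measurable_fun setT (fun t => complex.Re (f t)) ->
  measurable_fun setT (fun t => complex.Im (f t)) ->
  measurable_fun setT f.
Proof.
move=> mRe mIm.
have -> : f = @of_plane R \o (fun t => (complex.Re (f t), complex.Im (f t))).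
  by apply/funext => t; rewrite /of_plane/=; case: (f t).
apply: measurableT_comp; first exact: measurable_of_plane.
exact: measurable_fun_pair.
Qed.

Lemma continuous_of_plane : continuous (fun p : R * R => of_plane p : R[i]^o).
Proof.
move=> p A /nbhs_normcP[e e0 eA].
have e20 : 0 < e / 2 by rewrite divr_gt0.
exists (ball p.1 (e / 2), ball p.2 (e / 2)) => /=.
  by split; exact: nbhsx_ballx.
move=> [a b] /= [pa pb]; apply: eA.
rewrite (le_lt_trans (normc_le_ReIm _))//= [ltRHS]splitr ltrD//.
Qed.

Lemma closed_normc_le (r : R) : closed ([set x | normc x <= r] : set R[i]^o).
Proof.
rewrite -[X in closed X]setCK; apply: open_closedC.
apply/openC_normcP => x /= /negP; rewrite -ltNge => rx.
exists (normc x - r); first by rewrite subr_gt0.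
move=> y xy; apply/negP; rewrite -ltNge.
have := ler_normc_dist x y; rewrite ler_norml => /andP[_ h]; lra.
Qed.

Lemma compact_normc_le (r : R) : compact ([set x | normc x <= r] : set R[i]^o).
Proof.
apply: (@subclosed_compact _ _
  ((@of_plane R : R * R -> R[i]^o) @` (`[- r, r] `*` `[- r, r]))).
- exact: closed_normc_le.
- apply: continuous_compact; first exact/continuous_subspaceT/continuous_of_plane.
  by apply: compact_setX; exact: segment_compact.
- move=> [a b] /= abr; exists (a, b) => //=.
  rewrite !in_itv/= -!ler_norml; split.
    exact: le_trans (Re_le_normc (a +i* b)) abr.
  exact: le_trans (Im_le_normc (a +i* b)) abr.
Qed.

(** The closed disc of radius n/(n+1); these discs exhaust the unit disc. *)
Definition subdisc (n : nat) : set R[i] := [set x | normc x <= 1 - n.+1%:R^-1].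

Lemma subdisc_sub n : subdisc n `<=` disc R.
Proof.
by move=> x /= /le_lt_trans; apply; rewrite gtrBl invr_gt0.
Qed.

Lemma sub_subdisc m n : (m <= n)%N -> subdisc m `<=` subdisc n.
Proof.
move=> mn x /= /le_trans; apply.
by rewrite lerD2l lerNl opprK lef_pV2 ?posrE// ler_nat.
Qed.

Lemma disc_subdisc x : disc R x -> exists n, subdisc n x.
Proof.
move=> x1.
have x10 : 0 < 1 - normc x by rewrite subr_gt0.
have [n _ /(_ n (leqnn n)) h] := near_infty_natSinv_lt (PosNum x10).
have {}h : n.+1%:R^-1 < 1 - normc x := h.
by exists n; rewrite /subdisc/mkset lerBrDr addrC -lerBrDr ltW.
Qed.

Lemma disc_bigcup : disc R = \bigcup_n subdisc n.
Proof.
by apply/seteqP; split => [x /disc_subdisc[n]|x [n _]]; [exists n|exact: subdisc_sub].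
Qed.

Lemma measurable_subdisc n : measurable (subdisc n : set (borelC R)).
Proof. exact: measurable_normc_le. Qed.

Lemma relatively_compact_subdisc n (B : set R[i]) :
  B `<=` subdisc n -> relatively_compact_in_disc B.
Proof.
move=> Bn.
have cB : closure (B : set R[i]^o) `<=` subdisc n.
  rewrite (_ : subdisc n = closure (subdisc n : set R[i]^o)); last first.
    by rewrite -(closure_id _).1//; exact: closed_normc_le.
  exact: closureS.
split; last exact: subset_trans cB (@subdisc_sub n).
apply: (subclosed_compact _ (@compact_normc_le _) cB).
exact: closed_closure.
Qed.

(** The open discs with these radii cover the closure of D, which is compact. *)
Lemma relatively_compact_bounded (D : set R[i]) : relatively_compact_in_disc D ->
  exists n, D `<=` subdisc n.
Proof.
move=> [cD Ddisc].
have := cD; rewrite compact_cover.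
move=> /(_ nat setT (fun n => [set x : R[i]^o | normc x < 1 - n.+1%:R^-1])).
case.
- move=> n _; apply/openC_normcP => x /= xn.
  exists (1 - n.+1%:R^-1 - normc x); first by rewrite subr_gt0.
  by move=> y; exact: normc_lt_near.
- move=> x /Ddisc x1.
  have x10 : 0 < 1 - normc x by rewrite subr_gt0.
  have [n _ /(_ n (leqnn n)) h] := near_infty_natSinv_lt (PosNum x10).
  have {}h : n.+1%:R^-1 < 1 - normc x := h.
  by exists n => //; rewrite /mkset ltrBrDr addrC -ltrBrDr.
- move=> F _ Fcov.
  exists (\max_(i <- finmap.enum_fset F) i)%N => x Dx.
  have [i /= iF xi] := Fcov _ (subset_closure Dx).
  apply: (@sub_subdisc i); first exact: leq_bigmax_seq.
  by rewrite /subdisc/= ltW.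
Qed.

End complex_plane.

(** * Sums over a configuration as integrals *)

Section enumeration.
Context {R : realType}.
Local Open Scope ereal_scope.

(** The enumeration does not depend on the summand u, so that a single one
    turns all sums over a configuration into series; the option type allows for
    finite families. *)
Lemma esum_enumeration (T : choiceType) (A : set T) : countable A ->
  exists e : nat -> option T, forall u : T -> \bar R,
    (forall x, A x -> 0 <= u x) ->
    (forall n, 0 <= oapp u 0 (e n)) /\
    \esum_(x in A) u x = \sum_(n <oo) oapp u 0 (e n).
Proof.
move=> /countable_injP[f injf].
pose e n := if pselect (exists x, A x /\ f x = n) is left h
  then Some (projT1 (cid h)) else None.
exists e => u u0.
have eA x : A x -> e (f x) = Some x.
  move=> Ax; rewrite /e; case: pselect => [h|[]]; last by exists x.
  case: cid => y /= [Ay fyx]; congr Some.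
  by apply: injf => //; exact: mem_set.
have e0 n : 0 <= oapp u 0 (e n).
  rewrite /e; case: pselect => [ex|] //=.
  by have [/u0] := projT2 (cid ex).
split => //.
rewrite nneseries_esumT//.
have -> : \esum_(i in [set: nat]) oapp u 0 (e i) =
    \esum_(i in f @` A) oapp u 0 (e i).
  rewrite [RHS]esum_mkcond; apply: eq_esum => n _.
  case: ifPn => //; rewrite notin_setE => nA.
  by rewrite /e; case: pselect => [[x [Ax fx]]|] //=; case: nA; exists x.
rewrite (@reindex_esum _ _ _ A _ f).
  by apply: eq_esum => x Ax; rewrite eA.
split => //; by move=> x /= Ax; exists x.
Qed.

Lemma esumZl (T : choiceType) (A : set T) (c : R) (u : T -> \bar R) :
  countable A -> (0 <= c)%R -> (forall x, A x -> 0 <= u x) ->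
  \esum_(x in A) (c%:E * u x) = c%:E * \esum_(x in A) u x.
Proof.
move=> cA c0 u0; have [e he] := esum_enumeration cA.
have [e0 ->] := he u u0.
have [|_ ->] := he (fun x => c%:E * u x).
  by move=> x Ax; rewrite mule_ge0// ?lee_fin// u0.
rewrite -nneseriesZl//; apply: eq_eseriesr => n _.
by case: (e n) => //=; rewrite mule0.
Qed.

End enumeration.

Section counting_measure.
Context {R : realType}.
Implicit Types X : conf R.
Local Open Scope ereal_scope.

Lemma countable_points X : countable (points X).
Proof.
have -> : points X = \bigcup_n (points X `&` subdisc n).
  rewrite -setI_bigcupr -disc_bigcup setIidl//; exact: points_disc.
apply: bigcup_countable; first exact: countableP.
move=> n _; apply: finite_set_countable; apply: points_locally_finite.
exact: (@relatively_compact_subdisc _ n).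
Qed.

Definition enum_points X : nat -> option (borelC R) :=
  projT1 (cid (@esum_enumeration R _ _ (countable_points X))).

Lemma enum_pointsP X (u : borelC R -> \bar R) :
  (forall x, points X x -> 0 <= u x) ->
  (forall n, 0 <= oapp u 0 (enum_points X n)) /\
  \esum_(x in points X) u x = \sum_(n <oo) oapp u 0 (enum_points X n).
Proof. by rewrite /enum_points; case: cid => e /= /(_ u). Qed.

Definition odirac (o : option (borelC R)) : {measure set (borelC R) -> \bar R} :=
  if o is Some x then \d_x else mzero.

(** Sums over a configuration inherit the properties of integrals once the
    configuration is seen as a measure on the plane. *)
Definition point_measure X : {measure set (borelC R) -> \bar R} :=
  mseries (fun n => odirac (enum_points X n)) 0.

Lemma integral_odirac (o : option (borelC R)) (u : borelC R -> \bar R) :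
  measurable_fun setT u ->
  \int[odirac o]_x u x = oapp u 0 o.
Proof.
move=> mu; case: o => [x|] /=; first by rewrite integral_dirac// diracT mul1e.
by rewrite integral_measure_zero.
Qed.

Lemma integral_point_measure X (u : borelC R -> \bar R) :
  measurable_fun setT u -> (forall x, 0 <= u x) ->
  \int[point_measure X]_x u x = \esum_(x in points X) u x.
Proof.
move=> mu u0; rewrite ge0_integral_measure_series//.
have [//|_ ->] := @enum_pointsP X u.
by apply: eq_eseriesr => n _; exact: integral_odirac.
Qed.

Lemma point_measureE X (U : set (borelC R)) : measurable U ->
  point_measure X U = \esum_(x in points X) (\1_U x)%:E.
Proof.
move=> mU; rewrite -integral_point_measure.
- by rewrite integral_indic// setIT.
- by apply/measurable_EFinP; exact: measurable_indic.
- by move=> x; rewrite lee_fin.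
Qed.

Lemma esum_indic X (U : set (borelC R)) (k : nat) :
  ((points X `&` U) #= `I_k)%card ->
  \esum_(x in points X) (\1_U x)%:E = k%:R%:E :> \bar R.
Proof.
move=> Uk.
have finU : finite_set (points X `&` U) by apply/finite_setP; exists k.
transitivity (\esum_(x in points X `&` U) (1 : \bar R)).
  by rewrite esum_mkcondr; apply: eq_esum => x _; rewrite indicE; case: (x \in U).
rewrite esum_fset// fsbig_finite//= -(card_fset_set Uk).
by rewrite card_fset_sum1 natr_sum -sumEFin.
Qed.

(** Inside a compact subdisc the number of points is finite, hence the level
    sets of the counting function are generators of the sigma-algebra. *)
Lemma measurable_point_measure_bounded n (U : set (borelC R)) :
  measurable U -> U `<=` subdisc n ->
  measurable_fun [set: Conf_space R] (fun X => point_measure X U).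
Proof.
move=> mU Un.
have cU := relatively_compact_subdisc Un.
have kU X : exists k, ((points X `&` U) #= `I_k)%card.
  by apply/finite_setP; exact: points_locally_finite.
move=> _ B mB; rewrite setTI.
rewrite (_ : _ @^-1` B = \bigcup_(k in [set k | B k%:R%:E])
    [set X : Conf_space R | ((points X `&` U) #= `I_k)%card]); last first.
  apply/seteqP; split => X /=.
    have [k Xk] := kU X; rewrite point_measureE// (esum_indic Xk) => Bk.
    by exists k.
  by move=> [k /= Bk Xk]; rewrite point_measureE// (esum_indic Xk).
apply: bigcup_measurable => k _; apply: sub_sigma_algebra.
by exists U, k.
Qed.

Lemma point_measure_exhaust X (U : set (borelC R)) : measurable U ->
  point_measure X (U `&` subdisc n) @[n --> \oo] --> point_measure X U.
Proof.
move=> mU.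
have -> : point_measure X U = point_measure X (\bigcup_n (U `&` subdisc n)).
  rewrite -setI_bigcupr -disc_bigcup !point_measureE//; last first.
    by apply: measurableI => //; exact: measurable_disc.
  apply: eq_esum => x Xx; rewrite !indicE in_setI.
  by rewrite (mem_set (points_disc Xx)) andbT.
apply: nondecreasing_cvg_mu.
- by move=> n; apply: measurableI => //; exact: measurable_subdisc.
- by apply: bigcup_measurable => n _; apply: measurableI => //;
    exact: measurable_subdisc.
- by move=> m n mn; apply/subsetPset; apply: setIS; exact: sub_subdisc.
Qed.

Lemma measurable_point_measure (U : set (borelC R)) :
  measurable U -> measurable_fun [set: Conf_space R] (fun X => point_measure X U).
Proof.
move=> mU.
apply: (@emeasurable_fun_cvg _ _ _ setT
  (fun n (X : Conf_space R) => point_measure X (U `&` subdisc n))).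
  move=> n; apply: (@measurable_point_measure_bounded n) => //.
  by apply: measurableI => //; exact: measurable_subdisc.
by move=> X _; exact: point_measure_exhaust.
Qed.

Section joint.
Import HBNNSimple.
Context d (T : measurableType d).

Definition point_kernel (p : Conf_space R * T) :
  {measure set (borelC R) -> \bar R} := point_measure p.1.

Let measurable_point_kernel U : measurable U ->
  measurable_fun [set: Conf_space R * T] (fun p => point_kernel p U).
Proof.
move=> mU; rewrite /point_kernel.
apply: (@measurableT_comp _ _ _ _ _ _ (fun X : Conf_space R => point_measure X U)).
  exact: measurable_point_measure.
exact: measurable_fst.
Qed.

HB.instance Definition _ :=
  isKernel.Build _ _ (Conf_space R * T)%type (borelC R) R point_kernel
    measurable_point_kernel.

Let measurable_xsection_point_kernel (A : set ((Conf_space R * T) * borelC R)) :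
  measurable A ->
  measurable_fun setT (fun p => point_kernel p (xsection A p)).
Proof.
move=> mA.
apply: (@emeasurable_fun_cvg _ _ _ setT
  (fun n p => point_kernel p (xsection A p `&` subdisc n))); last first.
  move=> p _; apply: point_measure_exhaust; exact: measurable_xsection.
move=> n; have mn := @measurable_subdisc R n.
have := @measurable_prod_subset_xsection_kernel _ _ _ _ R
  [the kernel _ _ _ of point_kernel] _ mn.
move=> /(_ _ A mA)[]//.
move=> p; have [k pk] : exists k, ((points p.1 `&` subdisc n) #= `I_k)%card.
  apply/finite_setP; apply: points_locally_finite.
  exact: (@relatively_compact_subdisc _ n).
exists (k%:R + 1)%R => U mU; rewrite /mrestr/=.
apply: (@le_lt_trans _ _ (point_measure p.1 (subdisc n))).
  apply: le_measure; [exact/mem_set/measurableI|exact: mem_set|exact: subIsetr].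
by rewrite point_measureE// (esum_indic pk) lte_fin ltrDl.
Qed.

(** Joint measurability in the configuration and a parameter, for exchanging
    expectations with integrals over the circle: point_measure is a kernel that
    ignores the parameter. *)
Lemma measurable_esum_points_joint (f : T * borelC R -> \bar R) :
  measurable_fun setT f -> (forall p, 0 <= f p) ->
  measurable_fun [set: Conf_space R * T]
    (fun p => \esum_(x in points p.1) f (p.2, x)).
Proof.
move=> mf f0.
pose k (q : (Conf_space R * T) * borelC R) := f (q.1.2, q.2).
have mk : measurable_fun setT k.
  apply: (measurableT_comp mf); apply: measurable_fun_pair => //.
  apply: (@measurableT_comp _ _ _ _ _ _ (@snd (Conf_space R) T)).
    exact: measurable_snd.
  exact: measurable_fst.
rewrite (_ : (fun p => _) = (fun p => \int[point_kernel p]_x k (p, x))).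
  apply: (measurable_fun_xsection_integral k point_kernel
    (nnsfun_approx measurableT mk)).
  - by move=> a b ab; exact/nd_nnsfun_approx.
  - by move=> z; apply: cvg_nnsfun_approx => // q _; exact: f0.
  - move=> n r; apply: measurable_xsection_point_kernel.
    by [].
apply/funext => p; rewrite integral_point_measure//; last by move=> x; exact: f0.
apply: (measurableT_comp mf); exact: pair1_measurable.
Qed.

End joint.

Lemma measurable_esum_points (f : borelC R -> \bar R) :
  measurable_fun setT f -> (forall p, 0 <= f p) ->
  measurable_fun [set: Conf_space R] (fun X => \esum_(x in points X) f x).
Proof.
move=> mf f0.
rewrite (_ : (fun X => _) = (fun X => \int[point_measure X]_x f x)); last first.
  by apply/funext => X; rewrite integral_point_measure.
by apply: measurable_fun_integral_kernel => //; exact: measurable_point_measure.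
Qed.

End counting_measure.

(** * Invariance of the area under rotations and scalings *)

Section measure_preserving.
Context d (T : measurableType d) (R : realType).
Variable m : {measure set T -> \bar R}.
Local Open Scope ereal_scope.

(** The constant c is the factor by which f multiplies measures. *)
Definition preserving (c : \bar R) (f : T -> T) :=
  measurable_fun setT f /\
  forall U, measurable U -> c * m (f @^-1` U) = m U.

Lemma preserving1_comp f g : preserving 1 f -> preserving 1 g ->
  preserving 1 (g \o f).
Proof.
move=> [mf hf] [mg hg]; split; first exact: measurableT_comp.
move=> U mU.
have mgU : measurable (g @^-1` U) by rewrite -(setTI (_ @^-1` _)); exact: mg.
by rewrite comp_preimage hf// -(mul1e (m _)) hg.
Qed.

Lemma ge0_integral_preserving f (F : T -> \bar R) : preserving 1 f ->
  measurable_fun setT F -> (forall x, 0 <= F x) ->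
  \int[m]_x F (f x) = \int[m]_x F x.
Proof.
move=> [mf hf] mF F0.
transitivity (\int[pushforward m f]_x F x).
  by rewrite ge0_integral_pushforward// preimage_setT.
by apply: eq_measure_integral => //= A mA _; rewrite -[RHS]hf// mul1e.
Qed.

End measure_preserving.

Section lebesgue_plane.
Context {R : realType}.
Local Open Scope ereal_scope.
Local Notation leb := (@lebesgue_measure R).
Local Notation RR := (measurableTypeR R * measurableTypeR R)%type.
Local Notation leb2 := (leb \x leb).

Lemma lebesgue_measure_translation (a : R) (B : set (measurableTypeR R)) :
  measurable B -> leb ((fun x => (x + a)%R) @^-1` B) = leb B.
Proof.
move=> mB.
have mf : measurable_fun [set: measurableTypeR R]
    ((fun x => (x + a)%R) : _ -> measurableTypeR R).
  exact: measurable_funD.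
rewrite -/(pushforward leb ((fun x => (x + a)%R) : _ -> measurableTypeR R) B).
apply/esym; apply: lebesgue_measure_unique => //= _ [[b c] _ <-].
rewrite /pushforward.
rewrite (_ : _ @^-1` _ = `](b - a)%R, (c - a)%R]%classic); last first.
  by apply/seteqP; split => x /=; rewrite !in_itv/= ltrBlDr lerBrDr.
rewrite !lebesgue_measure_itv/= !lte_fin ltrD2r.
by case: ifP => // _; rewrite -!EFinB; congr EFin; ring.
Qed.

Lemma lebesgue_measure_scaling (t : R) (B : set (measurableTypeR R)) :
  (0 < t)%R -> measurable B ->
  t%:E * leb ((fun x => (t * x)%R) @^-1` B) = leb B.
Proof.
move=> t0 mB.
have mf : measurable_fun [set: measurableTypeR R]
    ((fun x => (t * x)%R) : _ -> measurableTypeR R).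
  exact: measurable_funM.
pose m : {measure set (measurableTypeR R) -> \bar R} :=
  mscale (NngNum (ltW t0))
   (pushforward leb ((fun x => (t * x)%R) : _ -> measurableTypeR R)).
transitivity (m mf B); first by [].
apply/esym; apply: lebesgue_measure_unique => //= _ [[b c] _ <-].
rewrite /m /= /mscale/= /pushforward.
rewrite (_ : _ @^-1` _ = `](b / t)%R, (c / t)%R]%classic); last first.
  apply/seteqP; split => x /=; rewrite !in_itv/=.
    by rewrite ltr_pdivrMr// ler_pdivlMr// !(mulrC x).
  by rewrite ltr_pdivrMr// ler_pdivlMr// !(mulrC x).
rewrite !lebesgue_measure_itv/= !lte_fin ltr_pM2r ?invr_gt0//.
case: ifP => _; last by rewrite mule0.
by rewrite -!EFinB -EFinM; congr EFin; field; rewrite gt_eqF.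
Qed.

(** By uniqueness of the product measure it is enough to look at rectangles. *)
Lemma preserving_rectangles (c : R) (f : RR -> RR) : (0 <= c)%R ->
  measurable_fun setT f ->
  (forall A B, measurable A -> measurable B ->
    c%:E * leb2 (f @^-1` (A `*` B)) = leb A * leb B) ->
  preserving leb2 c%:E f.
Proof.
move=> c0 mf h; split => // U mU.
pose m : {measure set RR -> \bar R} := mscale (NngNum c0) (pushforward leb2 f).
transitivity (m mf U); first by [].
by apply/esym; apply: (@product_measure_unique _ _ (measurableTypeR R)
  (measurableTypeR R) R leb leb (m mf)).
Qed.

Lemma preserving_swap : preserving leb2 1 (fun p : RR => ((p.2, p.1) : RR)).
Proof.
have mf : measurable_fun [set: RR] (fun p : RR => ((p.2, p.1) : RR)).
  by apply: measurable_fun_pair => //.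
apply: preserving_rectangles => // A B mA mB; rewrite mul1e (_ : _ @^-1` _ = B `*` A); last first.
  by apply/seteqP; split => -[x y] /= [].
by rewrite product_measure1E// muleC.
Qed.

Lemma preserving_shear (a : R) :
  preserving leb2 1 (fun p : RR => ((p.1, (p.2 + a * p.1)%R) : RR)).
Proof.
have mf : measurable_fun [set: RR]
    (fun p : RR => ((p.1, (p.2 + a * p.1)%R) : RR)).
  apply: measurable_fun_pair => //; apply: measurable_funD => //.
  exact: measurable_funM.
apply: preserving_rectangles => // A B mA mB; rewrite mul1e /product_measure1.
transitivity (\int[leb]_x ((\1_A x)%:E * leb B)).
  apply: eq_integral => x _ /=.
  rewrite indicE; have [xA|xA] := boolP (x \in A).
    rewrite mul1e -(lebesgue_measure_translation (a * x) mB).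
    congr (leb _); apply/seteqP; split => y /=; rewrite /xsection/= inE/=.
      by case.
    by move=> yB; split => //; exact: set_mem.
  rewrite mul0e (_ : xsection _ _ = set0) ?measure0//.
  apply/seteqP; split => y //=; rewrite /xsection/= inE/= => -[xA' _].
  by move: xA; rewrite notin_setE.
rewrite ge0_integralZr//; last first.
  by apply/measurable_EFinP; exact: measurable_indic.
by rewrite integral_indic// setIT.
Qed.

(** A rotation that is neither the identity nor minus the identity is a product
    of three shears; the swaps turn a shear along one axis into one along the
    other. *)
Lemma preserving_rotation (a b : R) : (a ^+ 2 + b ^+ 2 = 1)%R -> b != 0%R ->
  preserving leb2 1 (fun p : RR => ((a * p.1 - b * p.2, a * p.2 + b * p.1)%R : RR)).
Proof.
move=> ab b0.
pose s (c : R) (p : RR) : RR := (p.1, (p.2 + c * p.1)%R).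
pose w (p : RR) : RR := (p.2, p.1).
rewrite (_ : (fun p => _) =
  (w \o (s ((a - 1) / b)%R \o (w \o (s b \o
  (w \o (s ((a - 1) / b)%R \o w))))))); last first.
  have H : ((a - 1) / b * b = a - 1)%R by rewrite divfK.
  have H2 : ((a - 1) / b * (a + 1) = - b)%R.
    apply: (mulIf b0); rewrite mulrAC H.
    by transitivity (a ^+ 2 - 1)%R; [ring|rewrite -ab; ring].
  rewrite /s; move: ((a - 1) / b)%R H H2 => al H H2.
  have K1 (x y : R) :
      (a * x - b * y = x + al * y + al * (y + b * (x + al * y)))%R.
    transitivity (x + al * b * x + al * (al * b + 2) * y)%R; last by ring.
    rewrite H (_ : al * (a - 1 + 2) = al * (a + 1))%R; last by ring.
    by rewrite H2; ring.
  have K2 (x y : R) : (a * y + b * x = y + b * (x + al * y))%R.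
    transitivity (y + al * b * y + b * x)%R; last by ring.
    by rewrite H; ring.
  by apply/funext => -[x y] /=; rewrite K1 K2.
by repeat first [exact: preserving_swap | exact: preserving_shear |
  apply: preserving1_comp].
Qed.

Lemma preserving_scaling (t : R) : (0 < t)%R ->
  preserving leb2 (t ^+ 2)%:E (fun p : RR => ((t * p.1, t * p.2)%R : RR)).
Proof.
move=> t0.
have mf : measurable_fun [set: RR] (fun p : RR => ((t * p.1, t * p.2)%R : RR)).
  by apply: measurable_fun_pair; exact: measurable_funM.
have t20 : (0 <= t ^+ 2)%R by rewrite sqr_ge0.
apply: preserving_rectangles => // A B mA mB.
rewrite (_ : _ @^-1` _ =
  ((fun x => (t * x)%R) @^-1` A) `*` ((fun x => (t * x)%R) @^-1` B)); last first.
  by apply/seteqP; split => -[x y].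
have mt (C : set R) : measurable C -> measurable ((fun x => (t * x)%R) @^-1` C).
  move=> mC; rewrite -[X in measurable X]setTI.
  have : measurable_fun [set: measurableTypeR R] (fun x : R => (t * x)%R).
    exact: measurable_funM.
  by apply.
rewrite product_measure1E; [|exact: mt|exact: mt].
rewrite -(lebesgue_measure_scaling t0 mA) -(lebesgue_measure_scaling t0 mB).
by rewrite expr2 EFinM muleACA.
Qed.

End lebesgue_plane.

Section area.
Context {R : realType}.
Implicit Types x y z c eta : R[i].
Local Notation leb := (@lebesgue_measure R).
Local Notation RR := (measurableTypeR R * measurableTypeR R)%type.

Lemma preserving_area (k : \bar R) (f : borelC R -> borelC R) (g : RR -> RR) :
  measurable_fun setT f -> preserving (leb \x leb)%E k g ->
  (forall p, of_plane (g p) = f (of_plane p)) -> preserving (@area R) k f.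
Proof.
move=> mf [mg hg] gf; split => // U mU.
have mpU : measurable (@of_plane R @^-1` U).
  by rewrite -[X in measurable X]setTI; exact: measurable_of_plane.
have areaE V : area V = (((pi : R)^-1)%:E * (leb \x leb) (@of_plane R @^-1` V))%E.
  by [].
transitivity (k * area (f @^-1` U))%E; first by [].
transitivity (area U); last by [].
rewrite (areaE U) (areaE (f @^-1` U)) muleCA; congr (_ * _)%E.
rewrite -[RHS]hg//; congr (_ * (leb \x leb) _)%E.
by apply/seteqP; split => p /=; rewrite gf.
Qed.

Lemma measurable_mulC c : measurable_fun [set: borelC R] (fun x => c * x : borelC R).
Proof.
case: c => a b; apply: measurable_complex.
  rewrite (_ : (fun _ => _) = (fun x => a * complex.Re x - b * complex.Im x)).
    by apply: measurable_funB; apply: measurable_funM => //;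
      [exact: measurable_Re|exact: measurable_Im].
  by apply/funext => -[x y].
rewrite (_ : (fun _ => _) = (fun x => a * complex.Im x + b * complex.Re x)).
  by apply: measurable_funD; apply: measurable_funM => //;
    [exact: measurable_Im|exact: measurable_Re].
by apply/funext => -[x y].
Qed.

(** The half-turn is not a product of three shears, but it is the square of the
    quarter-turn. *)
Lemma area_rotation c : normc c = 1 -> preserving (@area R) 1%E ( *%R c).
Proof.
move=> c1.
have nc : complex.Re c ^+ 2 + complex.Im c ^+ 2 = 1.
  by rewrite -normc_sqr c1 expr1n.
have main u : complex.Re u ^+ 2 + complex.Im u ^+ 2 = 1 -> complex.Im u != 0 ->
    preserving (@area R) 1%E ( *%R u).
  move=> uu u0; apply: preserving_area (preserving_rotation uu u0) _.
    exact: measurable_mulC.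
  by case: u uu u0 => a b _ _ [x y].
have [b0|b0] := eqVneq (complex.Im c) 0; last exact: main.
have i2 : preserving (@area R) 1%E ( *%R ('i : R[i]) \o *%R ('i : R[i])).
  by apply: preserving1_comp; apply: main => /=; rewrite ?oner_eq0 ?expr0n ?add0r ?expr1n.
have : (complex.Re c - 1) * (complex.Re c + 1) = 0.
  by move: nc; rewrite b0 => nc; rewrite -subr_sqr; lra.
case: c {c1 nc} b0 => a b /= -> /eqP; rewrite mulf_eq0 => /orP[|].
  rewrite subr_eq0 => /eqP ->; split; first exact: measurable_mulC.
  move=> U mU; rewrite mul1e; congr (area _).
  by apply/seteqP; split => x /=; rewrite mul1r.
rewrite addr_eq0 => /eqP ->; congr (preserving _ _ _) : i2.
apply/funext => x /=; rewrite mulrA; congr (_ * _).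
by apply/eqP; rewrite eq_complex/=; apply/andP; split; apply/eqP; ring.
Qed.

Lemma area_scaling (t : R) : 0 < t -> preserving (@area R) (t ^+ 2)%:E ( *%R t%:C).
Proof.
move=> t0; apply: preserving_area (preserving_scaling t0) _.
  exact: measurable_mulC.
by move=> [x y]; apply/eqP; rewrite eq_complex/=; apply/andP; split; apply/eqP; ring.
Qed.

Lemma area_normc_lt (r : R) : 0 < r ->
  area ([set x : borelC R | normc x < r]) = ((r ^+ 2)%:E * area (disc R))%E.
Proof.
move=> r0; have [_ <-] := area_scaling r0; last exact: measurable_normc_lt.
congr (_ * area _)%E; apply/seteqP; split => x;
  by rewrite /preimage/mkset /disc /mkset normcM normc_real gtr0_norm// gtr_pMr.
Qed.

Lemma area_disc_fin : (area (disc R) < +oo)%E.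
Proof.
rewrite /area /pushforward /= /mscale/=.
pose Q : set R := `[-1, 1]%classic.
have mQ : measurable Q by exact: measurable_itv.
apply: lte_mul_pinfty => //; first by rewrite lee_fin invr_ge0 pi_ge0.
apply: (@le_lt_trans _ _ ((leb \x leb) (Q `*` Q))%E).
  apply: le_measure.
  - apply/mem_set; rewrite -[X in measurable X]setTI.
    by apply: measurable_of_plane => //; exact: measurable_disc.
  - apply/mem_set; exact: measurableX.
  - move=> [a b] /= ab; rewrite /Q/= !in_itv/= -!ler_norml; split.
      exact: le_trans (Re_le_normc (a +i* b)) (ltW ab).
    exact: le_trans (Im_le_normc (a +i* b)) (ltW ab).
rewrite product_measure1E//= /Q !lebesgue_measure_itv/= !lte_fin.
by case: ifP => _; rewrite ?mule0 ?ltry// -EFinB -EFinM ltry.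
Qed.

Lemma area_disc_gt0 : (0 < area (disc R))%E.
Proof.
rewrite /area /pushforward /= /mscale/=.
pose Q : set R := `[0, 2^-1]%classic.
have mQ : measurable Q by exact: measurable_itv.
apply: mule_gt0; first by rewrite lte_fin invr_gt0 pi_gt0.
apply: (@lt_le_trans _ _ ((leb \x leb) (Q `*` Q))%E); last first.
  apply: le_measure.
  - apply/mem_set; exact: measurableX.
  - apply/mem_set; rewrite -[X in measurable X]setTI.
    by apply: measurable_of_plane => //; exact: measurable_disc.
  - move=> [a b]; rewrite /Q/= !in_itv/= => -[/andP[a0 a1] /andP[b0 b1]].
    rewrite /disc/= -(ltr_pXn2r (n := 2)) ?nnegrE ?sqrtr_ge0//.
    by rewrite sqr_sqrtr ?addr_ge0 ?sqr_ge0//; nra.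
rewrite product_measure1E//= /Q !lebesgue_measure_itv/= !lte_fin.
by rewrite invr_gt0 ltr0n/= oppr0 adde0 -EFinM lte_fin mulr_gt0 ?invr_gt0.
Qed.

End area.

Lemma measurable_fun_invr d (T : measurableType d) (R : realType) (f : T -> R) :
  measurable_fun setT f -> (forall x, 0 <= f x) ->
  measurable_fun setT (fun x => (f x)^-1).
Proof.
move=> mf f0; rewrite (_ : (fun x => _) = (@powR R ^~ (-1)) \o f).
  by apply: measurableT_comp => //; exact: measurable_powR.
by apply/funext => x /=; rewrite powR_inv1.
Qed.

(** * The mean value property of the Poisson kernel *)

Section mean_value.
Context {R : realType}.
Implicit Types x y z c t u eta : R[i].

(** The Poisson kernel of the disc with pole at 1; its value at the product of
    the conjugate of zeta and z is the Poisson kernel with pole zeta at z. *)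
Definition pker t : R := (1 - normc t ^+ 2) / normc (1 - t) ^+ 2.

Lemma normc_1B t : 1 - normc t <= normc (1 - t).
Proof.
have := ler_normc_dist 1 t; rewrite normc1 => /(le_trans _) -> //.
exact: ler_norm.
Qed.

Lemma normc_1B_gt0 t : normc t < 1 -> 0 < normc (1 - t).
Proof. by move=> t1; apply: lt_le_trans (normc_1B t); rewrite subr_gt0. Qed.

Lemma normc_1B_le t : normc (1 - t) <= 1 + normc t.
Proof. by apply: le_trans (le_normcD _ _) _; rewrite normc1 normcN. Qed.

Lemma pker_ge0 t : normc t <= 1 -> 0 <= pker t.
Proof.
move=> t1; apply: divr_ge0; last exact: sqr_ge0.
by rewrite subr_ge0 -(expr1n _ 2) lerXn2r ?nnegrE ?normc_ge0.
Qed.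

Lemma pker_le t : normc t < 1 -> pker t <= (1 + normc t) / (1 - normc t).
Proof.
move=> t1; have h0 := normc_ge0 t; have h1 := normc_1B t.
have h2 : 0 < 1 - normc t by rewrite subr_gt0.
rewrite /pker ler_pdivrMr ?exprn_gt0 ?normc_1B_gt0//.
rewrite mulrAC ler_pdivlMr//.
rewrite (_ : _ * _ = (1 + normc t) * (1 - normc t) ^+ 2); last by ring.
rewrite ler_pM2l; last by rewrite ltr_pwDl.
by rewrite lerXn2r ?nnegrE ?normc_ge0// ltW.
Qed.

Lemma pker_ge t : normc t < 1 -> (1 - normc t) / (1 + normc t) <= pker t.
Proof.
move=> t1; have h0 := normc_ge0 t; have h1 := normc_1B_le t.
have h2 : 0 < 1 - normc t by rewrite subr_gt0.
have h3 : 0 < 1 + normc t by rewrite ltr_pwDl.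
rewrite /pker ler_pdivlMr ?exprn_gt0 ?normc_1B_gt0//.
rewrite mulrAC ler_pdivrMr//.
rewrite [leRHS](_ : _ = (1 - normc t) * (1 + normc t) ^+ 2); last by ring.
rewrite ler_pM2l//.
by rewrite lerXn2r ?nnegrE ?normc_ge0// ltW.
Qed.

(** Expand pker t in powers of t and of its conjugate: the even powers survive
    on the left, and they make up the expansion of pker (t ^+ 2). This identity
    replaces the series in the proof of the mean value property. *)
Lemma pkerD t : normc t < 1 -> pker t + pker (- t) = 2 * pker (t ^+ 2).
Proof.
move=> t1.
have h1 := normc_1B_gt0 t1.
have h2 : 0 < normc (1 + t).
  by rewrite -[t in X in _ < X](opprK t); apply: normc_1B_gt0; rewrite normcN.
have -> : pker (t ^+ 2) =
    (1 - normc t ^+ 4) / (normc (1 - t) ^+ 2 * normc (1 + t) ^+ 2).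
  have e : 1 - t ^+ 2 = (1 - t) * (1 + t) by ring.
  have e' : normc (t ^+ 2) = normc t ^+ 2 by rewrite expr2 normcM.
  by rewrite /pker e e' -exprM (normcM (1 - t)) exprMn.
rewrite /pker normcN opprK.
have E : normc (1 - t) ^+ 2 + normc (1 + t) ^+ 2 = 2 * (1 + normc t ^+ 2).
  by rewrite !normc_sqr; case: (t) => a b /=; ring.
have {}h1 : normc (1 - t) ^+ 2 != 0 by rewrite expf_neq0// gt_eqF.
have {}h2 : normc (1 + t) ^+ 2 != 0 by rewrite expf_neq0// gt_eqF.
rewrite addf_div// [RHS]mulrA; congr (_ / _).
by rewrite -mulrDr (addrC (normc (1 + t) ^+ 2)) E; ring.
Qed.

Lemma measurable_pker : measurable_fun [set: borelC R] pker.
Proof.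
apply: measurable_funM.
  apply: measurable_funB => //; apply: measurable_funX.
  exact: measurable_normc.
apply: measurable_fun_invr; last by move=> x; exact: sqr_ge0.
apply: measurable_funX.
apply: lipschitz_measurable => x y; apply: le_trans (ler_normc_dist _ _) _.
by rewrite (_ : 1 - x - (1 - y) = - (x - y)) ?normcN//; ring.
Qed.

Definition radial_set (D : set R[i]) := forall x y, normc x = normc y -> D x -> D y.

Lemma integral_rotation c (D : set (borelC R)) (F : borelC R -> \bar R) :
  normc c = 1 -> measurable D -> radial_set D ->
  measurable_fun setT F -> (forall x, D x -> 0 <= F x)%E ->
  (\int[@area R]_(x in D) F (c * x)%R = \int[@area R]_(x in D) F x)%E.
Proof.
move=> c1 mD rD mF F0.
have nc x : normc (c * x) = normc x by rewrite normcM c1 mul1r.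
rewrite [LHS]integral_mkcond [RHS]integral_mkcond.
rewrite -[RHS](ge0_integral_preserving (area_rotation c1)); last 2 first.
- by apply/(measurable_restrictT F) => //; exact: measurable_funTS.
- exact: erestrict_ge0.
apply: eq_integral => x _; rewrite /patch/=.
have -> : (c * x \in D) = (x \in D); last by [].
by apply/idP/idP => /set_mem h; apply/mem_set; apply: rD h; rewrite nc.
Qed.

Lemma root_Nexpn (k : nat) : exists c : R[i], normc c = 1 /\ c ^+ (2 ^ k) = -1.
Proof.
elim: k => [|k [c [c1 ck]]].
  by exists (-1); rewrite normcN normc1 expr1.
exists (sqrtc c); have cc := sqr_sqrtc c; split; last by rewrite expnS exprM cc.
apply/eqP; rewrite -sqrp_eq1 ?normc_ge0//.
by rewrite expr2 -normcM -expr2 cc c1.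
Qed.

Lemma normcX t n : normc (t ^+ n) = normc t ^+ n.
Proof. by elim: n => [|n IH]; rewrite ?expr0 ?normc1// !exprS normcM IH. Qed.

Lemma expr_small (q r : R) : 0 <= q -> q < 1 -> 0 < r ->
  exists k, q ^+ (2 ^ k) < r.
Proof.
move=> q0 q1 r0.
have : (q ^+ n @[n --> \oo] --> (0 : R))%classic.
  by apply: cvg_expr; rewrite ger0_norm.
move=> /cvgrPdist_lt /(_ r r0) [N _ hN]; exists N.
have := hN (2 ^ N)%N; rewrite /= sub0r normrN ger0_norm ?exprn_ge0//; apply.
by rewrite ltnW// ltn_expl.
Qed.

Section fixed_radius.
Variables (n : nat) (rho : borelC R -> R) (eta : R[i]).
Hypotheses (mrho : measurable_fun setT rho) (rho0 : forall x, 0 <= rho x).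
Hypothesis radial_rho : forall x y, normc x = normc y -> rho x = rho y.
Hypothesis eta1 : normc eta <= 1.
Local Open Scope ereal_scope.

Let arg (k : nat) (x : R[i]) : R[i] := ((eta^* * x) ^+ (2 ^ k))%R.

Let q : R := (1 - n.+1%:R^-1)%R.

Let arg_le k x : subdisc n x -> (normc (arg k x) <= q ^+ (2 ^ k))%R.
Proof.
move=> xn; rewrite normcX; apply: lerXn2r; rewrite ?nnegrE ?normc_ge0//.
  by rewrite subr_ge0 invf_le1// ler1n.
rewrite normcM normc_conj (le_trans _ xn)//.
by rewrite ler_piMl ?normc_ge0.
Qed.

Let q_ge0 : (0 <= q)%R. Proof. by rewrite subr_ge0 invf_le1// ler1n. Qed.
Let q_lt1 : (q < 1)%R. Proof. by rewrite gtrBl invr_gt0. Qed.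

Let arg_lt1 k x : subdisc n x -> (normc (arg k x) < 1)%R.
Proof.
move=> /(arg_le k) /le_lt_trans; apply.
by rewrite exprn_ilt1// -lt0n expn_gt0.
Qed.

Let measurable_exprC (m : nat) :
  measurable_fun [set: borelC R] (fun x => (x ^+ m)%R : borelC R).
Proof.
elim: m => [|m IH].
  under eq_fun do rewrite expr0; exact: measurable_cst.
have [mr mi] : measurable_fun [set: borelC R] (fun x => complex.Re (x ^+ m)%R) /\
    measurable_fun [set: borelC R] (fun x => complex.Im (x ^+ m)%R).
  by split; apply: measurableT_comp IH; [exact: measurable_Re|exact: measurable_Im].
apply: measurable_complex.
  rewrite (_ : (fun x => _) = (fun x => complex.Re x * complex.Re (x ^+ m) -
     complex.Im x * complex.Im (x ^+ m))%R); last first.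
    by apply/funext => x; rewrite exprS; case: (x) (x ^+ m)%R => [a b] [c d].
  by apply: measurable_funB; apply: measurable_funM => //;
    [exact: measurable_Re|exact: measurable_Im].
rewrite (_ : (fun x => _) = (fun x => complex.Re x * complex.Im (x ^+ m) +
     complex.Im x * complex.Re (x ^+ m))%R); last first.
  by apply/funext => x; rewrite exprS; case: (x) (x ^+ m)%R => [a b] [c d].
by apply: measurable_funD; apply: measurable_funM => //;
  [exact: measurable_Re|exact: measurable_Im].
Qed.

Let measurable_arg k : measurable_fun [set: borelC R] (arg k : _ -> borelC R).
Proof. by apply: (measurableT_comp (measurable_exprC _)); exact: measurable_mulC. Qed.

Let F k x : \bar R := (rho x * pker (arg k x))%:E.

Let mF k : measurable_fun [set: borelC R] (F k).
Proof.
apply/measurable_EFinP; apply: measurable_funM => //.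
by apply: (measurableT_comp measurable_pker); exact: measurable_arg.
Qed.

Let F0 k x : subdisc n x -> 0 <= F k x.
Proof.
by move=> xn; rewrite lee_fin mulr_ge0// pker_ge0// ltW// arg_lt1.
Qed.

(** A rotation whose 2 ^ k-th power is -1 changes the sign of the argument of
    pker and leaves the integral unchanged, hence the integral of F k is that of
    the average in pkerD. *)
Let F_double k : \int[@area R]_(x in subdisc n) F k x =
  \int[@area R]_(x in subdisc n) F k.+1 x.
Proof.
have [c [c1 ck]] := root_Nexpn k.
have mn := @measurable_subdisc R n.
have rn : radial_set (subdisc n) by move=> x y xy; rewrite /subdisc /mkset xy.
set A := LHS; set B := RHS.
have A0 : 0 <= A by apply: integral_ge0; exact: F0.
have B0 : 0 <= B by apply: integral_ge0; exact: F0.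
have AB : A + A = B + B.
  rewrite {2}/A -(integral_rotation c1 mn rn (mF k) (@F0 k)) -!ge0_integralD//.
  - apply: eq_integral => x /set_mem xn.
    have -> : F k (c * x)%R = (rho x * pker (- arg k x))%:E.
      rewrite /F (radial_rho (y := x)) ?normcM ?c1 ?mul1r//.
      by congr (_ * pker _)%:E; rewrite /arg mulrCA exprMn ck mulN1r.
    have E : (arg k x ^+ 2 = arg k.+1 x)%R by rewrite /arg -exprM expnSr.
    rewrite /F -!EFinD -!(mulrDr (rho x)) pkerD ?arg_lt1// E.
    by rewrite (mulr_natl (pker _)) mulr2n.
  - exact: F0.
  - exact: measurable_funTS.
  - exact: F0.
  - exact: measurable_funTS.
  - exact: F0.
  - exact: measurable_funTS.
  - move=> x xn; apply: F0; apply: rn xn; by rewrite normcM c1 mul1r.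
  - apply: measurable_funTS; apply: (measurableT_comp (mF k)).
    exact: measurable_mulC.
move: AB A0 B0; case: (A) => [a| |]; case: (B) => [b| |] //=.
by move=> [ab] _ _; congr EFin; lra.
Qed.

(** By F_double the argument of pker may be replaced by an arbitrarily high
    power, which is uniformly small on a subdisc, where pker is then close to
    its value 1 at the origin. *)
Lemma mean_value_subdisc :
  \int[@area R]_(x in subdisc n) (rho x * pker (eta^* * x))%:E =
  \int[@area R]_(x in subdisc n) (rho x)%:E.
Proof.
have mn := @measurable_subdisc R n.
have FE k : \int[@area R]_(x in subdisc n) (rho x * pker (eta^* * x))%:E =
    \int[@area R]_(x in subdisc n) F k x.
  by elim: k => [//|k ->]; exact: F_double.
have mr : measurable_fun (subdisc n : set (borelC R)) (fun x => (rho x)%:E).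
  by apply: measurable_funTS; exact/measurable_EFinP.
have bound (r : R) : (0 < r < 1)%R -> exists k, forall x, subdisc n x ->
    (r <= pker (arg k x) /\ r * pker (arg k x) <= 1)%R.
  move=> /andP[r0 r1].
  have e0 : (0 < (1 - r) / 2)%R by rewrite divr_gt0// subr_gt0.
  have [k qk] := expr_small q_ge0 q_lt1 e0; exists k => x xn.
  have a1 := arg_lt1 k xn; have a2 := normc_ge0 (arg k x).
  have a3 : (normc (arg k x) <= (1 - r) / 2)%R.
    exact: le_trans (arg_le k xn) (ltW qk).
  have p1 := pker_ge a1; have p2 := pker_le a1.
  move: (normc (arg k x)) (pker (arg k x)) a1 a2 a3 p1 p2 => a p a1 a2 a3.
  rewrite ler_pdivrMr ?ltr_pwDl// ler_pdivlMr ?subr_gt0// => p1 p2.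
  have p0 : (0 <= p)%R by nra.
  by split; nra.
apply/eqP; rewrite eq_le; apply/andP; split; apply/lee_mul01Pr.
- by rewrite (FE 0%N); apply: integral_ge0; exact: F0.
- move=> r /[dup] r01 /bound [k hk]; rewrite (FE k) -ge0_integralZl_EFin//.
  + apply: ge0_le_integral => //.
    * by move=> x xn; rewrite mule_ge0 ?F0// lee_fin; case/andP: r01 => /ltW.
    * apply: measurable_funTS; apply: measurable_funeM; exact: mF.
    * move=> x xn; rewrite /F -EFinM lee_fin mulrCA ler_piMr//.
      by have [] := hk _ xn.
  + exact: F0.
  + exact: measurable_funTS.
  + by case/andP: r01 => /ltW.
- by apply: integral_ge0 => x _; rewrite lee_fin.
- move=> r /[dup] r01 /bound [k hk]; rewrite (FE k) -ge0_integralZl_EFin//.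
  + apply: ge0_le_integral => //.
    * by move=> x xn; rewrite mule_ge0 // lee_fin//; case/andP: r01 => /ltW.
    * exact: measurable_funeM.
    * exact: measurable_funTS.
    * move=> x xn; rewrite /F -EFinM lee_fin mulrC ler_wpM2l//.
      by have [] := hk _ xn.
  + by move=> x _; rewrite lee_fin.
  + by case/andP: r01 => /ltW.
Qed.

End fixed_radius.

Lemma integral_disc_lim (F : borelC R -> \bar R) :
  measurable_fun setT F -> (forall x, disc R x -> 0 <= F x)%E ->
  (\int[@area R]_(x in subdisc n) F x @[n --> \oo] -->
   \int[@area R]_(x in disc R) F x)%E.
Proof.
move=> mF F0; rewrite disc_bigcup.
apply: ge0_nondecreasing_set_cvg_integral.
- by move=> m n mn; apply/subsetPset; exact: sub_subdisc.
- by move=> n; exact: measurable_subdisc.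
- by move=> n; exact: measurable_funTS.
- by move=> n x /subdisc_sub; exact: F0.
Qed.

Lemma measurable_pker_conjM eta :
  measurable_fun [set: borelC R] (fun x => pker (eta^* * x)).
Proof. by apply: (measurableT_comp measurable_pker); exact: measurable_mulC. Qed.

Lemma normc_conjM_lt1 eta x : normc eta <= 1 -> disc R x -> normc (eta^* * x) < 1.
Proof.
move=> e1 x1; rewrite normcM normc_conj; apply: le_lt_trans x1.
by rewrite ler_piMl ?normc_ge0.
Qed.

(** The kernel is harmonic in x with value 1 at the origin, so that its mean over
    each circle around the origin is 1. *)
Lemma mean_value (rho : borelC R -> R) eta :
  measurable_fun setT rho -> (forall x, 0 <= rho x) ->
  (forall x y, normc x = normc y -> rho x = rho y) -> normc eta <= 1 ->
  (\int[@area R]_(x in disc R) (rho x * pker (eta^* * x))%:E =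
   \int[@area R]_(x in disc R) (rho x)%:E)%E.
Proof.
move=> mrho rho0 rrho eta1.
have h1 : (\int[@area R]_(x in subdisc n) (rho x * pker (eta^* * x))%:E @[n --> \oo]
    --> \int[@area R]_(x in disc R) (rho x * pker (eta^* * x))%:E)%E.
  apply: integral_disc_lim.
    by apply/measurable_EFinP; apply: measurable_funM => //;
      exact: measurable_pker_conjM.
  move=> x x1; rewrite lee_fin mulr_ge0// pker_ge0//.
  by rewrite ltW// normc_conjM_lt1.
have h2 : (\int[@area R]_(x in subdisc n) (rho x)%:E @[n --> \oo]
    --> \int[@area R]_(x in disc R) (rho x)%:E)%E.
  by apply: integral_disc_lim => [|x _]; [exact/measurable_EFinP|rewrite lee_fin].
apply: cvg_unique h1 _ => //.
rewrite (_ : (fun n : nat => _) =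
  (fun n : nat => \int[@area R]_(x in subdisc n) (rho x)%:E)%E) //.
by apply/funext => n; exact: mean_value_subdisc.
Qed.

End mean_value.

(** * The mass of the weights *)

Section constant_bounds.
Context d (T : measurableType d) (R : realType) (m : {measure set T -> \bar R}).
Variables (D : set T) (f : T -> \bar R) (c : R).
Hypotheses (mD : measurable D) (mf : measurable_fun D f) (c0 : 0 <= c).
Local Open Scope ereal_scope.

Lemma ge0_integral_le_cst : (forall x, D x -> 0 <= f x) ->
  (forall x, D x -> f x <= c%:E) -> \int[m]_(x in D) f x <= c%:E * m D.
Proof.
by move=> f0 fc; rewrite -integral_cst//; apply: ge0_le_integral.
Qed.

Lemma ge0_integral_ge_cst :
  (forall x, D x -> c%:E <= f x) -> c%:E * m D <= \int[m]_(x in D) f x.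
Proof.
by move=> fc; rewrite -integral_cst//; apply: ge0_le_integral => // x _; rewrite lee_fin.
Qed.

End constant_bounds.

Section mass.
Context {R : realType}.
Implicit Types x y z : R[i].

(** The exponential of minus the hyperbolic distance to the origin. *)
Definition hyp x : R := (1 - normc x) / (1 + normc x).

(** The diagonal of the Bergman kernel. *)
Definition intensity x : R := ((1 - normc x ^+ 2) ^+ 2)^-1.

Lemma disc_sqr_lt1 x : disc R x -> 0 < 1 - normc x ^+ 2.
Proof. by move=> x1; rewrite subr_gt0 expr_lt1 ?normc_ge0. Qed.

Lemma hyp_gt0 x : disc R x -> 0 < hyp x.
Proof. by move=> x1; rewrite divr_gt0 ?subr_gt0// ltr_pwDl ?normc_ge0. Qed.

Lemma hyp_le1 x : hyp x <= 1.
Proof.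
have x0 := normc_ge0 x.
by rewrite ler_pdivrMr ?ltr_pwDl// mul1r lerD2l ge0_cp.
Qed.

Lemma hyp_le x : disc R x -> hyp x <= 1 - normc x ^+ 2.
Proof.
move=> x1; have x0 := normc_ge0 x; have {x1} : normc x < 1 := x1.
by rewrite /hyp ler_pdivrMr ?ltr_pwDl//; move: (normc x) x0 => a a0 a1; nra.
Qed.

Lemma hyp_ge x : disc R x -> (1 - normc x ^+ 2) / 4 <= hyp x.
Proof.
move=> x1; have x0 := normc_ge0 x; have {x1} : normc x < 1 := x1.
rewrite /hyp ler_pdivlMr ?ltr_pwDl//; move: (normc x) x0 => a a0 a1.
rewrite mulrAC ler_pdivrMr//.
have : 0 <= (1 - a) * ((1 - a) * (3 + a)) by rewrite !mulr_ge0//; lra.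
by nra.
Qed.

Lemma intensity_ge0 x : 0 <= intensity x.
Proof. by rewrite invr_ge0 sqr_ge0. Qed.

Lemma measurable_hyp : measurable_fun [set: borelC R] hyp.
Proof.
apply: measurable_funM.
  by apply: measurable_funB => //; exact: measurable_normc.
apply: measurable_fun_invr; last by move=> x; rewrite addr_ge0 ?normc_ge0.
by apply: measurable_funD => //; exact: measurable_normc.
Qed.

Lemma measurable_hyp_powR s : measurable_fun [set: borelC R] (fun x => hyp x `^ s).
Proof. exact: (measurableT_comp (@measurable_powR R s) measurable_hyp). Qed.

Lemma measurable_intensity : measurable_fun [set: borelC R] intensity.
Proof.
apply: measurable_fun_invr; last by move=> x; exact: sqr_ge0.
by apply: measurable_funX; apply: measurable_funB => //;
  apply: measurable_funX; exact: measurable_normc.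
Qed.

Definition mass_density s x : R := hyp x `^ s * intensity x.

Lemma mass_density_ge0 s x : 0 <= mass_density s x.
Proof. by rewrite mulr_ge0 ?powR_ge0 ?intensity_ge0. Qed.

Lemma measurable_mass_density s :
  measurable_fun [set: borelC R] (mass_density s).
Proof.
by apply: measurable_funM; [exact: measurable_hyp_powR|exact: measurable_intensity].
Qed.

Lemma mass_density_radial s x y : normc x = normc y ->
  mass_density s x = mass_density s y.
Proof. by rewrite /mass_density /hyp /intensity => ->. Qed.

(** The expected value of the sum of the s-th powers of hyp. *)
Definition mass s : \bar R := (\int[@area R]_(x in disc R) (mass_density s x)%:E)%E.

Lemma mass_ge0 s : (0 <= mass s)%E.
Proof. by apply: integral_ge0 => x _; rewrite lee_fin mass_density_ge0. Qed.

Lemma le_mass s t : s <= t -> (mass t <= mass s)%E.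
Proof.
move=> st; apply: ge0_le_integral => //.
- exact: measurable_disc.
- by move=> x _; rewrite lee_fin mass_density_ge0.
- by apply/measurable_funTS/measurable_EFinP; exact: measurable_mass_density.
- by apply/measurable_funTS/measurable_EFinP; exact: measurable_mass_density.
- move=> x x1; rewrite lee_fin ler_wpM2r ?intensity_ge0//.
  by apply: ger_powR => //; rewrite hyp_gt0// hyp_le1.
Qed.

(** On the dyadic annulus A k the defect 1 - |x|^2 is between 2 ^- k.+1 and
    2 ^- k, the intensity is of order 4 ^ k and the area of order 2 ^- k. Hence
    A k contributes about 2 ^ (k (1 - s)) to the mass. *)
Let D k : set (borelC R) := [set x | normc x < Num.sqrt (1 - 2 ^- k)].
Let A k : set (borelC R) := D k.+1 `\` D k.

Let pow2 k : 0 < 2 ^- k :> R. Proof. by rewrite invr_gt0 exprn_gt0. Qed.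
Let pow2_le1 k : 2 ^- k <= 1 :> R. Proof. by rewrite invf_le1 ?exprn_gt0// exprn_ege1// ler1n. Qed.

Let mD k : measurable (D k). Proof. exact: measurable_normc_lt. Qed.
Let mA k : measurable (A k). Proof. by apply: measurableD; exact: mD. Qed.

Let D_E k x : D k x <-> normc x ^+ 2 < 1 - 2 ^- k.
Proof.
rewrite /D /mkset -[in X in _ <-> X](@sqr_sqrtr _ (1 - 2 ^- k)) ?subr_ge0//.
by rewrite ltr_pXn2r// ?nnegrE ?normc_ge0// sqrtr_ge0.
Qed.

Let D_disc k : D k `<=` disc R.
Proof.
move=> x /D_E xk; rewrite /disc/mkset -(expr_lt1 (n := 2)) ?normc_ge0//.
by apply: lt_trans xk _; rewrite gtrBl.
Qed.

Let a : R := fine (area (disc R)).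
Let aE : area (disc R) = a%:E.
Proof. by rewrite fineK// ge0_fin_numE ?area_disc_fin. Qed.
Let a_gt0 : 0 < a.
Proof. by rewrite -lte_fin -aE; exact: area_disc_gt0. Qed.

Let area_D k : area (D k) = ((1 - 2 ^- k) * a)%:E.
Proof.
have : 0 <= Num.sqrt (1 - 2 ^- k : R) by exact: sqrtr_ge0.
rewrite le_eqVlt => /predU1P[h0|h0]; last first.
  by rewrite area_normc_lt// aE -EFinM sqr_sqrtr// subr_ge0.
have -> : 1 - 2 ^- k = 0 :> R.
  apply/eqP; rewrite eq_le subr_ge0 pow2_le1 andbT.
  by move/eqP : h0; rewrite eq_sym sqrtr_eq0.
rewrite mul0r (_ : D k = set0) ?measure0//.
by apply/seteqP; split => x //; rewrite /D /mkset -h0 ltNge normc_ge0.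
Qed.

Let D_subS k : D k `<=` D k.+1.
Proof.
move=> x /D_E xk; apply/D_E; apply: lt_le_trans xk _.
rewrite lerD2l lerNl opprK lef_pV2 ?posrE ?exprn_gt0//.
by rewrite exprS ler_peMl ?exprn_ge0// ler1n.
Qed.

Let area_A k : area (A k) = (2 ^- k.+1 * a)%:E.
Proof.
have : area (D k.+1) = (area (D k) + area (A k))%E.
  rewrite -measureU//; last by rewrite /A setDE setIA setIAC setICr set0I.
  by rewrite /A setDUK//; exact: D_subS.
rewrite !area_D.
have : (0 <= area (A k))%E by [].
case: (area (A k)) => [r| |]// _ -[h]; congr EFin.
rewrite (_ : r = (1 - 2 ^- k.+1) * a - (1 - 2 ^- k) * a); last by rewrite h; ring.
by rewrite exprS invfM; field.
Qed.

Let A_E k x : A k x -> 2 ^- k.+1 < 1 - normc x ^+ 2 /\ 1 - normc x ^+ 2 <= 2 ^- k.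
Proof.
move=> [/D_E x1 /D_E/negP]; rewrite -leNgt => x2.
by split; [rewrite ltrBrDr addrC -ltrBrDr|rewrite lerBlDr addrC -lerBlDr].
Qed.

Let f s x : \bar R := (mass_density s x)%:E.

Let mf s E : measurable_fun (E : set (borelC R)) (f s).
Proof.
by apply/measurable_funTS/measurable_EFinP; exact: measurable_mass_density.
Qed.

Let integral_D s k : (\int[@area R]_(x in D k.+1) f s x =
  \int[@area R]_(x in D k) f s x + \int[@area R]_(x in A k) f s x)%E.
Proof.
rewrite -ge0_integral_setU//.
- by rewrite /A setDUK//; exact: D_subS.
- by move=> x _; rewrite lee_fin mass_density_ge0.
- by apply/disj_setPS => x [? []].
Qed.

Let pow2_powR k s : (2 ^- k) `^ s = (2 `^ (- s)) ^+ k :> R.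
Proof.
by rewrite -powR_mulrn ?powR_ge0// -powR_invn// -!powRrM; congr (_ `^ _); ring.
Qed.

Let pow2_1B s : 2 `^ (1 - s) = 2 * 2 `^ (- s) :> R.
Proof. by rewrite powRD ?pnatr_eq0 ?implybT// powRr1. Qed.

Let integral_A_le s k : 0 <= s ->
  (\int[@area R]_(x in A k) f s x <= (2 * a * (2 `^ (1 - s)) ^+ k)%:E)%E.
Proof.
move=> s0.
rewrite (_ : 2 * a * (2 `^ (1 - s)) ^+ k =
    ((2 ^- k) `^ s * (2 ^+ k.+1) ^+ 2) * (2 ^- k.+1 * a)); last first.
  rewrite pow2_powR pow2_1B exprMn (exprS 2 k); field.
  by rewrite gt_eqF// exprn_gt0.
rewrite EFinM -area_A; apply: ge0_integral_le_cst; [exact: mA|exact: mf| |].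
- by move=> x _; rewrite lee_fin mass_density_ge0.
move=> x xk; have [x1 x2] := A_E xk.
have xd : disc R x by case: xk => /D_disc.
rewrite lee_fin; apply: ler_pM; rewrite ?powR_ge0 ?intensity_ge0//.
  apply: ge0_ler_powR => //.
  - by rewrite nnegrE ltW// hyp_gt0.
  - by rewrite nnegrE ltW.
  - by apply: le_trans x2; exact: hyp_le.
rewrite /intensity -exprVn lerXn2r ?nnegrE ?invr_ge0 ?exprn_ge0//.
  by rewrite ltW// disc_sqr_lt1.
by rewrite -[leRHS]invrK lef_pV2 ?posrE ?disc_sqr_lt1// ltW.
Qed.

Let integral_A_ge s k : 0 <= s ->
  ((8 `^ (- s) / 2 * a * (2 `^ (1 - s)) ^+ k)%:E <= \int[@area R]_(x in A k) f s x)%E.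
Proof.
move=> s0.
rewrite (_ : 8 `^ (- s) / 2 * a * (2 `^ (1 - s)) ^+ k =
    ((2 ^- k.+1 / 4) `^ s * (2 ^+ k) ^+ 2) * (2 ^- k.+1 * a)); last first.
  have -> : (2 ^- k.+1 / 4) `^ s = 8 `^ (- s) * (2 ^- k) `^ s :> R.
    rewrite (_ : 2 ^- k.+1 / 4 = 8^-1 * 2 ^- k); last first.
      by rewrite (exprS 2 k); field; rewrite gt_eqF// exprn_gt0.
    by rewrite powRM ?invr_ge0// -powR_inv1// -powRrM mulN1r.
  rewrite pow2_powR pow2_1B exprMn (exprS 2 k); field.
  by rewrite gt_eqF// exprn_gt0.
rewrite EFinM -area_A; apply: ge0_integral_ge_cst; [exact: mA|exact: mf| |].
  by rewrite mulr_ge0 ?powR_ge0 ?sqr_ge0.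
move=> x xk; have [x1 x2] := A_E xk.
have xd : disc R x by case: xk => /D_disc.
rewrite lee_fin; apply: ler_pM; rewrite ?powR_ge0 ?sqr_ge0//.
  apply: ge0_ler_powR => //.
  - by rewrite nnegrE divr_ge0// ltW.
  - by rewrite nnegrE ltW// hyp_gt0.
  - by apply: le_trans (hyp_ge xd); rewrite ler_pM2r// ltW.
rewrite /intensity -exprVn lerXn2r ?nnegrE ?invr_ge0 ?exprn_ge0//.
  by rewrite ltW// disc_sqr_lt1.
by rewrite -[leLHS]invrK lef_pV2 ?posrE ?disc_sqr_lt1.
Qed.

Let integral_D0 s : (\int[@area R]_(x in D 0) f s x = 0)%E.
Proof.
rewrite (_ : D 0 = set0) ?integral_set0//.
by apply/seteqP; split => x //; rewrite /D /mkset expr0 invr1 subrr sqrtr0 ltNge normc_ge0.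
Qed.

(** The contributions of the annuli decay geometrically. *)
Lemma mass_fin s : 1 < s -> (mass s < +oo)%E.
Proof.
move=> s1; have s0 : 0 <= s by apply: le_trans (ltW s1).
pose p : R := 2 `^ (1 - s).
have p0 : 0 < p by rewrite powR_gt0.
have p1 : p < 1.
  rewrite /p /powR gt_eqF// -[ltRHS]expR0 ltr_expR.
  by rewrite nmulr_rlt0 ?subr_lt0// ln_gt0// ltr1n.
pose C : R := 2 * a / (1 - p).
have bound k : (\int[@area R]_(x in D k) f s x <= (2 * a * ((1 - p ^+ k) / (1 - p)))%:E)%E.
  elim: k => [|k IH]; first by rewrite integral_D0 expr0 subrr mul0r mulr0.
  rewrite integral_D; apply: le_trans (leeD IH (integral_A_le _ s0)) _.
  rewrite -EFinD lee_fin -/p exprS le_eqVlt; apply/orP; left; apply/eqP.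
  by field; rewrite gt_eqF// subr_gt0.
apply: (@le_lt_trans _ _ C%:E); last exact: ltry.
have lm : (\int[@area R]_(x in subdisc n) f s x @[n --> \oo] --> mass s)%E.
  apply: integral_disc_lim; first exact: mf.
  by move=> x _; rewrite lee_fin mass_density_ge0.
rewrite -(cvg_lim _ lm)//; apply: lime_le; first by apply/cvg_ex; exists (mass s).
apply: nearW => n.
have [k hk] : exists k, subdisc n `<=` D k.
  pose q : R := 1 - n.+1%:R^-1.
  have q0 : 0 <= q by rewrite subr_ge0 invf_le1// ler1n.
  have q1 : q < 1 by rewrite gtrBl invr_gt0.
  have [|||k hk] := @expr_small R (2^-1) (1 - q ^+ 2).
  - by rewrite invr_ge0.
  - by rewrite invf_lt1// ltr1n.
  - by rewrite subr_gt0 expr_lt1.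
  exists (2 ^ k)%N => x xn; apply/D_E; rewrite -exprVn ltrBrDr addrC -ltrBrDr.
  apply: lt_le_trans hk _; rewrite lerD2l lerNl opprK.
  by rewrite lerXn2r ?nnegrE ?normc_ge0.
apply: (@le_trans _ _ (\int[@area R]_(x in D k) f s x)%E).
  apply: ge0_subset_integral => //; first exact: measurable_subdisc.
  by move=> x _; rewrite lee_fin mass_density_ge0.
apply: le_trans (bound k) _; rewrite lee_fin /C ler_pM2l ?mulr_gt0//.
by rewrite ler_piMl ?invr_ge0 ?subr_ge0 ?(ltW p1)// gerBl exprn_ge0 ?ltW.
Qed.

(** For s close to 1 each of the first annuli contributes at least a constant. *)
Lemma mass_large (M : R) : exists2 e : R, 0 < e &
  forall s, 1 < s -> s <= 1 + e -> (M%:E <= mass s)%E.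
Proof.
pose b : R := 8 `^ (- 2) / 2 * a / 2.
have b0 : 0 < b by rewrite !mulr_gt0// powR_gt0.
have [N MN] : exists N : nat, M <= b * N.+1%:R.
  exists (Num.bound `|M / b|); rewrite mulrC -ler_pdivrMr//.
  apply: le_trans (ler_norm _) _; apply: le_trans (ltW (archi_boundP _)) _ => //.
  by rewrite ler_nat.
exists (N.+1%:R^-1); first by rewrite invr_gt0.
move=> s s1 sN; have s0 : 0 <= s by apply: le_trans (ltW s1).
have s2 : s <= 2.
  by apply: le_trans sN _; rewrite -[leRHS]/(1 + 1) lerD2l invf_le1// ler1n.
have term k : (k <= N)%N -> (b%:E <= \int[@area R]_(x in A k) f s x)%E.
  move=> kN; apply: le_trans (integral_A_ge _ s0); rewrite lee_fin /b.
  apply: ler_pM => //.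
  - by rewrite !mulr_ge0 ?powR_ge0// ltW.
  - rewrite !ler_pM2r ?invr_gt0//; apply: ler_powR; first by rewrite ler1n.
    by rewrite lerN2.
  have -> : 2^-1 = 2 `^ (-1) :> R by rewrite powR_inv1.
  rewrite -powR_mulrn ?powR_ge0// -powRrM.
  apply: ler_powR; first by rewrite ler1n.
  have h1 : s - 1 <= N.+1%:R^-1 by rewrite lerBlDl.
  have h2 : (s - 1) * k%:R <= N.+1%:R^-1 * N.+1%:R.
    by apply: ler_pM; rewrite ?subr_ge0 ?(ltW s1)// ler_nat leqW.
  rewrite -[leLHS]opprK lerNl opprK -mulNr opprB (le_trans h2)//.
  by rewrite mulVf.
have bound k : (k <= N.+1)%N -> ((b * k%:R)%:E <= \int[@area R]_(x in D k) f s x)%E.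
  elim: k => [|k IH] kN; first by rewrite integral_D0 mulr0.
  rewrite integral_D -natr1 mulrDr mulr1 EFinD; apply: leeD; last exact: term.
  exact/IH/ltnW.
apply: (@le_trans _ _ (\int[@area R]_(x in D N.+1) f s x)%E).
  by apply: le_trans (bound _ _) => //; rewrite lee_fin.
apply: ge0_subset_integral => //; first exact: measurable_disc.
- by move=> x _; rewrite lee_fin mass_density_ge0.
Qed.

End mass.

Section mass_levels.
Context {R : realType}.

(** Lipschitz dependence on the exponent; the logarithm of v in the derivative
    is absorbed by lowering the exponent by tau. *)
Lemma powR_lip (v s t tau : R) : 0 < v -> v <= 1 -> 0 < tau -> s <= t ->
  v `^ s <= v `^ t + (t - s) / tau * v `^ (s - tau).
Proof.
move=> v0 v1 tau0 st; have L0 : ln v <= 0 by exact: ln_le0.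
rewrite /powR !gt_eqF//.
have h1 : 1 + (t - s) * ln v <= expR ((t - s) * ln v) by exact: expR_ge1Dx.
have h2 : - (tau * ln v) <= expR (- (tau * ln v)).
  by apply: le_trans (expR_ge1Dx _); rewrite lerDr.
have -> : t * ln v = s * ln v + (t - s) * ln v by ring.
have -> : (s - tau) * ln v = s * ln v + - (tau * ln v) by ring.
rewrite !expRD.
move: (expR (s * ln v)) (expR_gt0 (s * ln v)) => w w0.
move: (expR ((t - s) * ln v)) (expR (- (tau * ln v))) h1 h2 => e1 e2 h1 h2.
rewrite (_ : w * e1 + _ = w * (e1 + (t - s) / tau * e2)); last by ring.
rewrite -[leLHS]mulr1 ler_pM2l//.
have h3 : (t - s) / tau * (- (tau * ln v)) <= (t - s) / tau * e2.
  by rewrite ler_wpM2l// divr_ge0 ?subr_ge0// ltW.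
have h4 : (t - s) / tau * (- (tau * ln v)) = - ((t - s) * ln v).
  by field; rewrite gt_eqF.
by rewrite h4 in h3; lra.
Qed.

Lemma mass_lip (s t tau : R) : 0 < tau -> s <= t ->
  (mass s <= mass t + ((t - s) / tau)%:E * mass (s - tau))%E.
Proof.
move=> tau0 st.
have mm u E : measurable_fun (E : set (borelC R)) (fun x => (mass_density u x)%:E).
  by apply/measurable_funTS/measurable_EFinP; exact: measurable_mass_density.
have d0 u x : (0 <= (mass_density u x)%:E)%E by rewrite lee_fin mass_density_ge0.
have c0 : 0 <= (t - s) / tau by rewrite divr_ge0 ?subr_ge0// ltW.
have mD := @measurable_disc R.
rewrite /mass -ge0_integralZl_EFin// -ge0_integralD//; last 2 first.
- by move=> x _; rewrite mule_ge0.
- exact: measurable_funeM.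
apply: ge0_le_integral => //.
- by apply: emeasurable_funD => //; exact: measurable_funeM.
move=> x x1; rewrite -EFinM -EFinD lee_fin /mass_density mulrA -mulrDl.
by rewrite ler_wpM2r ?intensity_ge0// powR_lip// ?hyp_gt0// hyp_le1.
Qed.

Let M (s : R) : R := fine (mass s).

Let massE s : 1 < s -> mass s = (M s)%:E.
Proof. by move=> s1; rewrite /M fineK// ge0_fin_numE ?mass_ge0// mass_fin. Qed.

Let M_cont s : 1 < s -> {for s, continuous M}.
Proof.
move=> s1.
pose b := 1 + (s - 1) / 2; pose tau := (s - 1) / 4.
have tau0 : 0 < tau by rewrite divr_gt0// subr_gt0.
have b1 : 1 < b by rewrite /b ltrDl divr_gt0// subr_gt0.
have bt : 1 < b - tau by rewrite /b /tau; lra.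
pose L := M (b - tau) / tau.
have M0 u : 0 <= M u by rewrite fine_ge0 ?mass_ge0.
have L0 : 0 <= L by rewrite divr_ge0// ltW.
have lip u t : b <= u -> u <= t -> `|M u - M t| <= (t - u) * L.
  move=> bu ut.
  have u1 : 1 < u by apply: lt_le_trans bu.
  have t1 : 1 < t by apply: lt_le_trans ut.
  have ut1 : 1 < u - tau by lra.
  have := mass_lip tau0 ut; have := le_mass ut.
  have : (mass (u - tau) <= mass (b - tau))%E by apply: le_mass; lra.
  rewrite !massE// -EFinM -EFinD !lee_fin => h1 h2 h3.
  rewrite ger0_norm ?subr_ge0// lerBlDl (le_trans h3)// lerD2l /L.
  rewrite mulrA mulrAC ler_wpM2r ?invr_ge0 ?(ltW tau0)//.
  by rewrite ler_wpM2l// subr_ge0.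
apply/cvgrPdist_le => /= e e0.
have d0 : 0 < Num.min (s - b) (e / (L + 1)).
  rewrite lt_min; apply/andP; split; first by rewrite /b; lra.
  by rewrite divr_gt0// ltr_pwDr.
near=> t.
have : `|s - t| < Num.min (s - b) (e / (L + 1)).
  by near: t; apply: (@cvgr_dist_lt _ _ _ (nbhs s) _ idfun) => //; exact: cvg_id.
rewrite lt_min => /andP[h1 h2].
have {h2} h2 : `|s - t| * L <= e.
  move: h2; rewrite ltr_pdivlMr ?ltr_pwDr// => h2.
  by apply: le_trans (ltW h2); rewrite ler_wpM2l// lerDl.
have bt' : b <= t.
  by move: h1; rewrite ltr_distlC => /andP[]; lra.
have [st|/ltW ts] := leP s t.
  apply: le_trans (lip s t _ st) _; first by rewrite /b; lra.
  by move: h2; rewrite distrC ger0_norm ?subr_ge0.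
rewrite distrC; apply: le_trans (lip t s bt' ts) _.
by move: h2; rewrite ger0_norm ?subr_ge0.
Unshelve. all: by end_near. Qed.

(** Every large value is attained by the mass at some exponent above 1; the
    squares are singled out because both the sum of their inverses converges
    and the ratio of consecutive ones tends to 1. *)
Lemma mass_level : exists N : nat, forall n : nat, exists s : R,
  [/\ 1 < s & mass s = (((N + n).+1%:R ^+ 2)%:E)].
Proof.
have M2 : 0 <= M 2 by rewrite fine_ge0// mass_ge0.
exists (Num.bound (M 2)) => n; set k := _.+1.
have k2 : M 2 <= k%:R ^+ 2.
  apply: le_trans (ltW (archi_boundP M2)) _.
  apply: (@le_trans _ _ k%:R); first by rewrite ler_nat /k leqW// leq_addr.
  by rewrite expr2 ler_peMl// ler1n.
have [e e0 he] := @mass_large R (k%:R ^+ 2).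
pose a : R := 1 + Num.min e 1.
have a1 : 1 < a by rewrite ltrDl lt_min e0 ltr01.
have a2 : a <= 2 by rewrite -[leRHS]/(1 + 1) lerD2l ge_min lexx orbT.
have ka : k%:R ^+ 2 <= M a.
  rewrite -lee_fin -massE//; apply: he => //.
  by rewrite lerD2l ge_min lexx.
have cM : {within `[a, 2], continuous M}.
  apply: continuous_in_subspaceT => x /set_mem; rewrite /= in_itv/= => /andP[ax _].
  by apply: M_cont; apply: lt_le_trans ax.
have [] := @IVT R M a 2 (k%:R ^+ 2) a2 cM.
  by rewrite ge_min le_max k2 ka orbT.
move=> s; rewrite in_itv/= => /andP[as_ _] Ms.
exists s; have s1 : 1 < s by apply: lt_le_trans as_.
by rewrite massE// Ms.
Qed.

End mass_levels.

(** * Moments of linear statistics *)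

Section integral_aux.
Context d (T : measurableType d) (R : realType) (m : {measure set T -> \bar R}).
Local Open Scope ereal_scope.
Import HBNNSimple.

(** The integral of a nonnegative function is a supremum over the simple
    functions below it, so it is monotone without measurability. *)
Lemma le_integral_ge0 (D : set T) (f g : T -> \bar R) :
  (forall x, D x -> 0 <= f x) -> (forall x, D x -> f x <= g x) ->
  \int[m]_(x in D) f x <= \int[m]_(x in D) g x.
Proof.
move=> f0 fg; have g0 x : D x -> 0 <= g x by move=> Dx; exact: le_trans (f0 _ Dx) (fg _ Dx).
rewrite !ge0_integralE//; apply: le_ereal_sup => _ [h hf <-]; exists h => // x.
apply: le_trans (hf x) _; rewrite !patchE; case: ifPn => // /set_mem; exact: fg.
Qed.

Lemma le_integral_subset_ge0 (D : set T) (f : T -> \bar R) :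
  (forall x, 0 <= f x) -> \int[m]_(x in D) f x <= \int[m]_x f x.
Proof.
move=> f0; rewrite integral_mkcond; apply: le_integral_ge0 => x _.
  by rewrite erestrict_ge0.
by rewrite patchE; case: ifP.
Qed.

End integral_aux.

Section moments.
Context {R : realType}.
Variables (P : probability (Conf_space R) R) (P_dpp : is_bergman_dpp P).
Implicit Types (x y : R[i]) (F : borelC R -> R).

Lemma bergman_diag x : bergman_kernel x x = (intensity x)%:C.
Proof.
rewrite /bergman_kernel /intensity normc_sqr.
have -> : 1 - x * x^* = (1 - (complex.Re x ^+ 2 + complex.Im x ^+ 2))%:C.
  by case: x => a b; apply/eqP; rewrite eq_complex/=; apply/andP;
    split; apply/eqP; ring.
by rewrite -rmorphXn -fmorphV.
Qed.

Lemma bergman_conj x y : bergman_kernel y x = (bergman_kernel x y)^*.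
Proof.
rewrite /bergman_kernel conjc_inv rmorphXn rmorphB rmorph1 rmorphM/= conjcK.
by rewrite mulrC.
Qed.

Lemma mul_conj_normc (z : R[i]) : z * z^* = (normc z ^+ 2)%:C.
Proof.
rewrite normc_sqr; case: z => a b.
by apply/eqP; rewrite eq_complex/=; apply/andP; split; apply/eqP; ring.
Qed.

Lemma Re_det_pair x y :
  complex.Re (\det (\matrix_(i < 2, j < 2)
    bergman_kernel (tnth [tuple x; y] i) (tnth [tuple x; y] j))) =
  intensity x * intensity y - normc (bergman_kernel x y) ^+ 2.
Proof.
rewrite (expand_det_row _ 0) !big_ord_recl big_ord0 addr0 /cofactor !det_mx11 !mxE/=.
rewrite !(tnth_nth 0%R)/=.
rewrite (bergman_conj x y) !bergman_diag.
rewrite expr0 mul1r expr1 mulN1r mulrN mul_conj_normc.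
by rewrite -rmorphM -rmorphB.
Qed.

(** Cauchy-Schwarz for the Bergman kernel. *)
Lemma bergman_kernel_le x y : disc R x -> disc R y ->
  normc (bergman_kernel x y) ^+ 2 <= intensity x * intensity y.
Proof.
move=> x1 y1.
have x2 := disc_sqr_lt1 x1; have y2 := disc_sqr_lt1 y1.
set B := (1 - normc x ^+ 2) * (1 - normc y ^+ 2).
have B0 : 0 < B by rewrite mulr_gt0.
have BN : B <= normc (1 - x * y^*) ^+ 2.
  rewrite /B !normc_sqr; case: (x) (y) => [a b] [c e] /=.
  rewrite -subr_ge0 [leRHS](_ : _ = (a - c) ^+ 2 + (b - e) ^+ 2); last by ring.
  by rewrite addr_ge0 ?sqr_ge0.
have N0 := lt_le_trans B0 BN.
rewrite /bergman_kernel normcV normcX.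
rewrite (_ : intensity x * intensity y = B^-1 ^+ 2); last first.
  by rewrite /intensity -invfM -exprMn exprVn.
by rewrite lerXn2r ?nnegrE ?invr_ge0 ?(ltW B0) ?(ltW N0)// lef_pV2.
Qed.

Local Open Scope ereal_scope.

Lemma first_moment F : measurable_fun setT F -> (forall x, (0 <= F x)%R) ->
  \int[P]_X (\esum_(x in points X) (F x)%:E) =
  \int[@area R]_(x in disc R) (F x * intensity x)%:E.
Proof.
move=> mF F0.
pose phi (t : 1%N.-tuple (borelC R)) : R := F (tnth t ord0).
have mphi : measurable_fun setT phi.
  by apply: measurableT_comp => //; exact: measurable_tnth.
have H := @P_dpp 1%N isT phi mphi (fun t => F0 _).
transitivity (\int[P]_X \esum_(t in [set t : 1%N.-tuple (borelC R) |
    uniq t /\ forall i, points X (tnth t i)]) (phi t)%:E).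
  apply: eq_integral => X _; rewrite [RHS](@reindex_esum _ _ _ (points X) _
    (fun x => [tuple x] : 1%N.-tuple (borelC R))).
    by apply: eq_esum => x _; rewrite /phi (tnth_nth 0%R).
  split.
  - move=> x /= Xx; split => // i; by rewrite ord1 (tnth_nth 0%R).
  - by move=> x y _ _ /(congr1 val)[].
  - move=> t [_ /(_ ord0) Xt]; exists (tnth t ord0) => //.
    by apply: eq_from_tnth => i; rewrite (ord1 i).
rewrite H /=; apply: eq_integral => x _.
by rewrite /phi det_mx11 mxE bergman_diag !(tnth_nth 0%R).
Qed.

(** The determinant of the 2 x 2 Hermitian matrix is at most the product of its
    diagonal entries, for which the double integral factors. *)
Lemma pair_moment F (c : R) : measurable_fun setT F -> (forall x, (0 <= F x)%R) ->
  \int[@area R]_(x in disc R) (F x * intensity x)%:E = c%:E ->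
  \int[P]_X (\esum_(x in points X) \esum_(y in points X `\` [set x]) (F x * F y)%:E)
    <= (c * c)%:E.
Proof.
move=> mF F0 Fc.
pose phi (t : 2%N.-tuple (borelC R)) : R := (F (tnth t ord0) * F (tnth t (lift ord0 ord0)))%R.
have mphi : measurable_fun setT phi.
  by apply: measurable_funM; apply: measurableT_comp => //; exact: measurable_tnth.
have phi0 t : (0 <= phi t)%R by rewrite mulr_ge0.
have H := @P_dpp 2%N isT phi mphi phi0.
rewrite (_ : integral _ _ _ = \int[P]_X \esum_(t in [set t : 2%N.-tuple (borelC R) |
    uniq t /\ forall i, points X (tnth t i)]) (phi t)%:E); last first.
  apply: eq_integral => X _.
  rewrite esum_esum; last by move=> x y _ _; rewrite lee_fin mulr_ge0.
  rewrite [RHS](@reindex_esum _ _ _ (points X `*`` (fun x => points X `\` [set x])) _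
    (fun p : R[i] * R[i] => [tuple p.1; p.2] : 2%N.-tuple (borelC R))).
    by apply: eq_esum => -[x y] _; rewrite /phi !(tnth_nth 0%R).
  split.
  - move=> [x y] /= [Xx [Xy xy]]; split.
      by rewrite andbT inE; apply/eqP => e; apply: xy.
    by move=> i; rewrite (tnth_nth 0%R); case: i => -[|[|]].
  - by move=> [x y] [x' y'] _ _ /(congr1 val)[/= -> ->].
  - move=> t [ut Xt]; exists (tnth t ord0, tnth t (lift ord0 ord0)) => /=.
      split; [exact: Xt|split; first exact: Xt].
      by move: ut => /tuple_uniqP inj /inj.
    apply: eq_from_tnth => i; rewrite (tnth_nth 0%R).
    by case: i => -[|[|]]//= hi; congr (tnth t _); apply: val_inj.
rewrite H /=.
have rho0 x y : disc R x -> disc R y -> (0 <= intensity x * intensity y -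
    normc (bergman_kernel x y) ^+ 2)%R.
  by move=> x1 y1; rewrite subr_ge0 bergman_kernel_le.
have mFi : measurable_fun [set: borelC R] (fun x => (F x * intensity x)%:E).
  by apply/measurable_EFinP; apply: measurable_funM => //; exact: measurable_intensity.
have Fi0 x : (0 <= F x * intensity x)%R by rewrite mulr_ge0 ?intensity_ge0.
have c0 : (0 <= c)%R.
  by rewrite -lee_fin -Fc; apply: integral_ge0 => x _; rewrite lee_fin.
have inner x : disc R x ->
  \int[@area R]_(y in disc R) (phi [tuple of x :: [tuple of y :: [tuple]]] *
     complex.Re (\det (\matrix_(i < 2, j < 2)
       bergman_kernel (tnth [tuple of x :: [tuple of y :: [tuple]]] i)
        (tnth [tuple of x :: [tuple of y :: [tuple]]] j))))%:E
    <= (F x * intensity x)%:E * c%:E.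
  move=> x1; rewrite -Fc -ge0_integralZl_EFin//; last first.
  - exact: measurable_funTS.
  - by move=> y _; rewrite lee_fin.
  - exact: measurable_disc.
  have phiE y : phi [tuple of x :: [tuple of y :: [tuple]]] = (F x * F y)%R.
    by rewrite /phi !(tnth_nth 0%R).
  apply: le_integral_ge0 => y y1.
    by rewrite phiE Re_det_pair lee_fin !mulr_ge0// rho0.
  rewrite phiE Re_det_pair -EFinM lee_fin.
  rewrite [leRHS](_ : _ = (F x * F y) * (intensity x * intensity y))%R; last by ring.
  by rewrite ler_wpM2l ?mulr_ge0// gerBl sqr_ge0.
apply: (@le_trans _ _ (\int[@area R]_(x in disc R) ((F x * intensity x)%:E * c%:E))).
  apply: le_integral_ge0 => x x1; last exact: inner.
  apply: integral_ge0 => y y1.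
  by rewrite Re_det_pair lee_fin !mulr_ge0// rho0.
rewrite ge0_integralZr//; first by rewrite Fc -EFinM.
- exact: measurable_disc.
- exact: measurable_funTS.
- by move=> x _; rewrite lee_fin.
Qed.

End moments.

Section second_moment.
Context {R : realType}.
Variables (P : probability (Conf_space R) R) (P_dpp : is_bergman_dpp P).
Implicit Types (X : conf R) (x y : R[i]).
Local Open Scope ereal_scope.

(** The diagonal and the pairs of distinct points are governed by the first and
    the second correlation function. *)
Lemma esum_square X (F : borelC R -> R) (r : R) : (forall x, (0 <= F x)%R) ->
  \esum_(x in points X) (F x)%:E = r%:E ->
  (r * r)%:E = \esum_(x in points X) (F x * F x)%:E +
    \esum_(x in points X) \esum_(y in points X `\` [set x]) (F x * F y)%:E.
Proof.
move=> F0 Fr.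
have r0 : (0 <= r)%R by rewrite -lee_fin -Fr; apply: esum_ge0 => x _; rewrite lee_fin.
have cX := countable_points X.
rewrite EFinM -[X in _ * X = _]Fr -esumZl//; last by move=> x _; rewrite lee_fin.
rewrite -esumD; last 2 first.
- by move=> x _; rewrite lee_fin mulr_ge0.
- by move=> x _; apply: esum_ge0 => y _; rewrite lee_fin mulr_ge0.
apply: eq_esum => x Xx.
have -> : \esum_(y in points X `\` [set x]) (F x * F y)%:E =
    (F x)%:E * \esum_(y in points X `\` [set x]) (F y)%:E.
  rewrite -esumZl//; last by move=> y _; rewrite lee_fin.
  exact: sub_countable (subset_card_le (@subDsetl _ _ _)) cX.
rewrite EFinM -ge0_muleDr ?lee_fin//; last first.
  by apply: esum_ge0 => y _; rewrite lee_fin.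
rewrite -Fr muleC (esumID [set x])//; last by move=> y _; rewrite lee_fin.
congr (_ * (_ + _)); rewrite (_ : _ `&` _ = [set x]) ?esum_set1 ?lee_fin//.
by apply/seteqP; split => y; [move=> []|move=> ->].
Qed.

(** The variance of a nonnegative linear statistic is at most its variance
    under a Poisson process with the same intensity: the pair correlation is at
    most the product of the intensities. *)
Lemma second_moment (F : borelC R -> R) (c : R) :
  measurable_fun setT F -> (forall x, (0 <= F x)%R) ->
  \int[@area R]_(x in disc R) (F x * intensity x)%:E = c%:E ->
  \int[P]_X ((\esum_(x in points X) (F x)%:E - c%:E) *
             (\esum_(x in points X) (F x)%:E - c%:E)) <=
  \int[@area R]_(x in disc R) (F x * F x * intensity x)%:E.
Proof.
move=> mF F0 Fc.
pose Y X := \esum_(x in points X) (F x)%:E.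
pose D X := \esum_(x in points X) (F x * F x)%:E.
pose O X := \esum_(x in points X) \esum_(y in points X `\` [set x]) (F x * F y)%:E.
rewrite -/(Y _).
have Y0 X : 0 <= Y X by apply: esum_ge0 => x _; rewrite lee_fin.
have D0 X : 0 <= D X by apply: esum_ge0 => x _; rewrite lee_fin mulr_ge0.
have O0 X : 0 <= O X.
  by apply: esum_ge0 => x _; apply: esum_ge0 => y _; rewrite lee_fin mulr_ge0.
have mY : measurable_fun [set: Conf_space R] Y.
  by apply: measurable_esum_points => [|x]; [exact/measurable_EFinP|rewrite lee_fin].
have mD : measurable_fun [set: Conf_space R] D.
  apply: measurable_esum_points => [|x]; last by rewrite lee_fin mulr_ge0.
  exact/measurable_EFinP/measurable_funM.
have EY : \int[P]_X Y X = c%:E by rewrite -Fc first_moment.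
have ED : \int[P]_X D X = \int[@area R]_(x in disc R) (F x * F x * intensity x)%:E.
  rewrite -(@first_moment _ P P_dpp (fun x => F x * F x)%R)//.
    exact: measurable_funM.
  by move=> x; rewrite mulr_ge0.
have EO : \int[P]_X O X <= (c * c)%:E by exact: pair_moment.
have c0 : (0 <= c)%R by rewrite -lee_fin -EY; apply: integral_ge0.
pose N : set (Conf_space R) := [set X | Y X = +oo].
have mN : measurable N.
  by rewrite -[X in measurable X]setTI; exact: (mY measurableT _ (emeasurable_set1 _)).
have PN : P N = 0.
  have iY : P.-integrable setT Y.
    apply/integrableP; split => //; under eq_integral do rewrite gee0_abs//.
    by rewrite EY ltry.
  have [A [mA A0 sub]] := integrable_ae measurableT iY.
  apply/eqP; rewrite eq_le measure_ge0 andbT -A0.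
  apply: le_measure; [exact: mem_set|exact: mem_set|].
  by move=> X NX; apply: sub => /= /(_ Logic.I); rewrite NX.
pose G := ~` N.
have mG : measurable G by exact: measurableC.
have restr (f : Conf_space R -> \bar R) : measurable_fun setT f -> (forall X, 0 <= f X) ->
    \int[P]_X f X = \int[P]_(X in G) f X.
  move=> mf f0; rewrite (ge0_negligible_integral mN)//.
  by rewrite setTD.
have mS (f : Conf_space R -> \bar R) : measurable_fun setT f -> measurable_fun G f.
  exact: measurable_funTS.
have YG X : G X -> exists2 r, (0 <= r)%R & Y X = r%:E.
  rewrite /G /N /=; have := Y0 X; case: (Y X) => [r| |]//.
  by move=> r0 _; exists r.
pose Z X := (Y X - c%:E) * (Y X - c%:E).
have Z0 X : 0 <= Z X.
  have := Y0 X; rewrite /Z; case: (Y X) => [r| |]//= _.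
  by rewrite -EFinD -EFinM lee_fin -expr2 sqr_ge0.
have mZ : measurable_fun [set: Conf_space R] Z.
  by apply: emeasurable_funM; apply: emeasurable_funB.
pose W X := Y X * Y X - D X.
have mW : measurable_fun [set: Conf_space R] W.
  by apply: emeasurable_funB => //; apply: emeasurable_funM.
have WO X : G X -> W X = O X.
  move=> /YG[r r0 Yr]; have := esum_square F0 Yr; rewrite -/(D X) -/(O X).
  rewrite /W Yr -EFinM => ->; have := D0 X.
  have Dfin : D X \is a fin_num.
    have : D X <= (r * r)%:E by rewrite (esum_square F0 Yr) -/(D X) leeDl// O0.
    by have := D0 X; case: (D X).
  by move=> _; rewrite addeAC subee// add0e.
have E1 : \int[P]_(X in G) (Z X + (2 * c)%:E * Y X) =
    \int[P]_(X in G) (D X + W X + (c * c)%:E).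
  apply: eq_integral => X /set_mem GX; have [r r0 Yr] := YG _ GX.
  rewrite WO// /O -(esum_square F0 Yr) /Z Yr -EFinB -!EFinM -!EFinD.
  by congr EFin; ring.
have W0 X : G X -> 0 <= W X by move=> /WO ->.
rewrite (restr Z)//.
have EW : \int[P]_(X in G) W X <= (c * c)%:E.
  apply: le_trans EO; rewrite (_ : \int[P]_(X in G) W X = \int[P]_(X in G) O X).
    exact: le_integral_subset_ge0.
  by apply: eq_integral => X /set_mem GX; exact: WO.
have PG : P G = 1 by rewrite probability_setC// PN sube0.
move: E1; rewrite ge0_integralD//; last 3 first.
- exact: mS.
- by move=> X _; rewrite mule_ge0// lee_fin mulr_ge0.
- by apply: mS; exact: measurable_funeM.
rewrite ge0_integralZl_EFin//; [|exact: mS|by rewrite mulr_ge0].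
rewrite -(restr Y)// EY ge0_integralD//; last 3 first.
- by move=> X GX; rewrite adde_ge0// W0.
- by apply: emeasurable_funD; exact: mS.
- by move=> X _; rewrite lee_fin mulr_ge0.
have -> : \int[P]_(_ in G) (c * c)%:E = (c * c)%:E.
  transitivity ((c * c)%:E * P G); last by rewrite PG mule1.
  exact: integral_cst.
rewrite ge0_integralD//; [|exact: mS|exact: mS].
rewrite -(restr D)// ED => E1.
have {}E1 : \int[P]_(x in G) Z x + (2 * c)%:E * c%:E <=
   \int[@area R]_(x in disc R) (F x * F x * intensity x)%:E + (c * c)%:E + (c * c)%:E.
  by rewrite E1; apply: leeD => //; apply: leeD.
have := E1; rewrite -EFinM -addeA -EFinD.
by rewrite (_ : (c * c + c * c = 2 * c * c)%R) ?leeD2rE//; ring.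
Qed.

(** Poisson kernel weighted by a power of hyp. The absolute value is there to
    have a nonnegative function on the whole plane. *)
Definition hypker (s : R) (eta x : R[i]) : R := (hyp x `^ s * `|pker (eta^* * x)|)%R.

Lemma hypker_ge0 s eta x : (0 <= hypker s eta x)%R.
Proof. by rewrite mulr_ge0 ?powR_ge0. Qed.

Lemma measurable_hypker2 s :
  measurable_fun [set: borelC R * borelC R] (fun p => hypker s p.1 p.2).
Proof.
apply: measurable_funM.
  exact: (measurableT_comp (@measurable_hyp_powR R s) measurable_snd).
apply: measurableT_comp; first exact: normr_measurable.
apply: (measurableT_comp (@measurable_pker R)).
have m1 (f : borelC R -> R) : measurable_fun setT f ->
    measurable_fun [set: borelC R * borelC R] (fun p => f p.1).
  by move=> mf; exact: (measurableT_comp mf measurable_fst).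
have m2 (f : borelC R -> R) : measurable_fun setT f ->
    measurable_fun [set: borelC R * borelC R] (fun p => f p.2).
  by move=> mf; exact: (measurableT_comp mf measurable_snd).
have mRe := @measurable_Re R; have mIm := @measurable_Im R.
apply: measurable_complex.
  rewrite (_ : (fun p => _) = (fun p : borelC R * borelC R =>
    complex.Re p.1 * complex.Re p.2 + complex.Im p.1 * complex.Im p.2)%R).
    apply: measurable_funD; apply: measurable_funM;
    [exact: (m1 _ mRe)|exact: (m2 _ mRe)|exact: (m1 _ mIm)|exact: (m2 _ mIm)].
  by apply/funext => -[[a b] [u v]] /=; ring.
rewrite (_ : (fun p => _) = (fun p : borelC R * borelC R =>
  complex.Re p.1 * complex.Im p.2 - complex.Im p.1 * complex.Re p.2)%R).
  apply: measurable_funB; apply: measurable_funM;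
  [exact: (m1 _ mRe)|exact: (m2 _ mIm)|exact: (m1 _ mIm)|exact: (m2 _ mRe)].
by apply/funext => -[[a b] [u v]] /=; ring.
Qed.

Lemma measurable_hypker s eta : measurable_fun [set: borelC R] (hypker s eta).
Proof.
exact: (measurableT_comp (@measurable_hypker2 s) (pair1_measurable (eta : borelC R))).
Qed.

(** Harnack's inequality. *)
Lemma pker_le_hyp eta x : (normc eta <= 1)%R -> disc R x ->
  (pker (eta^* * x) <= (hyp x)^-1)%R.
Proof.
move=> e1 x1; have t1 := normc_conjM_lt1 e1 x1.
have tx : (normc (eta^* * x) <= normc x)%R.
  by rewrite normcM normc_conj ler_piMl ?normc_ge0.
apply: le_trans (pker_le t1) _; rewrite /hyp invf_div.
have h0 := normc_ge0 (eta^* * x)%R; have {}x1 : (normc x < 1)%R := x1.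
rewrite ler_pdivrMr ?subr_gt0// mulrAC ler_pdivlMr ?subr_gt0//.
move: (normc x) (normc (eta^* * x)%R) t1 tx h0 x1 => a b; nra.
Qed.

Lemma hypkerE s eta x : (normc eta <= 1)%R -> disc R x ->
  hypker s eta x = (hyp x `^ s * pker (eta^* * x))%R.
Proof.
move=> e1 x1; rewrite /hypker ger0_norm// pker_ge0//.
by rewrite ltW// normc_conjM_lt1.
Qed.

Lemma hypker_le1 s eta x : (1 <= s)%R -> (normc eta <= 1)%R -> disc R x ->
  (hypker s eta x <= 1)%R.
Proof.
move=> s1 e1 x1; rewrite hypkerE//.
have v0 := hyp_gt0 x1.
apply: (@le_trans _ _ (hyp x * (hyp x)^-1)%R); last by rewrite divff// gt_eqF.
apply: ler_pM; rewrite ?powR_ge0 ?pker_le_hyp//.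
  by rewrite pker_ge0// ltW// normc_conjM_lt1.
rewrite -[leRHS]powRr1; last exact: ltW.
apply: ger_powR => //.
by rewrite v0 hyp_le1.
Qed.

Lemma mean_hypker s eta : (normc eta <= 1)%R ->
  \int[@area R]_(x in disc R) (hypker s eta x * intensity x)%:E = mass s.
Proof.
move=> e1; rewrite /mass -(@mean_value R (mass_density s) eta)//.
- apply: eq_integral => x /set_mem x1; rewrite hypkerE//.
  by congr EFin; rewrite /mass_density; ring.
- exact: measurable_mass_density.
- exact: mass_density_ge0.
- exact: mass_density_radial.
Qed.

(** The sum over the configuration of the weighted Poisson kernel; by the mean
    value property its expectation does not depend on eta. *)
Definition kersum s eta X : \bar R := \esum_(x in points X) (hypker s eta x)%:E.

Lemma kersum_ge0 s eta X : 0 <= kersum s eta X.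
Proof. by apply: esum_ge0 => x _; rewrite lee_fin hypker_ge0. Qed.

Definition deviation (s c : R) eta X : \bar R :=
  (kersum s eta X - c%:E) * (kersum s eta X - c%:E).

Lemma deviation_ge0 s c eta X : 0 <= deviation s c eta X.
Proof.
have := kersum_ge0 s eta X; rewrite /deviation.
case: (kersum s eta X) => [r| |]//= _.
by rewrite -EFinD -EFinM lee_fin -expr2 sqr_ge0.
Qed.

Lemma measurable_deviation2 s c :
  measurable_fun [set: Conf_space R * borelC R] (fun p => deviation s c p.2 p.1).
Proof.
have mk : measurable_fun [set: Conf_space R * borelC R] (fun p => kersum s p.2 p.1).
  apply: (@measurable_esum_points_joint R _ (borelC R)
    (fun p => (hypker s p.1 p.2)%:E)).
    by apply/measurable_EFinP; exact: measurable_hypker2.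
  by move=> p; rewrite lee_fin hypker_ge0.
by apply: emeasurable_funM; apply: emeasurable_funB.
Qed.

Lemma measurable_deviation s c eta :
  measurable_fun [set: Conf_space R] (deviation s c eta).
Proof.
have := measurableT_comp (@measurable_deviation2 s c)
  (@pair2_measurable _ _ (Conf_space R) _ (eta : borelC R)).
exact.
Qed.

(** As hyp * pker <= 1, the square of hypker is at most hypker, and second_moment
    bounds the variance by the mean. *)
Lemma deviation_mean (s c : R) eta : (1 < s)%R -> mass s = c%:E ->
  (normc eta <= 1)%R -> \int[P]_X deviation s c eta X <= c%:E.
Proof.
move=> s1 sc e1.
have := @second_moment (hypker s eta) c (@measurable_hypker s eta)
  (@hypker_ge0 s eta).
rewrite mean_hypker// => /(_ sc) /le_trans; apply.
rewrite -sc -(@mean_hypker s eta e1); apply: le_integral_ge0 => x x1.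
  rewrite lee_fin; apply: mulr_ge0 (intensity_ge0 _).
  by apply: mulr_ge0; exact: hypker_ge0.
rewrite lee_fin ler_wpM2r ?intensity_ge0// ler_piMr ?hypker_ge0//.
by rewrite hypker_le1// ltW.
Qed.

End second_moment.

(** * Almost sure concentration along a sequence of exponents *)

Section almost_sure_convergence.
Local Open Scope ereal_scope.

Lemma sum_inv_sqr_le (R : realFieldType) (n : nat) :
  (\sum_(0 <= k < n) (k.+1%:R ^+ 2)^-1 <= 2 :> R)%R.
Proof.
case: n => [|n]; first by rewrite big_geq.
suff : (\sum_(0 <= k < n.+1) (k.+1%:R ^+ 2)^-1 <= 2 - n.+1%:R^-1 :> R)%R.
  by move=> /le_trans; apply; rewrite gerBl invr_ge0.
elim: n => [|n IH]; first by rewrite big_nat1 expr1n invr1; lra.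
rewrite big_nat_recr//=; apply: (le_trans (lerD IH (lexx _))).
have n0 : (0 < n.+1%:R :> R)%R by rewrite ltr0n.
rewrite -(natr1 n.+1); move: (n.+1%:R : R)%R n0 => a a0.
rewrite -subr_ge0.
have -> : (2 - (a + 1)^-1 - (2 - a^-1 + ((a + 1) ^+ 2)^-1) =
    (a * (a + 1) ^+ 2)^-1 :> R)%R.
  by field; rewrite !gt_eqF//; lra.
by rewrite invr_ge0 mulr_ge0 ?sqr_ge0// ltW.
Qed.

(** Means that are summable after normalization force almost sure convergence
    to zero of the normalized variables. *)
Lemma ae_normalized_small d (T : measurableType d) (R : realType)
    (m : {measure set T -> \bar R}) (Z : nat -> T -> \bar R) (N : nat) :
  (forall n, measurable_fun setT (Z n)) -> (forall n x, 0 <= Z n x) ->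
  (forall n, \int[m]_x Z n x <= ((N + n).+1%:R ^+ 2)%:E) ->
  {ae m, forall x, forall e : R, (0 < e)%R -> exists M, forall n, (M <= n)%N ->
     Z n x <= (e * (N + n).+1%:R ^+ 4)%:E}.
Proof.
move=> mZ Z0 IZ.
pose l n : R := (N + n).+1%:R.
have l0 n : (0 < l n)%R by rewrite ltr0n.
pose U n x := ((l n ^+ 4)^-1)%:E * Z n x.
have U0 n x : 0 <= U n x.
  by rewrite mule_ge0// lee_fin invr_ge0 exprn_ge0// ltW.
have mU n : measurable_fun setT (U n) by exact: measurable_funeM.
have IU n : \int[m]_x U n x <= ((n.+1%:R ^+ 2)^-1)%:E.
  rewrite ge0_integralZl_EFin//; last by rewrite invr_ge0 exprn_ge0// ltW.
  apply: (@le_trans _ _ (((l n ^+ 4)^-1)%:E * (l n ^+ 2)%:E)).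
    by apply: lee_wpmul2l => //; rewrite lee_fin invr_ge0 exprn_ge0// ltW.
  rewrite -EFinM lee_fin.
  have -> : ((l n ^+ 4)^-1 * l n ^+ 2 = (l n ^+ 2)^-1)%R.
    by field; rewrite gt_eqF.
  rewrite lef_pV2 ?posrE ?exprn_gt0// lerXn2r ?nnegrE//.
  by rewrite ler_nat ltnS leq_addl.
pose W x := \sum_(n <oo) U n x.
have mW : measurable_fun setT W by exact: ge0_emeasurable_sum.
have W0 x : 0 <= W x by apply: nneseries_ge0.
have IW : \int[m]_x W x < +oo.
  rewrite integral_nneseries//; apply: (@le_lt_trans _ _ 2%:E); last exact: ltry.
  apply: lime_le.
    by apply: is_cvg_nneseries => n _ _; exact: integral_ge0.
  apply: nearW => n.
  apply: (@le_trans _ _ (\sum_(0 <= k < n) ((k.+1%:R ^+ 2)^-1)%:E)).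
    by apply: lee_sum => k _; exact: IU.
  by rewrite sumEFin lee_fin sum_inv_sqr_le.
have iW : m.-integrable setT W.
  apply/integrableP; split => //; by under eq_integral do rewrite gee0_abs//.
apply: filterS (integrable_ae measurableT iW) => x /(_ Logic.I) Wx e e0.
have Woo : W x < +oo by rewrite -ge0_fin_numE.
have := @nneseries_tail_cvg R (U ^~ x) xpredT Woo (fun k _ => U0 k x).
move=> /fine_cvgP[ftail /cvgrPdist_le /(_ e e0) tail].
have [M _ HM] : \forall n \near \oo, \sum_(n <= k <oo) U k x <= e%:E.
  near=> n.
  have fn : (\sum_(n <= k <oo) U k x)%E \is a fin_num by near: n.
  have : (`|0 - fine (\sum_(n <= k <oo) U k x)| <= e)%R by near: n.
  rewrite sub0r normrN -(fineK fn) lee_fin; exact: le_trans (ler_norm _).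
exists M => n Mn.
have h : U n x <= e%:E.
  apply: le_trans (HM n Mn); have := @nneseries_lim_ge R (U ^~ x) xpredT n n.+1.
  by rewrite big_nat1; apply => k _ _.
move: h; rewrite /U -lee_pdivlMl ?invr_gt0 ?exprn_gt0// invrK -EFinM mulrC.
exact.
Unshelve. all: by end_near. Qed.

Context {R : realType}.
Variables (P : probability (Conf_space R) R) (P_dpp : is_bergman_dpp P).
Variables (s : nat -> R) (N : nat).
Hypotheses (s1 : forall n, (1 < s n)%R)
  (sl : forall n, mass (s n) = ((N + n).+1%:R ^+ 2)%:E).
Implicit Types X : conf R.

(** Mean square convergence over the circle of kersum, divided by its mean, to
    1: the mean at the exponent s n is (N + n).+1 ^ 2. *)
Definition circle_concentration (mu : probability (borelC R) R) X : Prop :=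
  forall e : R, (0 < e)%R -> exists M, forall n, (M <= n)%N ->
    \int[mu]_(zeta in circle R) deviation (s n) ((N + n).+1%:R ^+ 2) zeta X
      <= (e * (N + n).+1%:R ^+ 4)%:E.

(** The rational points are dense and countable, so that an almost sure property
    can be required at all of them. *)
Definition rational_concentration X : Prop :=
  forall q : rat * rat, (normc (ratr q.1 +i* ratr q.2 : R[i]) <= 1)%R ->
  forall e : R, (0 < e)%R -> exists M, forall n, (M <= n)%N ->
    deviation (s n) ((N + n).+1%:R ^+ 2) (ratr q.1 +i* ratr q.2) X
      <= (e * (N + n).+1%:R ^+ 4)%:E.

(** The sum is nonincreasing in t: exponents 1 + 1/(k+1) suffice. *)
Lemma ae_kersum_fin :
  {ae P, forall X : Conf_space R, forall t : R, (1 < t)%R -> kersum t 0%R X < +oo}.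
Proof.
have h (k : nat) : {ae P, forall X : Conf_space R, kersum (1 + k.+1%:R^-1)%R 0%R X < +oo}.
  have t1 : (1 < 1 + k.+1%:R^-1 :> R)%R by rewrite ltrDl invr_gt0.
  have mk : measurable_fun [set: Conf_space R] (kersum (1 + k.+1%:R^-1)%R 0%R).
    apply: measurable_esum_points => [|x]; last by rewrite lee_fin hypker_ge0.
    by apply/measurable_EFinP; exact: measurable_hypker.
  have iK : P.-integrable setT (kersum (1 + k.+1%:R^-1)%R 0%R).
    apply/integrableP; split => //.
    under eq_integral do rewrite gee0_abs ?kersum_ge0//.
    rewrite (first_moment P_dpp); last 2 first.
    - exact: measurable_hypker.
    - exact: hypker_ge0.
    by rewrite mean_hypker ?normc0// mass_fin.
  apply: filterS (integrable_ae measurableT iK) => X /(_ Logic.I).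
  by rewrite ge0_fin_numE// kersum_ge0.
have := ae_foralln h; apply: filterS => X hX t t1.
have t10 : (0 < t - 1)%R by rewrite subr_gt0.
have [k _ /(_ k (leqnn k)) hk] := near_infty_natSinv_lt (PosNum t10).
apply: le_lt_trans (hX k); apply: le_esum => x Xx; rewrite lee_fin.
have x1 := points_disc Xx.
rewrite ler_wpM2r//; apply: ger_powR; first by rewrite hyp_gt0// hyp_le1.
have {}hk : (k.+1%:R^-1 < t - 1)%R := hk.
by rewrite -lerBrDl ltW.
Qed.

Lemma ae_deviation_point (eta : R[i]) : (normc eta <= 1)%R ->
  {ae P, forall X : Conf_space R, forall e : R, (0 < e)%R ->
    exists M, forall n, (M <= n)%N ->
      deviation (s n) ((N + n).+1%:R ^+ 2) eta X <= (e * (N + n).+1%:R ^+ 4)%:E}.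
Proof.
move=> e1; apply: (@ae_normalized_small _ _ R P
  (fun n => deviation (s n) ((N + n).+1%:R ^+ 2) eta)).
- by move=> n; exact: measurable_deviation.
- by move=> n X; exact: deviation_ge0.
- by move=> n; exact: (deviation_mean P_dpp).
Qed.

Lemma ae_rational_concentration :
  {ae P, forall X : Conf_space R, rational_concentration X}.
Proof.
pose zq (q : rat * rat) : R[i] := ratr q.1 +i* ratr q.2.
pose good (q : rat * rat) (X : Conf_space R) := (normc (zq q) <= 1)%R ->
  forall e : R, (0 < e)%R -> exists M, forall n, (M <= n)%N ->
  deviation (s n) ((N + n).+1%:R ^+ 2) (zq q) X <= (e * (N + n).+1%:R ^+ 4)%:E.
have h k : {ae P, forall X : Conf_space R,
    if unpickle k is Some q then good q X else True}.
  case: (unpickle k) => [q|]; last exact: nearW.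
  have [q1|q1] := leP (normc (zq q)) 1%R; last first.
    by apply: nearW => X; rewrite /good leNgt q1.
  by apply: filterS (ae_deviation_point q1) => X hX _.
by apply: filterS (ae_foralln h) => X hX q; have := hX (pickle q); rewrite pickleK.
Qed.

(** The mean over the configurations and the circle is bounded at once, by
    Fubini. *)
Lemma ae_circle_concentration (mu : probability (borelC R) R) :
  {ae P, forall X : Conf_space R, circle_concentration mu X}.
Proof.
pose f n (p : Conf_space R * borelC R) :=
  deviation (s n) ((N + n).+1%:R ^+ 2) p.2 p.1 * (\1_(circle R) p.2)%:E.
have mf n : measurable_fun setT (f n).
  apply: emeasurable_funM; first exact: measurable_deviation2.
  apply/measurable_EFinP; apply: (@measurableT_comp _ _ _ _ _ _ (\1_(circle R) : borelC R -> R)).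
    by apply: measurable_indic; exact: measurable_circle.
  exact: measurable_snd.
have f0 n p : 0 <= f n p.
  by rewrite mule_ge0 ?deviation_ge0// lee_fin.
have fE n (X : Conf_space R) :
    \int[mu]_(zeta in circle R) deviation (s n) ((N + n).+1%:R ^+ 2) zeta X =
    \int[mu]_zeta f n (X, zeta).
  rewrite integral_mkcond; apply: eq_integral => z _; rewrite patchE /f/= indicE.
  by case: ifP; rewrite ?mule1 ?mule0.
have mI n := measurable_fun_fubini_tonelli_F (m2 := mu) (f n) (mf n) (f0 n).
have I0 n (X : Conf_space R) : 0 <= \int[mu]_zeta f n (X, zeta) by exact: integral_ge0.
have h := @ae_normalized_small _ _ R P (fun n X => \int[mu]_zeta f n (X, zeta)) N mI I0.
apply: filterS (h _) => [X hX e e0|n].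
  by have [M HM] := hX e e0; exists M => n /HM; rewrite fE.
rewrite (fubini_tonelli (f n) (mf n) (f0 n)).
apply: (@le_trans _ _ (\int[mu]_(zeta in setT) ((N + n).+1%:R ^+ 2)%:E)).
  apply: le_integral_ge0 => z _; first exact: integral_ge0.
  have [zc|zc] := boolP (z \in circle R); last first.
    rewrite (_ : (fun X => _) = cst 0) ?integral0 ?lee_fin ?sqr_ge0//.
    by apply/funext => X; rewrite /f/= indicE (negbTE zc) mule0.
  rewrite (_ : (fun X => _) =
    (fun X : Conf_space R => deviation (s n) ((N + n).+1%:R ^+ 2) z X)).
    by apply: (deviation_mean P_dpp) => //; rewrite (set_mem zc).
  by apply/funext => X; rewrite /f/= indicE zc mule1.
rewrite integral_cst// -[leRHS]mule1; apply: lee_wpmul2l.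
  by rewrite lee_fin sqr_ge0.
exact: probability_le1.
Qed.

End almost_sure_convergence.

(** * Hyperbolic distance and Poisson kernel *)

Section pointwise_estimates.
Context {R : realType}.
Implicit Types x y z w t u zeta : R[i].

Lemma pker_conj t : pker (t^*) = pker t.
Proof.
rewrite /pker normc_conj; congr (_ / _ ^+ 2).
by rewrite -normc_conj rmorphB rmorph1/= conjcK.
Qed.

Lemma pker_lip (r : R) : 0 <= r -> r < 1 -> forall t u,
  normc t <= r -> normc u <= r ->
  `|pker t - pker u| <= 12 / (1 - r) ^+ 4 * normc (t - u).
Proof.
move=> r0 r1 t u tr ur.
have t0 := normc_ge0 t; have u0 := normc_ge0 u.
have d0 := normc_ge0 (t - u).
have bt := normc_1B t; have bu := normc_1B u.
have bt2 := normc_1B_le t; have bu2 := normc_1B_le u.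
have h1 := ler_normc_dist t u.
have h2 : `|normc (1 - t) - normc (1 - u)| <= normc (t - u).
  apply: le_trans (ler_normc_dist _ _) _.
  by rewrite (_ : 1 - t - (1 - u) = - (t - u)) ?normcN//; ring.
rewrite /pker.
move: (normc t) (normc u) (normc (1 - t)) (normc (1 - u)) (normc (t - u))
  tr ur t0 u0 d0 bt bu bt2 bu2 h1 h2 => a b p q d ar br a0 b0 d0 pa qb pa2 qb2 h1 h2.
have p0 : 0 < p by lra.
have q0 : 0 < q by lra.
have e : (1 - a ^+ 2) / p ^+ 2 - (1 - b ^+ 2) / q ^+ 2 =
  ((1 - a ^+ 2) * (q ^+ 2 - p ^+ 2) + p ^+ 2 * (b ^+ 2 - a ^+ 2)) / (p ^+ 2 * q ^+ 2).
  by field; rewrite !gt_eqF.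
rewrite e normrM normfV (ger0_norm (_ : 0 <= p ^+ 2 * q ^+ 2)); last first.
  by rewrite mulr_ge0// sqr_ge0.
have num : `|(1 - a ^+ 2) * (q ^+ 2 - p ^+ 2) + p ^+ 2 * (b ^+ 2 - a ^+ 2)| <= 12 * d.
  apply: le_trans (ler_normD _ _) _.
  rewrite (normrM (1 - a ^+ 2)) (normrM (p ^+ 2)).
  have n1 : `|1 - a ^+ 2| <= 1 by rewrite ger0_norm; nra.
  have n2 : `|q ^+ 2 - p ^+ 2| <= 4 * d.
    rewrite subr_sqr normrM distrC (ger0_norm (_ : 0 <= q + p)); last by lra.
    by rewrite mulrC; apply: ler_pM => //; lra.
  have n3 : `|p ^+ 2| <= 4 by rewrite ger0_norm ?sqr_ge0//; nra.
  have n4 : `|b ^+ 2 - a ^+ 2| <= 2 * d.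
    rewrite subr_sqr normrM distrC (ger0_norm (_ : 0 <= b + a)); last by lra.
    by rewrite mulrC; apply: ler_pM => //; lra.
  have m1 : `|1 - a ^+ 2| * `|q ^+ 2 - p ^+ 2| <= 1 * (4 * d) by rewrite ler_pM.
  have m2 : `|p ^+ 2| * `|b ^+ 2 - a ^+ 2| <= 4 * (2 * d) by rewrite ler_pM.
  by apply: le_trans (lerD m1 m2) _; lra.
have den : (1 - r) ^+ 4 <= p ^+ 2 * q ^+ 2.
  rewrite (exprD _ 2 2) ler_pM ?sqr_ge0//; rewrite lerXn2r ?nnegrE//; lra.
rewrite [leRHS]mulrAC; apply: ler_pM => //.
  by rewrite invr_ge0 mulr_ge0 ?sqr_ge0.
by rewrite lef_pV2 ?posrE ?mulr_gt0 ?exprn_gt0// subr_gt0.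
Qed.

Lemma normc_conjMB z w x y : normc x <= 1 -> normc w <= 1 ->
  normc (z^* * x - w^* * y) <= normc (z - w) + normc (x - y).
Proof.
move=> x1 w1.
rewrite (_ : _ - _ = (z - w)^* * x + w^* * (x - y)); last by rewrite rmorphB/=; ring.
apply: le_trans (le_normcD _ _) _; rewrite !normcM !normc_conj.
apply: lerD; first by rewrite ler_piMr ?normc_ge0.
by rewrite ler_piMl ?normc_ge0.
Qed.

Lemma powR_exponent_lip (k kappa s : R) : 0 < kappa -> kappa <= 1 ->
  kappa <= k -> k <= kappa^-1 -> 1 <= s -> s <= 2 ->
  `|k `^ s - k| <= - ln kappa * kappa ^- 2 * (s - 1).
Proof.
move=> K0 K1 Kk kK s1 s2.
have k0 : 0 < k by apply: lt_le_trans Kk.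
have u1 : ln kappa <= ln k by rewrite ler_ln ?posrE.
have u2 : ln k <= - ln kappa by rewrite -lnV ?posrE// ler_ln ?posrE ?invr_gt0.
have L0 : ln kappa <= 0 by exact: ln_le0.
have -> : k `^ s - k = k * (expR ((s - 1) * ln k) - 1).
  rewrite /powR gt_eqF// (_ : s * ln k = ln k + (s - 1) * ln k); last by ring.
  by rewrite expRD lnK ?posrE// mulrBr mulr1.
rewrite normrM (gtr0_norm k0).
have y1 : expR ((s - 1) * ln k) <= kappa^-1.
  rewrite -[leRHS]lnK ?posrE ?invr_gt0// ler_expR lnV ?posrE//.
  have : (s - 1) * ln k <= (s - 1) * (- ln kappa) by rewrite ler_wpM2l// subr_ge0.
  have : (s - 1) * (- ln kappa) <= 1 * (- ln kappa) by rewrite ler_wpM2r; lra.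
  lra.
have e1 : 1 + (s - 1) * ln k <= expR ((s - 1) * ln k) by exact: expR_ge1Dx.
have e2 : 1 - (s - 1) * ln k <= (expR ((s - 1) * ln k))^-1.
  by rewrite -expRN; exact: expR_ge1Dx.
have E0 := expR_gt0 ((s - 1) * ln k).
have Ki : 1 <= kappa^-1 by rewrite invf_ge1.
have a1 : (s - 1) * ln k <= (s - 1) * (- ln kappa) by rewrite ler_wpM2l// subr_ge0.
have a2 : (s - 1) * ln kappa <= (s - 1) * ln k by rewrite ler_wpM2l// subr_ge0.
have c0 : 0 <= (s - 1) * (- ln kappa) by rewrite mulr_ge0; lra.
move: (expR ((s - 1) * ln k)) y1 e1 e2 E0 => E y1 e1 e2 E0.
move: ((s - 1) * ln k) e1 e2 a1 a2 => y e1 e2 a1 a2.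
have e3 : E - 1 <= y * E.
  have : (1 - y) * E <= E^-1 * E by rewrite ler_wpM2r// ltW.
  by rewrite mulVf ?gt_eqF//; lra.
have B : `|E - 1| <= (s - 1) * (- ln kappa) * kappa^-1.
  rewrite ler_norml; apply/andP; split.
    have : (s - 1) * (- ln kappa) * 1 <= (s - 1) * (- ln kappa) * kappa^-1.
      by rewrite ler_wpM2l.
    lra.
  apply: le_trans e3 _.
  have : y * E <= (s - 1) * (- ln kappa) * E by rewrite ler_wpM2r// ltW.
  move=> /le_trans; apply; by rewrite ler_wpM2l.
rewrite (_ : - ln kappa * _ * _ = kappa^-1 * ((s - 1) * (- ln kappa) * kappa^-1)); last first.
  by rewrite -exprVn; ring.
by rewrite ler_pM// ltW.
Qed.

Lemma mobius_normc x z : disc R x -> disc R z ->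
  1 - normc (mobius x z) ^+ 2 =
  (1 - normc x ^+ 2) * (1 - normc z ^+ 2) / normc (1 - x^* * z) ^+ 2.
Proof.
move=> x1 z1.
have d0 : 0 < normc (1 - x^* * z).
  by apply: normc_1B_gt0; rewrite normcM normc_conj mulr_ilt1 ?normc_ge0.
have E : normc (z - x) ^+ 2 =
    normc (1 - x^* * z) ^+ 2 - (1 - normc x ^+ 2) * (1 - normc z ^+ 2).
  by rewrite !normc_sqr; case: (x) (z) => [a b] [c d] /=; ring.
rewrite /mobius normcM normcV exprMn exprVn E.
by field; rewrite gt_eqF.
Qed.

Lemma mobius_lt1 x z : disc R x -> disc R z -> normc (mobius x z) < 1.
Proof.
move=> x1 z1; rewrite -(expr_lt1 (n := 2)) ?normc_ge0// -subr_gt0 mobius_normc//.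
apply: divr_gt0; first by apply: mulr_gt0; exact: disc_sqr_lt1.
apply: exprn_gt0; apply: normc_1B_gt0.
by rewrite normcM normc_conj mulr_ilt1 ?normc_ge0.
Qed.

Lemma gweightE s z x : disc R x -> disc R z ->
  gweight s z x = ((1 - normc (mobius x z)) / (1 + normc (mobius x z))) `^ s.
Proof.
move=> x1 z1; have f1 := mobius_lt1 x1 z1; have f0 := normc_ge0 (mobius x z).
rewrite /gweight /poincare_dist /powR gt_eqF; last first.
  by rewrite divr_gt0 ?subr_gt0// ltr_pwDl.
congr expR; rewrite -(invf_div (1 - _)) lnV; last first.
  by rewrite posrE divr_gt0 ?subr_gt0// ltr_pwDl.
by ring.
Qed.

Lemma gweight_gt0 s z x : 0 < gweight s z x :> R.
Proof. exact: expR_gt0. Qed.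

(** Near the boundary, the hyperbolic distances to z and to the origin differ
    by the logarithm of the Poisson kernel. *)
Lemma gweight_pker (r : R) : 0 <= r -> r < 1 -> exists2 C : R, 0 <= C &
  forall s x z, 1 < s -> s <= 2 -> disc R x -> normc z <= r ->
  `|gweight s z x - hyp x `^ s * pker (z^* * x)| <=
    C * (hyp x `^ s * ((s - 1) + (1 - normc x))).
Proof.
move=> r0 r1.
pose Q : R := ((1 - r) ^+ 2)^-1; pose kappa : R := (1 - r) ^+ 2 / 16.
have q0 : 0 < (1 - r) ^+ 2 by rewrite exprn_gt0// subr_gt0.
have q1 : (1 - r) ^+ 2 <= 1 by nra.
have K0 : 0 < kappa by rewrite divr_gt0.
have K1 : kappa <= 1 by rewrite /kappa; lra.
have Q1 : 1 <= Q by rewrite invf_ge1.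
pose C1 : R := - ln kappa * kappa ^- 2.
have C10 : 0 <= C1.
  by rewrite mulr_ge0 ?oppr_ge0 ?ln_le0// invr_ge0 sqr_ge0.
pose C2 : R := 14 * Q ^+ 2.
have C20 : 0 <= C2 by rewrite mulr_ge0// sqr_ge0.
exists (C1 + C2); first exact: addr_ge0.
move=> s x z s1 s2 x1 zr.
have z1 : disc R z by apply: le_lt_trans r1.
rewrite gweightE//.
have fE := mobius_normc x1 z1; have f1 := mobius_lt1 x1 z1.
have f0 := normc_ge0 (mobius x z); have x0 := normc_ge0 x; have z0 := normc_ge0 z.
have v0 := hyp_gt0 x1; have {}x1 : normc x < 1 := x1.
have d1 : 1 - r <= normc (1 - x^* * z).
  apply: le_trans (normc_1B _); rewrite lerD2l lerN2 normcM normc_conj.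
  by apply: le_trans zr; rewrite ler_piMl// ltW.
have d2 : normc (1 - x^* * z) <= 2.
  apply: le_trans (normc_1B_le _) _; rewrite -[leRHS]/(1 + 1) lerD2l normcM normc_conj.
  by rewrite mulr_ile1// ltW.
have pE : pker (z^* * x) = (1 - normc x ^+ 2 * normc z ^+ 2) / normc (1 - x^* * z) ^+ 2.
  have e : (z^* * x)^* = x^* * z by rewrite rmorphM/= conjcK mulrC.
  by rewrite -pker_conj e /pker normcM normc_conj exprMn.
rewrite pE /hyp in v0 *.
move: (normc (mobius x z)) (normc x) (normc z) (normc (1 - x^* * z))
  zr fE f1 f0 x0 z0 x1 d1 d2 v0 {pE z1} => f a b d br fE f1 f0 a0 b0 a1 d1 d2 v0.
have d0 : 0 < d by lra.
have dd0 : 0 < d ^+ 2 by rewrite exprn_gt0.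
pose n : R := (1 - b ^+ 2) / d ^+ 2.
have nQ : n <= Q.
  rewrite /n /Q -[leRHS]mul1r ler_pM ?invr_ge0 ?sqr_ge0//; [nra|nra|].
  by rewrite lef_pV2 ?posrE// lerXn2r ?nnegrE//; lra.
have nK : 4 * kappa <= n.
  rewrite /n ler_pdivlMr// /kappa.
  have : d ^+ 2 <= 4 by nra.
  by nra.
have n0 : 0 < n by apply: lt_le_trans nK; rewrite mulr_gt0.
have fE' : 1 - f ^+ 2 = n * (1 - a ^+ 2) by rewrite fE /n; ring.
(* The exponential of minus the distance to z is v * (n * m). The factor n * m
   stays between kappa and its inverse, and it tends to the Poisson kernel as
   a tends to 1. *)
pose v := (1 - a) / (1 + a); pose m := ((1 + a) / (1 + f)) ^+ 2.
have VE : (1 - f) / (1 + f) = v * (n * m).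
  have -> : (1 - f) / (1 + f) = (1 - f ^+ 2) / (1 + f) ^+ 2.
    by field; rewrite gt_eqF//; lra.
  rewrite fE' /v /m; field; rewrite !gt_eqF//; lra.
have m1 : 1 / 4 <= m.
  rewrite /m exprMn exprVn ler_pdivlMr ?exprn_gt0//; last by lra.
  by nra.
have m2 : m <= 4.
  rewrite /m exprMn exprVn ler_pdivrMr ?exprn_gt0//; last by lra.
  by nra.
rewrite -/v VE powRM; [|exact: ltW|by rewrite mulr_ge0//; lra].
rewrite -mulrBr normrM (ger0_norm (powR_ge0 _ _)).
rewrite [leRHS]mulrCA ler_wpM2l ?powR_ge0//.
have k1 : `|(n * m) `^ s - n * m| <= C1 * (s - 1).
  apply: powR_exponent_lip => //; last exact: ltW.
    by nra.
  have -> : kappa^-1 = 16 * Q by rewrite /kappa /Q invfM invrK mulrC.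
  by nra.
have k2 : `|n * m - (1 - a ^+ 2 * b ^+ 2) / d ^+ 2| <= C2 * (1 - a).
  have hb : (1 - a ^+ 2 * b ^+ 2) / d ^+ 2 = n + b ^+ 2 * (1 - a ^+ 2) / d ^+ 2.
    by rewrite /n; field; rewrite gt_eqF.
  have t1 : 0 <= b ^+ 2 * (1 - a ^+ 2) / d ^+ 2 <= 2 * Q * (1 - a).
    apply/andP; split.
      by apply: divr_ge0; [apply: mulr_ge0; [exact: sqr_ge0|nra]|exact: sqr_ge0].
    rewrite (_ : 2 * Q * (1 - a) = 2 * (1 - a) * Q); last by ring.
    apply: ler_pM => //.
    - by apply: mulr_ge0; [exact: sqr_ge0|nra].
    - by rewrite invr_ge0 sqr_ge0.
    - have c1 : 0 <= b ^+ 2 <= 1 by rewrite sqr_ge0/=; nra.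
      have c2 : 0 <= 1 - a ^+ 2 <= 2 * (1 - a) by apply/andP; split; nra.
      by move: (b ^+ 2) (1 - a ^+ 2) c1 c2 => B A /andP[? ?] /andP[? ?]; nra.
    - by rewrite lef_pV2 ?posrE// lerXn2r ?nnegrE//; lra.
  have mE : m - 1 = (a - f) * (2 + a + f) / (1 + f) ^+ 2.
    by rewrite /m; field; rewrite gt_eqF//; lra.
  have mb : `|m - 1| <= 4 * `|a - f|.
    rewrite mE !normrM normfV (ger0_norm (_ : 0 <= 2 + a + f)); last by lra.
    rewrite (ger0_norm (sqr_ge0 (1 + f))) -mulrA mulrC ler_wpM2r//.
    rewrite ler_pdivrMr ?exprn_gt0//; last by lra.
    by nra.
  have af : `|a - f| <= (1 - a) + 2 * n * (1 - a).
    have f2 : 1 - f <= 2 * n * (1 - a).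
      apply: (@le_trans _ _ (1 - f ^+ 2)).
        by rewrite lerD2l lerN2 expr2 ler_piMr// ltW.
      rewrite fE' (_ : 2 * n * (1 - a) = n * (2 * (1 - a))); last by ring.
      by rewrite ler_pM2l//; have := sqr_ge0 (1 - a); lra.
    have na0 : 0 <= 2 * n * (1 - a) by rewrite mulr_ge0//; lra.
    by rewrite ler_norml; apply/andP; split; lra.
  have nm : `|n * m - n| <= 4 * Q * ((1 - a) + 2 * Q * (1 - a)).
    rewrite -{2}(mulr1 n) -mulrBr normrM (gtr0_norm n0).
    have X1 : n * `|m - 1| <= Q * (4 * ((1 - a) + 2 * Q * (1 - a))).
      apply: ler_pM => //; first exact: ltW.
      apply: le_trans mb _; rewrite ler_pM2l//; apply: le_trans af _.
      by rewrite lerD2l ler_wpM2r//; lra.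
    by lra.
  rewrite hb ler_norml; move: nm t1; rewrite ler_norml => /andP[g1 g2] /andP[g3 g4].
  have g5 : 2 * Q * (1 - a) + 4 * Q * ((1 - a) + 2 * Q * (1 - a)) <= C2 * (1 - a).
    rewrite (_ : _ + _ = (6 * Q + 8 * Q ^+ 2) * (1 - a)); last by ring.
    rewrite ler_wpM2r//; first by lra.
    by rewrite /C2; nra.
  by apply/andP; split; lra.
rewrite (_ : (n * m) `^ s - _ = ((n * m) `^ s - n * m) +
   (n * m - (1 - a ^+ 2 * b ^+ 2) / d ^+ 2)); last by ring.
apply: le_trans (ler_normD _ _) _.
have : 0 <= C1 * (1 - a) by rewrite mulr_ge0//; lra.
have : 0 <= C2 * (s - 1) by rewrite mulr_ge0//; lra.
by lra.
Qed.

End pointwise_estimates.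

(** * From the sequence of exponents to all exponents *)

Section linear_bounds.
Local Open Scope ereal_scope.

Lemma le_integral_lin3 d (T : measurableType d) (R : realType)
    (m : {measure set T -> \bar R}) (D : set T) (f f1 f2 f3 : T -> \bar R) (a b : R) :
  measurable D -> measurable_fun D f1 -> measurable_fun D f2 -> measurable_fun D f3 ->
  (0 <= a)%R -> (0 <= b)%R ->
  (forall x, D x -> 0 <= f x) -> (forall x, D x -> 0 <= f1 x) ->
  (forall x, D x -> 0 <= f2 x) -> (forall x, D x -> 0 <= f3 x) ->
  (forall x, D x -> f x <= f1 x + a%:E * f2 x + b%:E * f3 x) ->
  \int[m]_(x in D) f x <= \int[m]_(x in D) f1 x + a%:E * (\int[m]_(x in D) f2 x) +
    b%:E * (\int[m]_(x in D) f3 x).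
Proof.
move=> mD m1 m2 m3 a0 b0 p p1 p2 p3 h.
have q2 x : D x -> 0 <= a%:E * f2 x by move=> Dx; rewrite mule_ge0 ?lee_fin ?p2.
have q3 x : D x -> 0 <= b%:E * f3 x by move=> Dx; rewrite mule_ge0 ?lee_fin ?p3.
have n2 : measurable_fun D (fun x => a%:E * f2 x) by exact: measurable_funeM.
have n3 : measurable_fun D (fun x => b%:E * f3 x) by exact: measurable_funeM.
rewrite -!ge0_integralZl_EFin// -!ge0_integralD//.
- exact: le_integral_ge0.
- by move=> x Dx; rewrite adde_ge0 ?p1 ?q2.
- exact: emeasurable_funD.
Qed.

Lemma le_esum_lin3 (T : choiceType) (R : realType) (A : set T)
    (f f1 f2 f3 : T -> \bar R) (a b : R) : countable A ->
  (0 <= a)%R -> (0 <= b)%R ->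
  (forall x, A x -> 0 <= f1 x) ->
  (forall x, A x -> 0 <= f2 x) -> (forall x, A x -> 0 <= f3 x) ->
  (forall x, A x -> f x <= f1 x + a%:E * f2 x + b%:E * f3 x) ->
  \esum_(x in A) f x <= \esum_(x in A) f1 x + a%:E * (\esum_(x in A) f2 x) +
    b%:E * (\esum_(x in A) f3 x).
Proof.
move=> cA a0 b0 p1 p2 p3 h.
have q2 x : A x -> 0 <= a%:E * f2 x by move=> Ax; rewrite mule_ge0 ?lee_fin ?p2.
have q3 x : A x -> 0 <= b%:E * f3 x by move=> Ax; rewrite mule_ge0 ?lee_fin ?p3.
apply: (@le_trans _ _ (\esum_(x in A) (f1 x + a%:E * f2 x + b%:E * f3 x))).
  exact: le_esum.
rewrite esumD//; last by move=> x Ax; rewrite adde_ge0 ?p1 ?q2.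
by rewrite esumD// !esumZl.
Qed.

End linear_bounds.

Section interpolation.
Context {R : realType}.
Variables (s : nat -> R) (N : nat).
Hypotheses (s1 : forall n, 1 < s n)
  (sl : forall n, mass (s n) = ((N + n).+1%:R ^+ 2)%:E).

Definition massr (t : R) : R := fine (mass t).

Lemma massrE t : 1 < t -> mass t = (massr t)%:E.
Proof. by move=> t1; rewrite fineK// ge0_fin_numE ?mass_ge0// mass_fin. Qed.

Lemma massr_ge0 t : 0 <= massr t.
Proof. by rewrite fine_ge0// mass_ge0. Qed.

(** Nonincreasing functions of the exponent that are close to multiples of the
    mass at the levels are so in between as well, since consecutive squares
    have ratio close to 1. *)
Lemma interpolation (I : Type) (a : I -> R -> \bar R) (L : I -> R) :
  (forall i t u, 1 < t -> t <= u -> (a i u <= a i t)%E) ->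
  (forall i, 0 <= L i <= 1) ->
  (forall e, 0 < e -> exists M : nat, forall n, (M <= n)%N -> forall i,
    (((N + n).+1%:R ^+ 2 * (L i - e))%:E <= a i (s n))%E /\
    (a i (s n) <= ((N + n).+1%:R ^+ 2 * (L i + e))%:E)%E) ->
  forall e, 0 < e -> exists2 d, 0 < d & forall t, 1 < t -> t <= 1 + d -> forall i,
    ((massr t * (L i - e))%:E <= a i t)%E /\
    (a i t <= (massr t * (L i + e))%:E)%E.
Proof.
move=> anti L01 lev.
pose l n : R := (N + n).+1%:R.
have l0 n : 0 <= l n by [].
have lS n : l n.+1 = l n + 1 by rewrite /l addnS natr1.
have l_mono m n : (m <= n)%N -> l m <= l n by move=> mn; rewrite ler_nat ltnS leq_add2l.
suff main e : 0 < e -> e <= 1 -> exists2 d, 0 < d & forall t, 1 < t -> t <= 1 + d ->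
    forall i, ((massr t * (L i - e))%:E <= a i t)%E /\
    (a i t <= (massr t * (L i + e))%:E)%E.
  move=> e e0; have [||d d0 hd] := main (Num.min e 1).
  - by rewrite lt_min e0 ltr01.
  - by rewrite ge_min lexx orbT.
  exists d => // t t1 td i; have [h1 h2] := hd t t1 td i.
  have me : Num.min e 1 <= e by rewrite ge_min lexx.
  split.
    apply: le_trans h1; rewrite lee_fin ler_wpM2l ?massr_ge0//; lra.
  apply: le_trans h2 _; rewrite lee_fin ler_wpM2l ?massr_ge0//; lra.
move=> e0 e1.
have e40 : 0 < e / 4 by rewrite divr_gt0.
have [M HM] := lev _ e40.
(* Past the index K, the squares of three consecutive integers differ by at
   most e / 16 times the mass. *)
pose K := (M + (Num.bound (64 / e)))%N.+2.
have KM : (M <= K)%N by rewrite /K -addnS -addnS leq_addr.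
have lK : 64 / e <= l K.-2.+1.
  apply: le_trans (ltW (archi_boundP _)) _; first by rewrite divr_ge0// ltW.
  by rewrite ler_nat /K/= leqW// addnS leqW// addnA leq_addl.
have [d d0 hd] := @mass_large R (l K ^+ 2).
exists d => // t t1 td i.
have mK : l K ^+ 2 <= massr t by rewrite -lee_fin -massrE//; exact: hd.
have exn : exists n, massr t < l n ^+ 2.
  exists (Num.bound (massr t)); apply: lt_le_trans (archi_boundP (massr_ge0 t)) _.
  apply: (@le_trans _ _ (l (Num.bound (massr t)))).
    by rewrite ler_nat leqW// leq_addl.
  by rewrite expr2 ler_peMl// ler1n.
case: (ex_minnP exn) => k mk kmin.
have kK : (K < k)%N.
  rewrite ltnNge; apply/negP => kK; move: mk; rewrite ltNge => /negP; apply.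
  by apply: le_trans mK; rewrite lerXn2r ?nnegrE// l_mono.
case: k kK mk kmin => [//|[//|j]] Kj mj jmin.
have mj1 : l j.+1 ^+ 2 <= massr t.
  by rewrite leNgt; apply/negP => /jmin; rewrite ltnn.
have Mj : (M <= j)%N by move: Kj; rewrite /K !ltnS => /ltnW; apply: leq_trans; exact: leq_addr.
have xj : 64 / e <= l j.+1.
  apply: le_trans lK _; apply: l_mono; rewrite ltnS.
  by move: Kj; rewrite /K !ltnS => /ltnW.
(* The mass at t is between two consecutive squares, hence t is between the
   exponents s j.+2 and s j. *)
have skt : s j.+2 <= t.
  rewrite leNgt; apply/negP => /ltW /le_mass.
  by rewrite sl massrE// lee_fin leNgt mj.
have tsj : t <= s j.
  rewrite leNgt; apply/negP => /ltW /le_mass.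
  rewrite sl massrE// lee_fin leNgt => /negP; apply.
  by apply: lt_le_trans mj1; rewrite ltrXn2r// lS ltrDl.
have [_ up] := HM j.+2 (leqW (leqW Mj)) i.
have [low _] := HM j Mj i.
have {}up := le_trans (anti i _ _ (s1 _) skt) up.
have {}low := le_trans low (anti i _ _ t1 tsj).
rewrite -/(l j.+2) in up; rewrite -/(l j) in low.
have /andP[L0 L1] := L01 i.
move: up low; rewrite (lS j.+1).
have -> : l j = l j.+1 - 1 by rewrite lS addrK.
move: mj; rewrite (lS j.+1); move: (l0 j) (l0 j.+1); rewrite (_ : l j = l j.+1 - 1); last first.
  by rewrite lS addrK.
move: (l j.+1) (massr t) (L i) mj1 xj L0 L1 => y m A ym yx L0 L1 y1 y0 my up low.
have yem : y * 64 <= m * e.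
  have h1 : 64 <= y * e by rewrite -ler_pdivrMr.
  have h2 : y * 64 <= y * (y * e) by rewrite ler_wpM2l.
  apply: le_trans h2 _; rewrite mulrA -expr2 ler_wpM2r//; exact: ltW.
have m0 : 0 <= m by apply: le_trans ym; exact: sqr_ge0.
have u1 : (y + 1) ^+ 2 <= m + 3 / 64 * (m * e).
  have : (y + 1) ^+ 2 = y ^+ 2 + 2 * y + 1 by ring.
  have : 1 <= y by lra.
  lra.
have w1 : m - 4 / 64 * (m * e) <= (y - 1) ^+ 2.
  have : (y - 1) ^+ 2 = (y + 1) ^+ 2 - 4 * y by ring.
  lra.
have w2 : (y - 1) ^+ 2 <= m.
  apply: le_trans ym; rewrite lerXn2r ?nnegrE//; lra.
have me0 : 0 <= m * e by rewrite mulr_ge0// ltW.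
split.
  apply: le_trans low; rewrite lee_fin !mulrBr.
  have h1 : (m - 4 / 64 * (m * e)) * A <= (y - 1) ^+ 2 * A by rewrite ler_wpM2r.
  have h2 : (y - 1) ^+ 2 * (e / 4) <= m * (e / 4) by rewrite ler_wpM2r// ltW.
  have h3 : (m * e) * A <= (m * e) * 1 by rewrite ler_wpM2l.
  have h4 : (m - 4 / 64 * (m * e)) * A = m * A - 4 / 64 * ((m * e) * A) by ring.
  lra.
apply: le_trans up _; rewrite lee_fin.
have h1 : (y + 1) ^+ 2 * (A + e / 4) <= (m + 3 / 64 * (m * e)) * (A + e / 4).
  by rewrite ler_wpM2r//; lra.
apply: le_trans h1 _.
have h3 : (m * e) * (A + e / 4) <= (m * e) * 2 by rewrite ler_wpM2l//; lra.
have -> : (m + 3 / 64 * (m * e)) * (A + e / 4) =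
  m * A + m * e / 4 + 3 / 64 * ((m * e) * (A + e / 4)) by ring.
rewrite mulrDr; lra.
Qed.

End interpolation.

(** * Sums of Poisson integrals along the sequence *)

Section sums_along_levels.
Context {R : realType}.
Variable mu : probability (borelC R) R.
Variables (s : nat -> R) (N : nat).
Variable X : conf R.
Hypothesis deviation_circle : circle_concentration s N mu X.
Implicit Types (h : borelC R -> R) (x y z zeta : R[i]).

Let cX := countable_points X.

(** Nonnegativity makes integrals and sums meaningful and exchangeable without
    integrability conditions. *)
Definition admissible h : Prop :=
  [/\ measurable_fun (circle R : set (borelC R)) h, (forall zeta, 0 <= h zeta) &
      (\int[mu]_(zeta in circle R) (h zeta ^+ 2)%:E <= 1)%E].

Definition circle_mean h : \bar R := (\int[mu]_(zeta in circle R) (h zeta)%:E)%E.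

(** The Poisson integral of h, written with hypker 0, the absolute value of the
    Poisson kernel, in order to be nonnegative on the whole plane. *)
Definition pint h x : \bar R :=
  (\int[mu]_(zeta in circle R) (hypker 0 zeta x * h zeta)%:E)%E.

Lemma hypker_split t zeta x : hypker t zeta x = hyp x `^ t * hypker 0 zeta x.
Proof. by rewrite /hypker powRr0 mul1r. Qed.

Lemma hypker_eta0 t x : hypker t 0 x = hyp x `^ t.
Proof.
by rewrite /hypker rmorph0 mul0r /pker normc0 subr0 normc1 expr0n subr0 expr1n
  divr1 normr1 mulr1.
Qed.

Lemma measurable_hypker_eta t x :
  measurable_fun [set: borelC R] (fun zeta => hypker t zeta x).
Proof.
exact: (measurableT_comp (@measurable_hypker2 R t) (pair2_measurable (x : borelC R))).
Qed.

Lemma measurable_kersum_eta t :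
  measurable_fun [set: borelC R] (fun zeta => kersum t zeta X).
Proof.
have mk : measurable_fun [set: Conf_space R * borelC R] (fun p => kersum t p.2 p.1).
  apply: (@measurable_esum_points_joint R _ (borelC R)
    (fun p => (hypker t p.1 p.2)%:E)).
    by apply/measurable_EFinP; exact: measurable_hypker2.
  by move=> p; rewrite lee_fin hypker_ge0.
exact: (measurableT_comp mk (pair1_measurable (X : Conf_space R))).
Qed.

Lemma measurable_deviation_eta t c :
  measurable_fun [set: borelC R] (fun zeta => deviation t c zeta X).
Proof.
exact: (measurableT_comp (@measurable_deviation2 R t c)
  (pair1_measurable (X : Conf_space R))).
Qed.

Let mC := @measurable_circle R.

Lemma circle_mean_ge0 h : admissible h -> (0 <= circle_mean h)%E.
Proof. by move=> [_ h0 _]; apply: integral_ge0 => z _; rewrite lee_fin. Qed.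

Lemma circle_mean_le1 h : admissible h -> (circle_mean h <= 1)%E.
Proof.
move=> [mh h0 h2].
have mh2 : measurable_fun (circle R : set (borelC R)) (fun z => (h z ^+ 2)%:E).
  by apply/measurable_EFinP; exact: measurable_funX.
apply: (@le_trans _ _ ((2^-1)%:E * 1 + (2^-1)%:E * 1)%E); last first.
  by rewrite !mule1 -EFinD lee_fin; lra.
have half : 0 <= 2^-1 :> R by rewrite invr_ge0.
apply: (@le_trans _ _ ((\int[mu]_(z in circle R) (2^-1)%:E) +
    (2^-1)%:E * \int[mu]_(z in circle R) (h z ^+ 2)%:E)%E); last first.
  apply: leeD; last by apply: lee_wpmul2l.
  rewrite integral_cst//; apply: lee_wpmul2l => //; exact: probability_le1.
rewrite -ge0_integralZl_EFin//; last by move=> z _; rewrite lee_fin sqr_ge0.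
rewrite -ge0_integralD//; last 2 first.
- by move=> z _; rewrite mule_ge0// lee_fin sqr_ge0.
- exact: measurable_funeM.
apply: le_integral_ge0 => z _; first by rewrite lee_fin.
rewrite -EFinM -EFinD lee_fin; have := sqr_ge0 (h z - 1).
rewrite sqrrB1; lra.
Qed.

Lemma circle_mean_fin h : admissible h -> circle_mean h = (fine (circle_mean h))%:E.
Proof.
move=> ah; rewrite fineK// ge0_fin_numE ?circle_mean_ge0//.
by apply: le_lt_trans (circle_mean_le1 ah) _; exact: ltry.
Qed.

Lemma circle_mean01 h : admissible h -> 0 <= fine (circle_mean h) <= 1.
Proof.
by move=> ah; rewrite -!lee_fin -circle_mean_fin// circle_mean_ge0// circle_mean_le1.
Qed.

Lemma pint_ge0 h x : admissible h -> (0 <= pint h x)%E.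
Proof.
move=> [_ h0 _]; apply: integral_ge0 => z _.
by rewrite lee_fin mulr_ge0// hypker_ge0.
Qed.

Lemma measurable_pint_integrand h x : admissible h ->
  measurable_fun (circle R : set (borelC R)) (fun z => (hypker 0 z x * h z)%:E).
Proof.
move=> [mh _ _]; apply/measurable_EFinP; apply: measurable_funM => //.
by apply: measurable_funTS; exact: measurable_hypker_eta.
Qed.

Lemma hypker0_le zeta x : normc zeta <= 1 -> disc R x ->
  hypker 0 zeta x <= (hyp x)^-1.
Proof.
by move=> z1 x1; rewrite hypkerE// powRr0 mul1r pker_le_hyp.
Qed.

Lemma circle_le1 zeta : circle R zeta -> normc zeta <= 1.
Proof. by move=> ->. Qed.

Lemma pint_le h x : admissible h -> disc R x -> (pint h x <= ((hyp x)^-1)%:E * circle_mean h)%E.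
Proof.
move=> ah x1; have [mh h0 _] := ah.
rewrite -ge0_integralZl_EFin//.
- apply: le_integral_ge0 => z zc; first by rewrite lee_fin mulr_ge0// hypker_ge0.
  by rewrite -EFinM lee_fin ler_wpM2r// hypker0_le// circle_le1.
- by move=> z _; rewrite lee_fin.
- exact/measurable_EFinP.
- by rewrite invr_ge0 ltW// hyp_gt0.
Qed.

Lemma pint_fin h x : admissible h -> disc R x -> pint h x = (fine (pint h x))%:E.
Proof.
move=> ah x1; rewrite fineK// ge0_fin_numE ?pint_ge0//.
apply: le_lt_trans (pint_le ah x1) _; rewrite (circle_mean_fin ah) -EFinM; exact: ltry.
Qed.

Definition psum h t : \bar R :=
  \esum_(x in points X) ((hyp x `^ t)%:E * pint h x)%E.

(** Reduces sums of Poisson integrals to the statistics kersum at points of the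
    circle, which do not involve h. *)
Lemma psum_integral h t : admissible h ->
  psum h t = (\int[mu]_(zeta in circle R) ((h zeta)%:E * kersum t zeta X))%E.
Proof.
move=> ah; have [mh h0 _] := ah.
have mk x : measurable_fun (circle R : set (borelC R)) (fun z => (hypker t z x)%:E).
  by apply/measurable_EFinP/measurable_funTS; exact: measurable_hypker_eta.
have mh' : measurable_fun (circle R : set (borelC R)) (fun z => (h z)%:E).
  exact/measurable_EFinP.
rewrite /psum.
have [|_ ->] := @enum_pointsP R X (fun x => ((hyp x `^ t)%:E * pint h x)%E).
  by move=> x _; rewrite mule_ge0 ?lee_fin ?powR_ge0 ?pint_ge0.
have kE z : kersum t z X =
    (\sum_(n <oo) oapp (fun x => (hypker t z x)%:E) 0 (enum_points X n))%E.
  have [|_ //] := @enum_pointsP R X (fun x => (hypker t z x)%:E).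
  by move=> x _; rewrite lee_fin hypker_ge0.
transitivity (\int[mu]_(z in circle R)
    \sum_(n <oo) ((h z)%:E * oapp (fun x => (hypker t z x)%:E) 0 (enum_points X n)))%E;
    last first.
  apply: eq_integral => z _; rewrite kE nneseriesZl// => n _.
  by case: (enum_points X n) => //= x; rewrite lee_fin hypker_ge0.
rewrite integral_nneseries//.
- apply: eq_eseriesr => n _; case: (enum_points X n) => [x|] /=; last first.
    by under eq_integral do rewrite mule0; rewrite integral0.
  rewrite /pint -ge0_integralZl_EFin//.
  + by apply: eq_integral => z _; rewrite -!EFinM (hypker_split t); congr EFin; ring.
  + by move=> z _; rewrite lee_fin mulr_ge0// hypker_ge0.
  + exact: measurable_pint_integrand.
  + exact: powR_ge0.
- move=> n; case: (enum_points X n) => [x|] /=; last first.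
    by under eq_fun do rewrite mule0; exact: measurable_cst.
  by apply: emeasurable_funM.
- move=> n z _; case: (enum_points X n) => [x|] /=; last by rewrite mule0.
  by rewrite mule_ge0 ?lee_fin ?hypker_ge0.
Qed.

Lemma mul_le_square (k d b : R) : 0 < k -> b * d <= k * b ^+ 2 + k^-1 * (d * d).
Proof.
move=> k0; rewrite -(ler_pM2l k0).
have -> : k * (k * b ^+ 2 + k^-1 * (d * d)) = (k * b) ^+ 2 + d ^+ 2.
  by field; rewrite gt_eqF.
have := sqr_ge0 (k * b - d); have := sqr_ge0 (k * b); have := sqr_ge0 d.
have -> : (k * b - d) ^+ 2 = (k * b) ^+ 2 - 2 * (k * (b * d)) + d ^+ 2 by ring.
lra.
Qed.

(** Young's inequality for the product of b and kersum - c, without subtraction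
    since kersum may be infinite. *)
Lemma deviation_bounds t c k b zeta : 0 <= c -> 0 < k -> 0 <= b ->
  ((b%:E * kersum t zeta X <= (c * b)%:E + k%:E * (b ^+ 2)%:E +
      (k^-1)%:E * deviation t c zeta X) /\
   ((c * b)%:E <= b%:E * kersum t zeta X + k%:E * (b ^+ 2)%:E +
      (k^-1)%:E * deviation t c zeta X))%E.
Proof.
move=> c0 k0 b0; rewrite /deviation.
have := kersum_ge0 t zeta X; case: (kersum t zeta X) => [y| |] // y0.
  rewrite -!EFinB -!EFinM -!EFinD !lee_fin.
  have h1 := mul_le_square (y - c) b k0; have h2 := mul_le_square (c - y) b k0.
  have e : (c - y) * (c - y) = (y - c) * (y - c) by ring.
  by rewrite e in h2; split; lra.
have -> : (+oo - c%:E = +oo :> \bar R)%E by [].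
have e : ((k^-1)%:E * +oo = +oo :> \bar R)%E by rewrite gt0_muley// lte_fin invr_gt0.
have p : (0 <= b%:E * +oo + k%:E * (b ^+ 2)%:E :> \bar R)%E.
  by rewrite adde_ge0 ?mule_ge0 ?lee_fin ?sqr_ge0// ltW.
rewrite mulyy e addey ?leey; last by rewrite -EFinM.
by split=> //; rewrite addey ?leey// gt_eqF// (lt_le_trans _ p)// ltNyr.
Qed.

(** The rank M does not depend on h: only the square integral of h enters the
    error. This is what makes the exceptional configurations independent of the
    function. *)
Lemma psum_levels e : 0 < e -> exists M : nat, forall n, (M <= n)%N ->
  forall h, admissible h ->
    (((N + n).+1%:R ^+ 2 * (fine (circle_mean h) - e))%:E <= psum h (s n))%E /\
    (psum h (s n) <= ((N + n).+1%:R ^+ 2 * (fine (circle_mean h) + e))%:E)%E.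
Proof.
move=> e0; have e2 : 0 < (e / 2) ^+ 2 by rewrite exprn_gt0// divr_gt0.
have [M HM] := deviation_circle e2; exists M => n /HM {HM}.
pose l : R := (N + n).+1%:R; have l0 : 0 < l by rewrite ltr0n.
rewrite -/l => HD h ah; have [mh h0 h2] := ah.
(* This choice balances the two error terms of Young's inequality. *)
pose k := l ^+ 2 * (e / 2).
have k0 : 0 < k by rewrite mulr_gt0 ?exprn_gt0// divr_gt0.
have c0 : 0 <= l ^+ 2 by exact: sqr_ge0.
have ki0 : 0 <= k^-1 by rewrite invr_ge0 ltW.
have mh' : measurable_fun (circle R : set (borelC R)) (fun z => (h z)%:E).
  exact/measurable_EFinP.
have m1 : measurable_fun (circle R : set (borelC R)) (fun z => (l ^+ 2 * h z)%:E).
  by apply/measurable_EFinP; exact: measurable_funM.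
have m2 : measurable_fun (circle R : set (borelC R)) (fun z => (h z ^+ 2)%:E).
  by apply/measurable_EFinP; exact: measurable_funX.
have m3 : measurable_fun (circle R : set (borelC R))
    (fun z => deviation (s n) (l ^+ 2) z X).
  by apply: measurable_funTS; exact: measurable_deviation_eta.
have m4 : measurable_fun (circle R : set (borelC R))
    (fun z => (h z)%:E * kersum (s n) z X)%E.
  apply: emeasurable_funM => //; apply: measurable_funTS.
  exact: measurable_kersum_eta.
have p4 z : (0 <= (h z)%:E * kersum (s n) z X)%E.
  by rewrite mule_ge0 ?lee_fin ?kersum_ge0.
have tE : (\int[mu]_(z in circle R) (l ^+ 2 * h z)%:E = (l ^+ 2 * fine (circle_mean h))%:E)%E.
  transitivity ((l ^+ 2)%:E * circle_mean h)%E; last by rewrite {1}(circle_mean_fin ah) EFinM.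
  rewrite /circle_mean -ge0_integralZl_EFin//; last by move=> z _; rewrite lee_fin.
have rest : (k%:E * (\int[mu]_(z in circle R) (h z ^+ 2)%:E) +
     (k^-1)%:E * (\int[mu]_(z in circle R) deviation (s n) (l ^+ 2) z X)
     <= (l ^+ 2 * e)%:E)%E.
  apply: (@le_trans _ _ (k%:E * 1 + (k^-1)%:E * ((e / 2) ^+ 2 * l ^+ 4)%:E)%E).
    by apply: leeD; apply: lee_wpmul2l => //; rewrite lee_fin ltW.
  rewrite mule1 -EFinM -EFinD lee_fin /k le_eqVlt; apply/orP; left; apply/eqP.
  by field; rewrite !gt_eqF.
rewrite (psum_integral _ ah); split.
  have := @le_integral_lin3 _ _ _ mu (circle R) (fun z => (l ^+ 2 * h z)%:E)
    (fun z => (h z)%:E * kersum (s n) z X)%E (fun z => (h z ^+ 2)%:E)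
    (fun z => deviation (s n) (l ^+ 2) z X) k k^-1 mC m4 m2 m3 (ltW k0) ki0.
  rewrite tE => /(_ _ _ _ _ _) H.
  have {}H : ((l ^+ 2 * fine (circle_mean h))%:E <=
      \int[mu]_(z in circle R) ((h z)%:E * kersum (s n) z X) + (l ^+ 2 * e)%:E)%E.
    apply: le_trans (H _ _ _ _ _) _.
    - by move=> z _; rewrite lee_fin mulr_ge0.
    - by move=> z _; exact: p4.
    - by move=> z _; rewrite lee_fin sqr_ge0.
    - by move=> z _; exact: deviation_ge0.
    - by move=> z _; have [] := deviation_bounds (s n) z c0 k0 (h0 z).
    by rewrite -addeA leeD2l.
  by rewrite mulrBr EFinB leeBlDr.
have H := @le_integral_lin3 _ _ _ mu (circle R)
    (fun z => (h z)%:E * kersum (s n) z X)%E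
    (fun z => (l ^+ 2 * h z)%:E) (fun z => (h z ^+ 2)%:E)
    (fun z => deviation (s n) (l ^+ 2) z X) k k^-1 mC m1 m2 m3 (ltW k0) ki0.
apply: le_trans (H _ _ _ _ _) _.
- by move=> z _; exact: p4.
- by move=> z _; rewrite lee_fin mulr_ge0.
- by move=> z _; rewrite lee_fin sqr_ge0.
- by move=> z _; exact: deviation_ge0.
- by move=> z _; have [] := deviation_bounds (s n) z c0 k0 (h0 z).
by rewrite tE -addeA mulrDr EFinD leeD2l.
Qed.

End sums_along_levels.

(** * Uniformity on compact subsets of the disc *)

Section uniform_levels.
Context {R : realType}.
Variables (s : nat -> R) (N : nat).
Variable X : conf R.
Hypothesis deviation_rat : rational_concentration s N X.
Implicit Types (x y z zeta : R[i]).

Let cX := countable_points X.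

Lemma deviation_le (t c e : R) eta : 0 <= c -> 0 <= e ->
  (deviation t c eta X <= ((e * c) ^+ 2)%:E)%E ->
  ((c * (1 - e))%:E <= kersum t eta X)%E /\
  (kersum t eta X <= (c * (1 + e))%:E)%E.
Proof.
move=> c0 e0; rewrite /deviation.
have := kersum_ge0 t eta X; case: (kersum t eta X) => [y| |] // y0.
rewrite -EFinB -EFinM !lee_fin -expr2 => h.
have {h} : `|y - c| <= e * c.
  rewrite -(ler_pXn2r (n := 2))// ?nnegrE ?mulr_ge0//.
  by rewrite real_normK ?num_real.
by rewrite ler_norml => /andP[h1 h2]; split; lra.
Qed.

Lemma kersum_levels_rat (q : rat * rat) (e : R) :
  normc (ratr q.1 +i* ratr q.2 : R[i]) <= 1 -> 0 < e ->
  exists M : nat, forall n, (M <= n)%N ->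
    (((N + n).+1%:R ^+ 2 * (1 - e))%:E <= kersum (s n) (ratr q.1 +i* ratr q.2) X)%E /\
    (kersum (s n) (ratr q.1 +i* ratr q.2) X <= ((N + n).+1%:R ^+ 2 * (1 + e))%:E)%E.
Proof.
move=> q1 e0.
have e20 : 0 < e ^+ 2 by rewrite exprn_gt0.
have [M HM] := deviation_rat q1 e20; exists M => n /HM h.
apply: deviation_le; [exact: sqr_ge0|exact: ltW|].
by rewrite exprMn -exprM.
Qed.

Lemma kersum_lip (r t : R) z w : 0 <= r -> r < 1 -> normc z <= r -> normc w <= r ->
  (kersum t z X <= kersum t w X +
     (12 / (1 - r) ^+ 4 * normc (z - w))%:E * kersum t 0%R X)%E.
Proof.
move=> r0 r1 zr wr.
have c0 : 0 <= 12 / (1 - r) ^+ 4 * normc (z - w).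
  by rewrite mulr_ge0 ?normc_ge0// divr_ge0// exprn_ge0// subr_ge0 ltW.
have -> : (kersum t z X = \esum_(x in points X) (hypker t z x)%:E)%E by [].
rewrite {2}/kersum -esumZl//; last by move=> x _; rewrite lee_fin hypker_ge0.
rewrite -esumD; last 2 first.
- by move=> x _; rewrite lee_fin hypker_ge0.
- by move=> x _; rewrite mule_ge0// lee_fin hypker_ge0.
apply: le_esum => x /points_disc x1; have {}x1 : normc x <= 1 by exact: ltW.
rewrite -EFinM -EFinD lee_fin hypker_eta0 (mulrC _ (hyp x `^ t)) /hypker -mulrDr.
rewrite ler_wpM2l ?powR_ge0//.
rewrite -lerBlDl; apply: le_trans (lerB_dist _ _) _.
have zx v : normc v <= r -> normc (v^* * x) <= r.
  move=> vr; rewrite normcM normc_conj; apply: le_trans vr.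
  by rewrite ler_piMr ?normc_ge0.
apply: le_trans (pker_lip r0 r1 (zx _ zr) (zx _ wr)) _.
rewrite ler_wpM2l ?divr_ge0// ?exprn_ge0// ?subr_ge0 ?(ltW r1)//.
have := @normc_conjMB _ z w x x x1.
by rewrite subrr normc0 addr0; apply; exact: le_trans (ltW r1).
Qed.

Lemma rat_near z (e : R) : 0 < e -> exists q : rat * rat,
  normc (z - (ratr q.1 +i* ratr q.2)) < e.
Proof.
move=> e0.
have rd (a : R) : exists q : rat, `|a - ratr q| < e / 2.
  have e2 : a - e / 2 < a + e / 2.
    by rewrite ltrD2l gtrN// divr_gt0.
  have [q qx] := rat_in_itvoo e2.
  by exists q; rewrite ltr_distlC; move: qx; rewrite in_itv.
have [p hp] := rd (complex.Re z); have [q hq] := rd (complex.Im z).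
exists (p, q); apply: le_lt_trans (normc_le_ReIm _) _.
by rewrite [ltRHS]splitr; case: z hp hq => a b /= hp hq; rewrite ltrD.
Qed.

(** Uniformity comes from a finite net, as the kernels depend on the point in a
    Lipschitz way. *)
Lemma kersum_levels (r : R) : 0 <= r -> r < 1 -> forall e : R, 0 < e ->
  exists M : nat, forall n, (M <= n)%N -> forall z, normc z <= r ->
    (((N + n).+1%:R ^+ 2 * (1 - e))%:E <= kersum (s n) z X)%E /\
    (kersum (s n) z X <= ((N + n).+1%:R ^+ 2 * (1 + e))%:E)%E.
Proof.
move=> r0 r1 e e0.
pose r2 := (1 + r) / 2.
have r20 : 0 <= r2 by rewrite /r2; lra.
have r21 : r2 < 1 by rewrite /r2; lra.
pose C : R := 12 / (1 - r2) ^+ 4.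
have C0 : 0 < C by rewrite divr_gt0// exprn_gt0// subr_gt0.
have C40 : 0 < 4 * C by apply: mulr_gt0.
pose d := Num.min ((1 - r) / 2) (e / (4 * C)).
have d0 : 0 < d.
  rewrite lt_min; apply/andP; split; first by rewrite divr_gt0// subr_gt0.
  exact: divr_gt0.
have dr : d <= (1 - r) / 2 by rewrite ge_min lexx.
have dC : C * d <= e / 4.
  have : d <= e / (4 * C) by rewrite ge_min lexx orbT.
  rewrite (ler_pdivlMr _ _ C40) => h.
  by rewrite ler_pdivlMr// (_ : C * d * 4 = d * (4 * C))//; ring.
pose ratc (q : rat * rat) : R[i] := ratr q.1 +i* ratr q.2.
pose D : set (rat * rat) := [set q | normc (ratc q) <= r2].
have e40 : 0 < e / 4 by rewrite divr_gt0.
have /choice[m hm] : forall q, exists m : nat, D q -> forall n, (m <= n)%N ->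
    (((N + n).+1%:R ^+ 2 * (1 - e / 4))%:E <= kersum (s n) (ratc q) X)%E /\
    (kersum (s n) (ratc q) X <= ((N + n).+1%:R ^+ 2 * (1 + e / 4))%:E)%E.
  move=> q; have [Dq|nD] := pselect (D q); last by exists 0%N.
  have [M HM] := kersum_levels_rat (le_trans Dq (ltW r21)) e40.
  by exists M => _.
have := @compact_normc_le R r; rewrite compact_cover.
move=> /(_ (rat * rat)%type D (fun q => [set z : R[i]^o | normc (z - ratc q) < d])).
case.
- move=> q _; apply/openC_normcP => z /= zq; exists (d - normc (z - ratc q)).
    by rewrite subr_gt0.
  move=> y yz.
  have -> : y - ratc q = (y - z) + (z - ratc q) by ring.
  apply: le_lt_trans (le_normcD _ _) _.
  by rewrite -ltrBrDr normcC.
- move=> z zr; have [q hq] := rat_near z d0.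
  exists q => //; rewrite /D/mkset.
  have -> : ratc q = z - (z - ratc q) by ring.
  apply: le_trans (le_normcD _ _) _; rewrite normcN.
  apply: le_trans (lerD zr (ltW hq)) _; rewrite /r2; lra.
move=> F FD Fcov.
pose q0 : rat * rat := (0, 0).
have rat0 : ratr q0.1 +i* ratr q0.2 = 0 :> R[i] by rewrite /q0/= !rmorph0.
have O1 : normc (ratr q0.1 +i* ratr q0.2 : R[i]) <= 1 by rewrite rat0 normc0.
have [M0 HM0] := kersum_levels_rat O1 (@ltr01 R).
exists (maxn M0 (\max_(q <- finmap.enum_fset F) m q)) => n.
rewrite geq_max => /andP[M0n Mn] z zr.
have [q /= qF zq] := Fcov z zr.
have Dq : D q by have := FD q qF; rewrite inE.
have [_ k0] := HM0 n M0n.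
have {}k0 : (kersum (s n) 0%R X <= ((N + n).+1%:R ^+ 2 * 2)%:E)%E.
  by move: k0; rewrite rat0.
have mn : (m q <= n)%N.
  by apply: leq_trans Mn; exact: leq_bigmax_seq.
have [q1 q2] := hm q Dq n mn.
move: (N + n).+1%:R k0 q1 q2 => l k0 q1 q2.
have zr2 : normc z <= r2 by rewrite /r2; lra.
have l1 := kersum_lip (s n) r20 r21 zr2 Dq.
have l2 := kersum_lip (s n) r20 r21 Dq zr2.
rewrite normcC in l2; rewrite -/C in l1 l2.
have c0 : 0 <= C * normc (z - ratc q) by rewrite mulr_ge0 ?normc_ge0// ltW.
have c1 : C * normc (z - ratc q) <= e / 4.
  by apply: le_trans dC; rewrite ler_pM2l// ltW.
have err : ((C * normc (z - ratc q))%:E * kersum (s n) 0%R X <=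
    (e / 4 * (l ^+ 2 * 2))%:E)%E.
  apply: (@le_trans _ _ ((C * normc (z - ratc q))%:E * (l ^+ 2 * 2)%:E)%E).
    exact: lee_wpmul2l.
  by rewrite -EFinM lee_fin ler_wpM2r// mulr_ge0// sqr_ge0.
have l20 : 0 <= l ^+ 2 by exact: sqr_ge0.
have le0 : 0 <= l ^+ 2 * e by rewrite mulr_ge0// ltW.
split; last first.
  apply: le_trans l1 _; apply: le_trans (leeD q2 err) _.
  by rewrite -EFinD lee_fin; lra.
have := le_trans q1 (le_trans l2 (leeD2l _ err)).
rewrite -leeBlDr// -EFinB; apply: le_trans; rewrite lee_fin; lra.
Qed.

End uniform_levels.

(** * Asymptotics of the weighted sums *)

Section kernel_comparison.
Context {R : realType}.
Implicit Types (x y z zeta : R[i]).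

Lemma hyp_powR_ler (t u : R) x : disc R x -> t <= u -> hyp x `^ u <= hyp x `^ t.
Proof. by move=> x1 tu; apply: ger_powR => //; rewrite hyp_gt0// hyp_le1. Qed.

Lemma hyp_powR_mul (t : R) x : disc R x -> 1 <= t -> hyp x `^ t * hyp x <= hyp x `^ 2.
Proof.
move=> x1 t1; have v0 := hyp_gt0 x1.
rewrite -{2}(powRr1 (ltW v0)) -powRD; last by rewrite (gt_eqF v0) implybT.
apply: hyp_powR_ler => //; lra.
Qed.

Lemma hyp_defect x : disc R x -> 1 - normc x <= 2 * hyp x.
Proof.
move=> x1; have x0 := normc_ge0 x; have {}x1 : normc x < 1 := x1.
rewrite /hyp mulrA ler_pdivlMr ?ltr_pwDl//.
by move: (normc x) x0 x1 => a a0 a1; nra.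
Qed.

Lemma normc_circle_dist x zeta : circle R zeta ->
  normc (1 - zeta^* * x) = normc (x - zeta).
Proof.
move=> zc.
have zz : zeta^* * zeta = 1.
  by rewrite mulrC mul_conj_normc (zc : normc zeta = 1) expr1n.
have -> : 1 - zeta^* * x = zeta^* * (zeta - x) by rewrite mulrBr zz.
by rewrite normcM normc_conj (zc : normc zeta = 1) mul1r normcC.
Qed.

(** The Poisson kernel is concentrated near its pole: its product with the
    squared distance to the pole vanishes at the boundary. *)
Lemma pker_concentration x zeta (e : R) : disc R x -> circle R zeta -> 0 < e ->
  normc (x - zeta) * pker (zeta^* * x) <= e * pker (zeta^* * x) + 4 / e * hyp x.
Proof.
move=> x1 zc e0.
have z1 : normc zeta = 1 := zc.
have t1 : normc (zeta^* * x) < 1 by apply: normc_conjM_lt1 => //; rewrite z1.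
have p0 : 0 <= pker (zeta^* * x) by rewrite pker_ge0// ltW.
have D0 : 0 < normc (x - zeta) by rewrite -normc_circle_dist// normc_1B_gt0.
have pE : pker (zeta^* * x) * normc (x - zeta) ^+ 2 = 1 - normc x ^+ 2.
  rewrite /pker normc_circle_dist// normcM normc_conj z1 mul1r divfK//.
  by rewrite expf_neq0// gt_eqF.
have h4 := hyp_ge x1.
move: (pker (zeta^* * x)) (normc (x - zeta)) p0 D0 pE => p D p0 D0 pE.
rewrite -(ler_pM2l e0).
have -> : e * (e * p + 4 / e * hyp x) = e ^+ 2 * p + 4 * hyp x.
  by field; rewrite gt_eqF.
have h1 : p * D ^+ 2 <= 4 * hyp x by rewrite pE; lra.
have h2 : 0 <= p * (D - e) ^+ 2 by rewrite mulr_ge0// sqr_ge0.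
have h3 : 0 <= p * D ^+ 2 by rewrite mulr_ge0// sqr_ge0.
have h5 : 0 <= p * e ^+ 2 by rewrite mulr_ge0// sqr_ge0.
have h6 : p * (D - e) ^+ 2 = p * D ^+ 2 + e ^+ 2 * p - 2 * (e * (D * p)) by ring.
have h7 : p * e ^+ 2 = e ^+ 2 * p by ring.
lra.
Qed.

(** In the approximation of gweight t z x by a power of hyp x times
    pker (z^* * x), the kernel may be replaced by pker (zeta^* * z) against the Poisson kernel with pole zeta at x, because
    only those zeta matter that are close to x. *)
Lemma gweight_comparison (r : R) : 0 <= r -> r < 1 -> exists2 C : R, 0 <= C &
  forall t x z zeta e, 1 < t -> t <= 2 -> disc R x -> normc z <= r ->
    circle R zeta -> 0 < e ->
  `|gweight t z x * hypker 0 zeta x - hyp x `^ t * hypker 0 zeta z * hypker 0 zeta x| <=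
  C * ((t - 1) + e) * (hyp x `^ t * hypker 0 zeta x) + C * (4 / e) * hyp x `^ 2.
Proof.
move=> r0 r1; have [C C0 hC] := gweight_pker r0 r1.
pose C2 : R := 12 / (1 - r) ^+ 4.
have C20 : 0 <= C2 by rewrite divr_ge0// exprn_ge0// subr_ge0 ltW.
exists (C + C2); first exact: addr_ge0.
move=> t x z zeta e t1 t2 x1 zr zc e0.
have z1 : disc R z by apply: le_lt_trans r1.
have zz : normc zeta <= 1 by rewrite (zc : normc zeta = 1).
rewrite !hypkerE// !powRr0 !mul1r.
have hg := hC t x z t1 t2 x1 zr.
have hp := pker_concentration x1 zc e0.
have p0 : 0 <= pker (zeta^* * x) by rewrite pker_ge0// ltW// normc_conjM_lt1.
have hz : `|pker (z^* * x) - pker (zeta^* * z)| <= C2 * normc (x - zeta).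
  have -> : pker (zeta^* * z) = pker (z^* * zeta).
    by rewrite -pker_conj rmorphM/= conjcK mulrC.
  apply: le_trans (pker_lip r0 r1 _ _) _.
  - rewrite normcM normc_conj; apply: le_trans zr.
    by rewrite ler_piMr ?normc_ge0// ltW.
  - by rewrite normcM normc_conj (zc : normc zeta = 1) mulr1.
  by rewrite -mulrBr normcM normc_conj ler_wpM2l// ler_piMl ?normc_ge0// ltW.
have dx : 1 - normc x <= normc (x - zeta).
  rewrite -normc_circle_dist//; apply: le_trans (normc_1B _).
  by rewrite normcM normc_conj (zc : normc zeta = 1) mul1r.
have w0 := powR_ge0 (hyp x) t.
have w2 := hyp_powR_mul x1 (ltW t1).
move: (gweight t z x) (pker (zeta^* * x)) (pker (z^* * x)) (pker (zeta^* * z))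
  (normc (x - zeta)) (normc x) (hyp x `^ t) (hyp x `^ 2) hg hp p0 hz dx w0 w2
  => g p q pz D a w W hg hp p0 hz dx w0 w2.
rewrite -mulrBl normrM (ger0_norm p0).
have h1 : `|g - w * pz| <= C * (w * ((t - 1) + D)) + w * (C2 * D).
  rewrite (_ : g - w * pz = (g - w * q) + w * (q - pz)); last by ring.
  apply: le_trans (ler_normD _ _) _; rewrite (normrM w) (ger0_norm w0).
  apply: lerD; last by rewrite ler_wpM2l.
  apply: le_trans hg _; rewrite ler_wpM2l// ler_wpM2l//; lra.
have h2 : `|g - w * pz| * p <= (C * (w * ((t - 1) + D)) + w * (C2 * D)) * p.
  by rewrite ler_wpM2r.
apply: le_trans h2 _.
rewrite (_ : _ * p = C * (t - 1) * (w * p) + (C + C2) * (w * (D * p))); last by ring.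
have h3 : w * (D * p) <= w * (e * p) + 4 / e * W.
  apply: (@le_trans _ _ (w * (e * p + 4 / e * hyp x))); first by rewrite ler_wpM2l.
  rewrite mulrDr lerD2l (_ : w * _ = 4 / e * (w * hyp x)); last by ring.
  by rewrite ler_wpM2l// divr_ge0// ltW.
have h4 : (C + C2) * (w * (D * p)) <= (C + C2) * (w * (e * p) + 4 / e * W).
  by rewrite ler_wpM2l// addr_ge0.
have t0 : 0 <= t - 1 by rewrite subr_ge0 ltW.
have h5 : 0 <= C2 * (t - 1) * (w * p) by apply: mulr_ge0; apply: mulr_ge0.
apply: le_trans (lerD (lexx _) h4) _.
have -> : (C + C2) * (t - 1 + e) * (w * p) + (C + C2) * (4 / e) * W =
  C * (t - 1) * (w * p) + (C + C2) * (w * (e * p) + 4 / e * W) +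
   C2 * (t - 1) * (w * p) by ring.
by rewrite lerDl.
Qed.

End kernel_comparison.

Section asymptotics.
Context {R : realType}.
Variable mu : probability (borelC R) R.
Variables (s : nat -> R) (N : nat).
Hypotheses (s1 : forall n, 1 < s n)
  (sl : forall n, mass (s n) = ((N + n).+1%:R ^+ 2)%:E).
Variable X : conf R.
Hypothesis kersum_fin : forall t : R, 1 < t -> (kersum t 0%R X < +oo)%E.
Hypothesis deviation_circle : circle_concentration s N mu X.
Hypothesis deviation_rat : rational_concentration s N X.
Implicit Types (h : borelC R -> R) (x y z zeta : R[i]).

Let cX := countable_points X.
Let mC := @measurable_circle R.

Lemma massr_large (A : R) : exists2 d : R, 0 < d & forall t : R, 1 < t -> t <= 1 + d ->
  A <= massr t.
Proof.
have [d d0 hd] := @mass_large R A; exists d => // t t1 td.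
by rewrite -lee_fin -massrE//; exact: hd.
Qed.

Lemma psum_bounds (e : R) : 0 < e -> exists2 d : R, 0 < d & forall t : R, 1 < t -> t <= 1 + d ->
  forall h, admissible mu h ->
    ((massr t * (fine (circle_mean mu h) - e))%:E <= psum mu X h t)%E /\
    (psum mu X h t <= (massr t * (fine (circle_mean mu h) + e))%:E)%E.
Proof.
move=> e0.
pose I := {h : borelC R -> R | admissible mu h}.
have := @interpolation R s N s1 sl I (fun i t => psum mu X (sval i) t)
  (fun i => fine (circle_mean mu (sval i))).
move=> /(_ _ _ _ e e0) H; case: H.
- move=> [h ah] t u t1 tu /=; apply: le_esum => x /points_disc x1.
  apply: lee_wpmul2r; first exact: pint_ge0.
  by rewrite lee_fin hyp_powR_ler.
- by move=> [h ah] /=; exact: circle_mean01.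
- move=> e' /(psum_levels deviation_circle)[M HM]; exists M => n Mn [h ah] /=.
  exact: HM.
by move=> d d0 hd; exists d => // t t1 td h ah; exact: (hd t t1 td (exist _ h ah)).
Qed.

Lemma kersum_bounds (r e : R) : 0 <= r -> r < 1 -> 0 < e ->
  exists2 d : R, 0 < d & forall t : R, 1 < t -> t <= 1 + d -> forall z, normc z <= r ->
    ((massr t * (1 - e))%:E <= kersum t z X)%E /\
    (kersum t z X <= (massr t * (1 + e))%:E)%E.
Proof.
move=> r0 r1 e0.
pose I := {z : R[i] | normc z <= r}.
have := @interpolation R s N s1 sl I (fun i t => kersum t (sval i) X) (fun=> 1).
move=> /(_ _ _ _ e e0) H; case: H.
- move=> [z zr] t u t1 tu /=; apply: le_esum => x /points_disc x1.
  by rewrite lee_fin ler_wpM2r// hyp_powR_ler.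
- by move=> _; rewrite ler01 lexx.
- move=> e' /(kersum_levels deviation_rat r0 r1)[M HM]; exists M => n Mn [z zr] /=.
  exact: HM.
by move=> d d0 hd; exists d => // t t1 td z zr; exact: (hd t t1 td (exist _ z zr)).
Qed.

Definition gsum (t : R) z : \bar R := \esum_(x in points X) (gweight t z x)%:E.

(** By gweight_pker, the sum differs from kersum t z by t - 1 times the mass, up
    to a constant, and by a multiple of kersum 2 0, which does not depend on
    t. *)
Lemma gsum_bounds (r e : R) : 0 <= r -> r < 1 -> 0 < e ->
  exists2 d : R, 0 < d & forall t : R, 1 < t -> t <= 1 + d -> forall z, normc z <= r ->
    ((massr t * (1 - e))%:E <= gsum t z)%E /\
    (gsum t z <= (massr t * (1 + e))%:E)%E.
Proof.
move=> r0 r1 e0.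
have [C C0 hC] := gweight_pker r0 r1.
have e4 : 0 < e / 4 by rewrite divr_gt0.
have [d1 d10 hd1] := kersum_bounds r0 r1 e4.
have [d2 d20 hd2] := kersum_bounds (lexx 0) ltr01 (@ltr01 R).
have T2 : kersum 2 0%R X = (fine (kersum 2 0%R X))%:E.
  by rewrite fineK// ge0_fin_numE ?kersum_ge0// kersum_fin// ltr1n.
set T := fine _ in T2.
have [d3 d30 hd3] := massr_large (2 * C * T / (e / 4)).
have d4 : 0 < e / 4 / (2 * C + 1) by rewrite divr_gt0// ltr_pwDr// mulr_ge0.
exists (Num.min (Num.min d1 d2) (Num.min d3 (Num.min (e / 4 / (2 * C + 1)) 1))).
  by rewrite !lt_min d10 d20 d30 d4 ltr01.
move=> t t1; rewrite -lerBlDl !le_min => /andP[/andP[t_1 t_2] /and3P[t_3 t_4 t_5]] z zr.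
rewrite lerBlDl in t_1; rewrite lerBlDl in t_2; rewrite lerBlDl in t_3.
have t2 : t <= 2 by lra.
have [k1 k2] := hd1 t t1 t_1 z zr.
have n00 : normc (0 : R[i]) <= 0 by rewrite normc0.
have [_ k3] := hd2 t t1 t_2 0 n00.
have k4 := hd3 t t1 t_3.
rewrite ler_pdivrMr// in k4.
have m0 := massr_ge0 t.
have a0 : 0 <= C * (t - 1) by rewrite mulr_ge0// subr_ge0 ltW.
have b0 : 0 <= 2 * C by rewrite mulr_ge0.
have aC : C * (t - 1) * 2 <= e / 4.
  move: t_4; rewrite ler_pdivlMr ?ltr_pwDr//.
  have : 0 <= t - 1 by lra.
  nra.
have err : ((C * (t - 1))%:E * kersum t 0%R X + (2 * C)%:E * kersum 2 0%R X <=
    (massr t * (e / 2))%:E)%E.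
  apply: (@le_trans _ _ ((C * (t - 1))%:E * (massr t * (1 + 1))%:E +
     (2 * C)%:E * T%:E)%E).
    by apply: leeD; [exact: lee_wpmul2l|rewrite T2].
  rewrite -!EFinM -EFinD lee_fin.
  have : (C * (t - 1) * 2) * massr t <= e / 4 * massr t by rewrite ler_wpM2r.
  by lra.
have pt x : points X x -> `|gweight t z x - hypker t z x| <=
    C * (t - 1) * hypker t 0 x + 2 * C * hypker 2 0 x.
  move=> /points_disc x1.
  rewrite hypkerE//; last by apply: le_trans (ltW r1).
  apply: le_trans (hC t x z t1 t2 x1 zr) _; rewrite !hypker_eta0.
  have h1 : hyp x `^ t * (1 - normc x) <= hyp x `^ t * (2 * hyp x).
    by rewrite ler_wpM2l ?powR_ge0// hyp_defect.
  have h2 := hyp_powR_mul x1 (ltW t1).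
  rewrite (_ : C * _ = C * (t - 1) * hyp x `^ t + C * (hyp x `^ t * (1 - normc x))); last by ring.
  rewrite lerD2l (_ : 2 * C * _ = C * (2 * hyp x `^ 2)); last by ring.
  by rewrite ler_wpM2l//; lra.
have g1 : (gsum t z <= kersum t z X + (C * (t - 1))%:E * kersum t 0%R X +
    (2 * C)%:E * kersum 2 0%R X)%E.
  apply: le_esum_lin3 => // [x _|x _|x _|x Xx]; rewrite ?lee_fin ?hypker_ge0//.
  by have := pt x Xx; rewrite ler_norml => /andP[]; lra.
have g2 : (kersum t z X <= gsum t z + (C * (t - 1))%:E * kersum t 0%R X +
    (2 * C)%:E * kersum 2 0%R X)%E.
  apply: le_esum_lin3 => // [x _|x _|x _|x Xx]; rewrite ?lee_fin ?hypker_ge0//.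
    by rewrite ltW// gweight_gt0.
  by have := pt x Xx; rewrite ler_norml => /andP[]; lra.
rewrite -!addeA in g1 g2.
have me0 : 0 <= massr t * e by rewrite mulr_ge0// ltW.
split.
  have := le_trans k1 (le_trans g2 (leeD2l _ err)).
  rewrite -leeBlDr// -EFinB; apply: le_trans; rewrite lee_fin; lra.
apply: le_trans g1 _; apply: le_trans (leeD k2 err) _.
by rewrite -EFinD lee_fin; lra.
Qed.

Definition nsum (t : R) z h : \bar R :=
  \esum_(x in points X) ((gweight t z x)%:E * pint mu h x)%E.

Lemma integral_circle_scale (c : R) (u : borelC R -> R) : 0 <= c ->
  measurable_fun (circle R : set (borelC R)) u -> (forall zeta, 0 <= u zeta) ->
  (\int[mu]_(zeta in circle R) (c * u zeta)%:E =
   c%:E * \int[mu]_(zeta in circle R) (u zeta)%:E)%E.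
Proof.
move=> c0 mu0 u0; rewrite -ge0_integralZl_EFin//.
- by move=> z _; rewrite lee_fin.
- exact/measurable_EFinP.
Qed.

(** By gweight_comparison, h may be replaced by the density ht that is the
    product of h and the Poisson kernel at z, divided by the bound A of this
    kernel; the mean of ht over the circle is the Poisson integral of h at z,
    divided by A. *)
Lemma nsum_bounds (r e : R) : 0 <= r -> r < 1 -> 0 < e ->
  exists2 d : R, 0 < d & forall t : R, 1 < t -> t <= 1 + d -> forall z, normc z <= r ->
    forall h, admissible mu h ->
    ((massr t * (fine (pint mu h z) - e))%:E <= nsum t z h)%E /\
    (nsum t z h <= (massr t * (fine (pint mu h z) + e))%:E)%E.
Proof.
move=> r0 r1 e0.
have [C C0 hC] := gweight_comparison r0 r1.
pose A := (1 + r) / (1 - r).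
have A0 : 0 < A by rewrite divr_gt0 ?subr_gt0// ltr_pwDl.
pose eps := e / (16 * (C + 1)).
have eps0 : 0 < eps by rewrite divr_gt0// mulr_gt0// ltr_pwDr.
have eA : 0 < e / (4 * A) by apply: divr_gt0 => //; apply: mulr_gt0.
have [d1 d10 hd1] := psum_bounds eA.
have [d2 d20 hd2] := psum_bounds (@ltr01 R).
have T2 : kersum 2 0%R X = (fine (kersum 2 0%R X))%:E.
  by rewrite fineK// ge0_fin_numE ?kersum_ge0// kersum_fin// ltr1n.
set T := fine _ in T2.
have [d3 d30 hd3] := massr_large (C * (4 / eps) * T / (e / 4)).
exists (Num.min (Num.min d1 d2) (Num.min d3 (Num.min eps 1))).
  by rewrite !lt_min d10 d20 d30 eps0 ltr01.
move=> t t1; rewrite -lerBlDl !le_min => /andP[/andP[t_1 t_2] /and3P[t_3 t_4 t_5]] z zr h ah.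
rewrite lerBlDl in t_1; rewrite lerBlDl in t_2; rewrite lerBlDl in t_3.
have t2 : t <= 2 by lra.
have z1 : disc R z by apply: le_lt_trans r1.
have [mh h0 h2] := ah.
have mhk x : measurable_fun (circle R : set (borelC R)) (fun zeta => hypker 0 zeta x).
  by apply: measurable_funTS; exact: measurable_hypker_eta.
pose ht zeta := A^-1 * (hypker 0 zeta z * h zeta).
have ht0 zeta : 0 <= ht zeta.
  by rewrite mulr_ge0 ?invr_ge0 ?(ltW A0)// mulr_ge0 ?hypker_ge0.
have mht : measurable_fun (circle R : set (borelC R)) ht.
  by apply: measurable_funM => //; apply: measurable_funM.
have kA zeta : circle R zeta -> hypker 0 zeta z <= A.
  move=> zc; apply: le_trans (hypker0_le (circle_le1 zc) z1) _.
  rewrite /hyp invf_div /A; have z0 := normc_ge0 z.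
  rewrite ler_pdivrMr ?subr_gt0// mulrAC ler_pdivlMr ?subr_gt0//.
  by move: (normc z) z0 zr => b; nra.
have aht : admissible mu ht.
  split => //; apply: le_trans h2; apply: le_integral_ge0 => zeta zc.
    by rewrite lee_fin sqr_ge0.
  rewrite lee_fin lerXn2r ?nnegrE// /ht mulrA ler_piMl//.
  by rewrite mulrC ler_pdivrMr// mul1r kA.
have pz0 : measurable_fun (circle R : set (borelC R)) (fun zeta => hypker 0 zeta z * h zeta).
  by apply: measurable_funM.
have tot_ht : circle_mean mu ht = (A^-1 * fine (pint mu h z))%:E.
  rewrite /circle_mean integral_circle_scale//.
  - by rewrite EFinM -pint_fin.
  - by rewrite invr_ge0 ltW.
  - by move=> zeta; rewrite mulr_ge0 ?hypker_ge0.
have [p1 p2] := hd1 t t1 t_1 ht aht.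
have [_ p3] := hd2 t t1 t_2 h ah.
have m0 := massr_ge0 t.
have k4 := hd3 t t1 t_3.
rewrite ler_pdivrMr ?divr_gt0// in k4.
pose a := C * ((t - 1) + eps); pose b := C * (4 / eps).
have a0 : 0 <= a by rewrite mulr_ge0// addr_ge0 ?(ltW eps0)// subr_ge0 ltW.
have b0 : 0 <= b by rewrite mulr_ge0// divr_ge0// ltW.
have a4 : a * 2 <= e / 4.
  have h1 : (t - 1) + eps <= 2 * eps by lra.
  have h3 : a <= C * (2 * eps) by rewrite ler_wpM2l.
  have h4 : eps * (16 * (C + 1)) = e.
    by rewrite /eps divfK// gt_eqF// mulr_gt0// ltr_pwDr.
  lra.
have err : (a%:E * psum mu X h t + b%:E * kersum 2 0%R X <= (massr t * (e / 2))%:E)%E.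
  apply: (@le_trans _ _ (a%:E * (massr t * (1 + 1))%:E + b%:E * T%:E)%E).
    apply: leeD; last by rewrite T2.
    apply: lee_wpmul2l; first by rewrite lee_fin.
    apply: le_trans p3 _; rewrite lee_fin ler_wpM2l// lerD2r.
    by case/andP: (circle_mean01 ah).
  rewrite -!EFinM -EFinD lee_fin.
  have h1 : (a * 2) * massr t <= e / 4 * massr t by rewrite ler_wpM2r.
  rewrite -/b in k4; lra.
pose G x := ((gweight t z x)%:E * pint mu h x)%E.
pose H x := (A%:E * ((hyp x `^ t)%:E * pint mu ht x))%E.
pose U x := ((hyp x `^ t)%:E * pint mu h x)%E.
have G0 x : (0 <= G x)%E by rewrite mule_ge0 ?pint_ge0// lee_fin ltW// gweight_gt0.
have U0 x : (0 <= U x)%E by rewrite mule_ge0 ?pint_ge0// lee_fin powR_ge0.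
have H0 x : (0 <= H x)%E.
  rewrite mule_ge0 ?lee_fin ?(ltW A0)// mule_ge0 ?pint_ge0//.
  by rewrite lee_fin powR_ge0.
have esH : (\esum_(x in points X) H x = A%:E * psum mu X ht t)%E.
  rewrite esumZl//; first exact: ltW.
  by move=> x _; rewrite mule_ge0 ?pint_ge0// lee_fin powR_ge0.
have pt x : points X x ->
    (G x <= H x + a%:E * U x + b%:E * (hypker 2 0 x)%:E)%E /\
    (H x <= G x + a%:E * U x + b%:E * (hypker 2 0 x)%:E)%E.
  move=> /points_disc x1.
  pose u zeta := hypker 0 zeta x * h zeta.
  have u0 zeta : 0 <= u zeta by rewrite mulr_ge0 ?hypker_ge0.
  have mu1 : measurable_fun (circle R : set (borelC R)) u by apply: measurable_funM.
  pose f1 zeta := gweight t z x * u zeta.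
  pose f2 zeta := hyp x `^ t * (hypker 0 zeta z * u zeta).
  pose f3 zeta := hyp x `^ t * u zeta.
  pose f4 zeta := hyp x `^ 2 * h zeta.
  have gw0 : 0 <= gweight t z x by rewrite ltW// gweight_gt0.
  have mm (f : borelC R -> R) : measurable_fun (circle R : set (borelC R)) f ->
      measurable_fun (circle R : set (borelC R)) (fun zeta => (f zeta)%:E).
    by move=> mf; exact/measurable_EFinP.
  have mzu : measurable_fun (circle R : set (borelC R)) (fun zeta => hypker 0 zeta z * u zeta).
    by apply: measurable_funM.
  have m1 : measurable_fun (circle R : set (borelC R)) f1 by apply: measurable_funM.
  have m2 : measurable_fun (circle R : set (borelC R)) f2 by apply: measurable_funM.
  have m3 : measurable_fun (circle R : set (borelC R)) f3 by apply: measurable_funM.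
  have m4 : measurable_fun (circle R : set (borelC R)) f4 by apply: measurable_funM.
  have q1 zeta : 0 <= f1 zeta by rewrite mulr_ge0.
  have q2 zeta : 0 <= f2 zeta by rewrite mulr_ge0 ?powR_ge0// mulr_ge0 ?hypker_ge0.
  have q3 zeta : 0 <= f3 zeta by rewrite mulr_ge0 ?powR_ge0.
  have q4 zeta : 0 <= f4 zeta by rewrite mulr_ge0 ?powR_ge0.
  have GE : G x = (\int[mu]_(zeta in circle R) (f1 zeta)%:E)%E.
    by rewrite integral_circle_scale.
  have UE : U x = (\int[mu]_(zeta in circle R) (f3 zeta)%:E)%E.
    by rewrite integral_circle_scale// powR_ge0.
  have HE : H x = (\int[mu]_(zeta in circle R) (f2 zeta)%:E)%E.
    rewrite integral_circle_scale ?powR_ge0//; last first.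
      by move=> zeta; rewrite mulr_ge0 ?hypker_ge0.
    rewrite /H muleCA; congr (_ * _)%E; rewrite /pint -integral_circle_scale//.
    - apply: eq_integral => zeta _; rewrite /ht /u; congr EFin.
      by field; rewrite gt_eqF.
    - exact: ltW.
    - by apply: measurable_funM.
    - by move=> zeta; rewrite mulr_ge0 ?hypker_ge0.
  have VE : (\int[mu]_(zeta in circle R) (f4 zeta)%:E <= (hypker 2 0 x)%:E)%E.
    rewrite integral_circle_scale ?powR_ge0// -/(circle_mean mu h) hypker_eta0.
    rewrite -[leRHS]mule1; apply: lee_wpmul2l; first by rewrite lee_fin powR_ge0.
    exact: circle_mean_le1.
  have key zeta : circle R zeta -> `|f1 zeta - f2 zeta| <= a * f3 zeta + b * f4 zeta.
    move=> zc; have := hC t x z zeta eps t1 t2 x1 zr zc eps0.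
    rewrite -/a -/b => /(ler_wpM2r (h0 zeta)).
    rewrite -{1}(ger0_norm (h0 zeta)) -normrM.
    rewrite (_ : (_ - _) * h zeta = f1 zeta - f2 zeta); last by rewrite /f1 /f2 /u; ring.
    move=> /le_trans; apply; rewrite le_eqVlt; apply/orP; left; apply/eqP.
    by rewrite /f3 /f4 /u; ring.
  have bV : (b%:E * (\int[mu]_(zeta in circle R) (f4 zeta)%:E) <=
     b%:E * (hypker 2 0 x)%:E)%E by apply: lee_wpmul2l.
  rewrite GE HE UE; split.
    apply: le_trans (leeD2l _ bV).
    apply: (@le_integral_lin3 _ _ _ mu (circle R) (fun zeta => (f1 zeta)%:E)
      (fun zeta => (f2 zeta)%:E) (fun zeta => (f3 zeta)%:E) (fun zeta => (f4 zeta)%:E));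
      rewrite ?lee_fin//; [exact: mm|exact: mm|exact: mm|..];
      move=> zeta zc; rewrite ?lee_fin//.
    by have := key zeta zc; rewrite ler_norml => /andP[]; lra.
  apply: le_trans (leeD2l _ bV).
  apply: (@le_integral_lin3 _ _ _ mu (circle R) (fun zeta => (f2 zeta)%:E)
    (fun zeta => (f1 zeta)%:E) (fun zeta => (f3 zeta)%:E) (fun zeta => (f4 zeta)%:E));
    rewrite ?lee_fin//; [exact: mm|exact: mm|exact: mm|..];
    move=> zeta zc; rewrite ?lee_fin//.
  by have := key zeta zc; rewrite ler_norml => /andP[]; lra.
have g1 : (nsum t z h <= A%:E * psum mu X ht t + a%:E * psum mu X h t +
    b%:E * kersum 2 0%R X)%E.
  rewrite -esH; apply: le_esum_lin3 => // [x _|x _|x Xx]; [exact: U0|by rewrite lee_fin hypker_ge0|].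
  by have [] := pt x Xx.
have g2 : (A%:E * psum mu X ht t <= nsum t z h + a%:E * psum mu X h t +
    b%:E * kersum 2 0%R X)%E.
  rewrite -esH; apply: le_esum_lin3 => // [x _|x _|x _|x Xx]; [exact: G0|exact: U0|by rewrite lee_fin hypker_ge0|].
  by have [] := pt x Xx.
rewrite -!addeA in g1 g2.
rewrite tot_ht /= in p1 p2.
have A00 : (0 <= A%:E)%E by rewrite lee_fin ltW.
have E1 : A * (massr t * (A^-1 * fine (pint mu h z) - e / (4 * A))) =
   massr t * (fine (pint mu h z) - e / 4).
  by field; rewrite gt_eqF.
have E2 : A * (massr t * (A^-1 * fine (pint mu h z) + e / (4 * A))) =
   massr t * (fine (pint mu h z) + e / 4).
  by field; rewrite gt_eqF.
have {}p1 := lee_wpmul2l A00 p1; have {}p2 := lee_wpmul2l A00 p2.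
rewrite -EFinM E1 in p1; rewrite -EFinM E2 in p2.
have me0 : 0 <= massr t * e by rewrite mulr_ge0// ltW.
split.
  have := le_trans p1 (le_trans g2 (leeD2l _ err)).
  rewrite -leeBlDr// -EFinB; apply: le_trans; rewrite lee_fin; lra.
apply: le_trans g1 _; apply: le_trans (leeD p2 err) _.
by rewrite -EFinD lee_fin; lra.
Qed.

End asymptotics.

(** * Reduction to nonnegative densities *)

Section absolutely_convergent_sums.
Context {R : realType} (T : choiceType).
Implicit Types (A : set T) (u p q : T -> R).

(** For the Poisson integral of a real density the decomposition comes from the
    parts of the density, which differ from those of the integral. *)
Lemma real_sum_decomposition A u p q :
  (forall x, A x -> 0 <= p x) -> (forall x, A x -> 0 <= q x) ->
  (\esum_(x in A) (p x)%:E < +oo)%E -> (\esum_(x in A) (q x)%:E < +oo)%E ->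
  (forall x, A x -> u x = p x - q x) ->
  real_sum A u = fine (\esum_(x in A) (p x)%:E) - fine (\esum_(x in A) (q x)%:E).
Proof.
move=> p0 q0 fp fq upq.
have up0 x : 0 <= u^\+ x by exact: funrpos_ge0.
have un0 x : 0 <= u^\- x by exact: funrneg_ge0.
have uE x : u x = u^\+ x - u^\- x by rewrite -[in LHS](funrposBneg u).
have upp x : A x -> u^\+ x <= p x.
  by move=> Ax; rewrite /funrpos ge_max p0// upq// gerBl q0.
have unq x : A x -> u^\- x <= q x.
  by move=> Ax; rewrite /funrneg ge_max q0// upq// opprB gerBl p0.
have fE (v w : T -> R) : (forall x, A x -> 0 <= v x) -> (forall x, A x -> v x <= w x) ->
    (\esum_(x in A) (w x)%:E < +oo)%E ->
    (\esum_(x in A) (v x)%:E)%E = (fine (\esum_(x in A) (v x)%:E))%:E.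
  move=> v0 vw fw; rewrite fineK// ge0_fin_numE; last first.
    by apply: esum_ge0 => x Ax; rewrite lee_fin v0.
  by apply: le_lt_trans fw; apply: le_esum => x Ax; rewrite lee_fin vw.
have e1 := fE _ p p0 (fun x _ => lexx _) fp; have e2 := fE _ q q0 (fun x _ => lexx _) fq.
have e3 := fE _ p (fun x _ => up0 x) upp fp; have e4 := fE _ q (fun x _ => un0 x) unq fq.
have : (\esum_(x in A) (u^\+ x)%:E + \esum_(x in A) (q x)%:E =
    \esum_(x in A) (u^\- x)%:E + \esum_(x in A) (p x)%:E)%E.
  rewrite -!esumD => [| | | |]; try by move=> x Ax; rewrite lee_fin ?up0 ?un0 ?p0 ?q0.
  apply: eq_esum => x Ax; rewrite -!EFinD; congr EFin.
  by have := uE x; rewrite upq//; lra.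
rewrite /real_sum e1 e2 e3 e4 -!EFinD => -[]; lra.
Qed.

End absolutely_convergent_sums.

Section poisson_decomposition.
Context {R : realType}.
Variable mu : probability (borelC R) R.
Implicit Types (z zeta : R[i]).

Let mC := @measurable_circle R.

Let measurable_kernel z :
  measurable_fun (circle R : set (borelC R)) (fun zeta => hypker 0 zeta z).
Proof. by apply: measurable_funTS; exact: measurable_hypker_eta. Qed.

Lemma admissible_scaled (c : R) (u v : borelC R -> R) : 0 < c ->
  measurable_fun (circle R : set (borelC R)) u ->
  measurable_fun (circle R : set (borelC R)) v ->
  (forall zeta, 0 <= u zeta) -> (forall zeta, u zeta ^+ 2 <= v zeta) ->
  (\int[mu]_(zeta in circle R) (v zeta)%:E <= (c ^+ 2)%:E)%E ->
  admissible mu (fun zeta => c^-1 * u zeta).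
Proof.
move=> c0 mu0 mv u0 uv vc; have ci0 : 0 <= c^-1 by rewrite invr_ge0 ltW.
split; first by apply: measurable_funM.
  by move=> zeta; rewrite mulr_ge0.
have v0 zeta : 0 <= v zeta by apply: le_trans (uv zeta); exact: sqr_ge0.
apply: (@le_trans _ _ (\int[mu]_(zeta in circle R) (c^-1 ^+ 2 * v zeta)%:E)%E).
  apply: le_integral_ge0 => zeta _; first by rewrite lee_fin sqr_ge0.
  by rewrite lee_fin exprMn ler_wpM2l ?sqr_ge0.
rewrite integral_circle_scale ?sqr_ge0//.
have c2 : (0 <= (c^-1 ^+ 2)%:E)%E by rewrite lee_fin sqr_ge0.
apply: le_trans (lee_wpmul2l c2 vc) _.
by rewrite -EFinM lee_fin -exprMn mulVf ?gt_eqF// expr1n.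
Qed.

Lemma pint_scaled (c : R) (u : borelC R -> R) z : 0 < c ->
  measurable_fun (circle R : set (borelC R)) u -> (forall zeta, 0 <= u zeta) ->
  (\int[mu]_(zeta in circle R) (hypker 0 zeta z * u zeta)%:E =
   c%:E * pint mu (fun zeta => (c^-1 * u zeta)%R) z)%E.
Proof.
move=> c0 mu0 u0; rewrite /pint -integral_circle_scale.
- apply: eq_integral => zeta _; congr EFin.
  by field; rewrite gt_eqF.
- exact: ltW.
- by apply: measurable_funM => //; apply: measurable_funM.
- by move=> zeta; rewrite mulr_ge0 ?hypker_ge0// mulr_ge0// invr_ge0 ltW.
Qed.

Lemma real_poisson_parts (c : R) (u v : borelC R -> R) : 0 < c ->
  measurable_fun (circle R : set (borelC R)) u ->
  measurable_fun (circle R : set (borelC R)) v ->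
  (forall zeta, u zeta ^+ 2 <= v zeta) ->
  (\int[mu]_(zeta in circle R) (v zeta)%:E <= (c ^+ 2)%:E)%E ->
  exists a b, [/\ admissible mu a, admissible mu b & forall z, disc R z ->
    \int[mu]_(zeta in circle R) (hypker 0 zeta z * u zeta) =
    c * (fine (pint mu a z) - fine (pint mu b z))].
Proof.
move=> c0 mu0 mv uv vc.
have mp : measurable_fun (circle R : set (borelC R)) u^\+ by exact: measurable_funrpos.
have mn : measurable_fun (circle R : set (borelC R)) u^\- by exact: measurable_funrneg.
have p0 zeta : 0 <= u^\+ zeta by exact: funrpos_ge0.
have n0 zeta : 0 <= u^\- zeta by exact: funrneg_ge0.
have sqr_part zeta (w : R) : 0 <= w -> w <= `|u zeta| -> w ^+ 2 <= v zeta.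
  move=> w0 wu; apply: le_trans (uv zeta); rewrite -(real_normK (num_real (u zeta))).
  by rewrite lerXn2r ?nnegrE.
have aa : admissible mu (fun zeta => c^-1 * u^\+ zeta).
  apply: (admissible_scaled c0 mp mv) => // zeta; apply: sqr_part => //.
  by rewrite /funrpos ge_max ler_norm normr_ge0.
have ab : admissible mu (fun zeta => c^-1 * u^\- zeta).
  apply: (admissible_scaled c0 mn mv) => // zeta; apply: sqr_part => //.
  by rewrite /funrneg ge_max -normrN ler_norm normr_ge0.
exists (fun zeta => c^-1 * u^\+ zeta), (fun zeta => c^-1 * u^\- zeta); split => // z z1.
rewrite /Rintegral integralE.
have -> : (\int[mu]_(zeta in circle R) ((fun x => (hypker 0 x z * u x)%:E)^\+ zeta) =
    \int[mu]_(zeta in circle R) (hypker 0 zeta z * u^\+ zeta)%:E)%E.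
  apply: eq_integral => zeta _; rewrite funeposE /funrpos.
  by rewrite -EFin_max maxr_pMr ?hypker_ge0// mulr0.
have -> : (\int[mu]_(zeta in circle R) ((fun x => (hypker 0 x z * u x)%:E)^\- zeta) =
    \int[mu]_(zeta in circle R) (hypker 0 zeta z * u^\- zeta)%:E)%E.
  apply: eq_integral => zeta _; rewrite funenegE /funrneg.
  by rewrite -EFinN -EFin_max maxr_pMr ?hypker_ge0// mulr0 mulrN.
rewrite !(pint_scaled _ c0)// (pint_fin aa z1) (pint_fin ab z1) -!EFinM -EFinB /=.
by rewrite mulrBr.
Qed.

(** Reduces a complex density to nonnegative ones, and with the scale c all
    square integrable densities to those of norm at most 1. *)
Definition represented (c : R) (f : R[i] -> R[i]) : Prop :=
  exists a1 b1 a2 b2, [/\ admissible mu a1 /\ admissible mu b1,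
    admissible mu a2 /\ admissible mu b2 & forall z, disc R z ->
    f z = (c * (fine (pint mu a1 z) - fine (pint mu b1 z))) +i*
          (c * (fine (pint mu a2 z) - fine (pint mu b2 z)))].

Lemma poisson_represented (c : R) (h : borelC R -> borelC R) (f : R[i] -> R[i]) :
  0 < c -> measurable_fun (circle R : set (borelC R)) h ->
  (\int[mu]_(zeta in circle R) ((normc (h zeta) ^+ 2)%:E) <= (c ^+ 2)%:E)%E ->
  (forall z, disc R z -> f z = poisson mu h z) -> represented c f.
Proof.
move=> c0 mh hc fh.
pose nh zeta := normc (h zeta) ^+ 2.
have mn : measurable_fun (circle R : set (borelC R)) nh.
  by apply: measurable_funX; exact: (measurableT_comp (@measurable_normc R) mh).
have mr : measurable_fun (circle R : set (borelC R)) (fun zeta => complex.Re (h zeta)).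
  exact: (measurableT_comp (@measurable_Re R) mh).
have mi : measurable_fun (circle R : set (borelC R)) (fun zeta => complex.Im (h zeta)).
  exact: (measurableT_comp (@measurable_Im R) mh).
have rn zeta : complex.Re (h zeta) ^+ 2 <= nh zeta.
  by rewrite /nh normc_sqr lerDl sqr_ge0.
have im zeta : complex.Im (h zeta) ^+ 2 <= nh zeta.
  by rewrite /nh normc_sqr lerDr sqr_ge0.
have [a1 [b1 [h1 h2 h3]]] := real_poisson_parts c0 mr mn rn hc.
have [a2 [b2 [h4 h5 h6]]] := real_poisson_parts c0 mi mn im hc.
exists a1, b1, a2, b2; split=> // z z1; rewrite fh// -h3// -h6// /poisson /complex_integral.
have kE zeta : circle R zeta ->
    ((1 - normc z ^+ 2) / normc (1 - zeta^* * z) ^+ 2) = hypker 0 zeta z.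
  move=> zc; rewrite /hypker powRr0 mul1r /pker normcM normc_conj (zc : normc zeta = 1) mul1r.
  by rewrite ger0_norm// divr_ge0 ?sqr_ge0// ltW// disc_sqr_lt1.
congr (_ +i* _); apply: eq_Rintegral => zeta; rewrite inE => zc; rewrite kE//.
  by case: (h zeta) => a b /=; rewrite mul0r subr0.
by case: (h zeta) => a b /=; rewrite mul0r addr0.
Qed.

Lemma L2norm_sqr h : (L2norm mu h < +oo)%E ->
  (\int[mu]_(zeta in circle R) ((normc (h zeta) ^+ 2)%:E) =
   (fine (L2norm mu h) ^+ 2)%:E)%E.
Proof.
rewrite /L2norm; set I := (\int[mu]_(_ in _) _)%E => fI.
have I0 : (0 <= I)%E by apply: integral_ge0 => zeta _; rewrite lee_fin sqr_ge0.
have : (I < +oo)%E by apply: lty_poweRy fI; rewrite invr_neq0.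
move: I I0 {fI} => [r| |]//; rewrite lee_fin => r0 _.
by rewrite poweR_EFin /= powR12_sqrt// sqr_sqrtr.
Qed.

Lemma ball_represented f : harmonic_hardy_ball mu f -> represented 1 f.
Proof.
move=> [h [[mh fh] h1] fE]; apply: (poisson_represented ltr01 mh _ fE).
have n0 : (0 <= L2norm mu h)%E by exact: poweR_ge0.
rewrite L2norm_sqr// lee_fin lerXn2r ?nnegrE ?fine_ge0//.
by rewrite -lee_fin fineK// ge0_fin_numE.
Qed.

Lemma hardy_represented f : harmonic_hardy mu f -> exists2 c, 0 < c & represented c f.
Proof.
move=> [h [mh fh] fE].
have n0 : 0 <= fine (L2norm mu h) by apply: fine_ge0; exact: poweR_ge0.
exists (1 + fine (L2norm mu h)); first by rewrite ltr_pwDl.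
apply: (poisson_represented _ mh _ fE); first by rewrite ltr_pwDl.
by rewrite L2norm_sqr// lee_fin lerXn2r ?nnegrE ?addr_ge0// lerDr.
Qed.

End poisson_decomposition.

(** * Convergence of the ratios *)

Section conclusions.
Context {R : realType}.
Variable mu : probability (borelC R) R.
Variables (s : nat -> R) (N : nat).
Hypotheses (s1 : forall n, 1 < s n)
  (sl : forall n, mass (s n) = ((N + n).+1%:R ^+ 2)%:E).
Variable X : conf R.
Hypothesis kersum_fin : forall t : R, 1 < t -> (kersum t 0%R X < +oo)%E.
Hypothesis deviation_circle : circle_concentration s N mu X.
Hypothesis deviation_rat : rational_concentration s N X.
Implicit Types (h : borelC R -> R) (x y z zeta : R[i]).

Let cX := countable_points X.

Lemma gweight_anti (t u : R) x z : disc R x -> disc R z -> t <= u ->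
  gweight u z x <= gweight t z x.
Proof.
move=> x1 z1 tu; rewrite !gweightE//; apply: ger_powR => //.
have f1 := mobius_lt1 x1 z1; have f0 := normc_ge0 (mobius x z).
by rewrite divr_gt0 ?subr_gt0 ?ltr_pwDl//= ler_pdivrMr ?ltr_pwDl//; lra.
Qed.

Lemma gweight_le_hyp z : disc R z -> exists2 C : R, 0 <= C &
  forall t x, 1 < t -> t <= 2 -> disc R x -> gweight t z x <= C * hyp x `^ t.
Proof.
move=> z1; have [C C0 hC] := gweight_pker (normc_ge0 z) z1.
exists (2 / (1 - normc z) + C * 2).
  by rewrite addr_ge0 ?mulr_ge0// invr_ge0 subr_ge0 ltW.
move=> t x t1 t2 x1; have := hC t x z t1 t2 x1 (lexx _).
have xz1 : normc (z^* * x) <= normc z.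
  by rewrite normcM normc_conj ler_piMr ?normc_ge0// ltW.
have {}z1 : normc z < 1 := z1.
have zx : pker (z^* * x) <= 2 / (1 - normc z).
  apply: le_trans (pker_le (le_lt_trans xz1 z1)) _.
  have := normc_ge0 (z^* * x).
  rewrite ler_pdivrMr; last by lra.
  rewrite mulrAC ler_pdivlMr; last by lra.
  by move: (normc (z^* * x)) (normc z) xz1 z1 => a b; nra.
have w0 := powR_ge0 (hyp x) t; have x0 := normc_ge0 x.
rewrite ler_norml => /andP[_ h].
have h1 : hyp x `^ t * pker (z^* * x) <= hyp x `^ t * (2 / (1 - normc z)).
  by rewrite ler_wpM2l.
have h2 : C * (hyp x `^ t * (t - 1 + (1 - normc x))) <= C * (hyp x `^ t * 2).
  by rewrite ler_wpM2l// ler_wpM2l//; lra.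
lra.
Qed.

(** Finite for t close to 1 by psum_bounds, and nonincreasing in t. *)
Lemma psum_fin t h : 1 < t -> admissible mu h -> (psum mu X h t < +oo)%E.
Proof.
move=> t1 ah; have [d d0 hd] := psum_bounds s1 sl deviation_circle (@ltr01 R).
pose u := Num.min t (1 + d).
have u1 : 1 < u by rewrite lt_min t1 ltrDl.
have ud : u <= 1 + d by rewrite ge_min lexx orbT.
have [_ h1] := hd u u1 ud h ah.
apply: le_lt_trans (ltry _); apply: le_trans h1; apply: le_esum => x /points_disc x1; apply: lee_wpmul2r; first exact: pint_ge0.
by rewrite lee_fin hyp_powR_ler// ge_min lexx.
Qed.

Lemma gsum_fin t z : 1 < t -> disc R z -> (gsum X t z < +oo)%E.
Proof.
move=> t1 z1; have [C C0 hC] := gweight_le_hyp z1.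
pose u := Num.min t 2.
have u1 : 1 < u by rewrite lt_min t1 ltr1n.
apply: (@le_lt_trans _ _ (C%:E * kersum u 0%R X)%E); last first.
  by rewrite lte_mul_pinfty ?lee_fin ?kersum_fin.
rewrite /kersum -esumZl//; last by move=> x _; rewrite lee_fin hypker_ge0.
apply: le_esum => x /points_disc x1; rewrite -EFinM lee_fin hypker_eta0.
have tu : u <= t by rewrite ge_min lexx.
apply: le_trans (gweight_anti x1 z1 tu) _; apply: hC => //.
by rewrite ge_min lexx orbT.
Qed.

Lemma nsum_fin t z h : 1 < t -> disc R z -> admissible mu h ->
  (nsum mu X t z h < +oo)%E.
Proof.
move=> t1 z1 ah; have [C C0 hC] := gweight_le_hyp z1.
pose u := Num.min t 2.
have u1 : 1 < u by rewrite lt_min t1 ltr1n.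
apply: (@le_lt_trans _ _ (C%:E * psum mu X h u)%E); last first.
  by rewrite lte_mul_pinfty ?lee_fin ?psum_fin.
rewrite /psum -esumZl//; last first.
  by move=> x _; rewrite mule_ge0 ?pint_ge0// lee_fin powR_ge0.
apply: le_esum => x /points_disc x1; rewrite muleA.
apply: lee_wpmul2r; first exact: pint_ge0.
have tu : u <= t by rewrite ge_min lexx.
rewrite -EFinM lee_fin; apply: le_trans (gweight_anti x1 z1 tu) _; apply: hC => //.
by rewrite ge_min lexx orbT.
Qed.

Let fpint h x := fine (pint mu h x).

Let fpint_ge0 h x : admissible mu h -> 0 <= fpint h x.
Proof. by move=> ah; rewrite fine_ge0// pint_ge0. Qed.

Lemma nsumE t z h : admissible mu h ->
  nsum mu X t z h = (\esum_(x in points X) (gweight t z x * fpint h x)%:E)%E.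
Proof.
by move=> ah; apply: eq_esum => x /points_disc x1; rewrite (pint_fin ah x1) EFinM.
Qed.

Lemma gE t z : 1 < t -> disc R z -> g X t z = fine (gsum X t z).
Proof.
move=> t1 z1; rewrite /g (@real_sum_decomposition _ _ _ _ (gweight t z) (fun=> 0)).
- by rewrite [X in _ - fine X]esum1// subr0.
- by move=> x _; rewrite ltW// gweight_gt0.
- by [].
- exact: gsum_fin.
- by rewrite esum1// ltry.
- by move=> x _; rewrite subr0.
Qed.

Lemma real_sum_pint t z (c : R) a b (u : R[i] -> R) : 0 <= c -> 1 < t -> disc R z ->
  admissible mu a -> admissible mu b ->
  (forall x, disc R x -> u x = c * (fpint a x - fpint b x)) ->
  real_sum (points X) (fun x => gweight t z x * u x) =
  c * (fine (nsum mu X t z a) - fine (nsum mu X t z b)).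
Proof.
move=> c0 t1 z1 aa ab uE.
have w0 x : 0 <= gweight t z x by rewrite ltW// gweight_gt0.
have fE h : admissible mu h ->
    (\esum_(x in points X) (c * (gweight t z x * fpint h x))%:E)%E =
    (c * fine (nsum mu X t z h))%:E.
  move=> ah; rewrite EFinM fineK; last first.
    rewrite ge0_fin_numE ?nsum_fin//; apply: esum_ge0 => x _.
    by rewrite mule_ge0 ?pint_ge0// lee_fin.
  rewrite nsumE// -esumZl//.
  by move=> x _; rewrite lee_fin mulr_ge0// fpint_ge0.
rewrite (@real_sum_decomposition _ _ _ _
  (fun x => c * (gweight t z x * fpint a x)) (fun x => c * (gweight t z x * fpint b x))).
- by rewrite (fE a aa) (fE b ab) /= mulrBr.
- by move=> x _; rewrite mulr_ge0// mulr_ge0// fpint_ge0.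
- by move=> x _; rewrite mulr_ge0// mulr_ge0// fpint_ge0.
- by rewrite (fE a aa) ltry.
- by rewrite (fE b ab) ltry.
- by move=> x /points_disc x1; rewrite uE//; ring.
Qed.

Lemma gf_summable_represented t z (c : R) f : 0 <= c -> 1 < t -> disc R z ->
  represented mu c f -> gf_summable X t z f.
Proof.
move=> c0 t1 z1 [a1 [b1 [a2 [b2 [[A1 B1] [A2 B2] fE]]]]].
pose G h x := ((gweight t z x)%:E * pint mu h x)%E.
have w0 x : 0 <= gweight t z x by rewrite ltW// gweight_gt0.
have G0 h x : admissible mu h -> (0 <= G h x)%E.
  by move=> ah; rewrite mule_ge0 ?pint_ge0// lee_fin.
apply: (@le_lt_trans _ _ (\esum_(x in points X)
    (c%:E * (G a1 x + G b1 x + (G a2 x + G b2 x))))%E).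
  apply: le_esum => x /points_disc x1; rewrite gee0_abs ?lee_fin ?normc_ge0//.
  rewrite /G (pint_fin A1 x1) (pint_fin B1 x1) (pint_fin A2 x1) (pint_fin B2 x1).
  rewrite lee_fin normcM normc_real (ger0_norm (w0 x)).
  have p1 := fpint_ge0 x A1; have p2 := fpint_ge0 x B1.
  have p3 := fpint_ge0 x A2; have p4 := fpint_ge0 x B2.
  have h : normc (f x) <= c * (fpint a1 x + fpint b1 x + (fpint a2 x + fpint b2 x)).
    apply: le_trans (normc_le_ReIm _) _; rewrite fE//= !normrM (ger0_norm c0) -mulrDr.
    rewrite ler_wpM2l// lerD// (le_trans (ler_normB _ _))// !ger0_norm//.
  have := ler_wpM2l (w0 x) h; rewrite /fpint; lra.
have S0 x : points X x -> (0 <= G a1 x + G b1 x + (G a2 x + G b2 x))%E.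
  by move=> _; rewrite !adde_ge0 ?G0.
rewrite esumZl// esumD => [|x _|x _]; rewrite ?adde_ge0 ?G0//.
rewrite !esumD => [|x _|x _|x _|x _]; rewrite ?G0//.
by apply: lte_mul_pinfty; rewrite ?lee_fin// !lte_add_pinfty// nsum_fin.
Qed.

Lemma ratio_part (r e : R) : 0 <= r -> r < 1 -> 0 < e ->
  exists2 d : R, 0 < d & forall t : R, 1 < t -> t <= 1 + d -> forall z, normc z <= r ->
    0 < g X t z /\ forall a b, admissible mu a -> admissible mu b ->
    `|(fine (nsum mu X t z a) - fine (nsum mu X t z b)) / g X t z
      - (fpint a z - fpint b z)| <= e.
Proof.
move=> r0 r1 e0.
pose A := (1 + r) / (1 - r).
have A0 : 0 < A by rewrite divr_gt0 ?subr_gt0// ltr_pwDl.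
pose e1 := Num.min 2^-1 (e / (4 * (1 + A))).
have B0 : 0 < 4 * (1 + A) by rewrite mulr_gt0 ?addr_gt0.
have e10 : 0 < e1 by rewrite lt_min invr_gt0 ltr0n/=; exact: divr_gt0.
have e12 : e1 <= 2^-1 by rewrite ge_min lexx.
have e1e : e1 * (4 * (1 + A)) <= e by rewrite -ler_pdivlMr// ge_min lexx orbT.
have [d1 d10 hd1] := gsum_bounds s1 sl kersum_fin deviation_rat r0 r1 e10.
have [d2 d20 hd2] := nsum_bounds s1 sl kersum_fin deviation_circle r0 r1 e10.
have [d3 d30 hd3] := @massr_large R 1.
exists (Num.min d1 (Num.min d2 d3)); first by rewrite !lt_min d10 d20 d30.
move=> t t1; rewrite -lerBlDl !le_min => /and3P[t_1 t_2 t_3] z zr.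
rewrite lerBlDl in t_1; rewrite lerBlDl in t_2; rewrite lerBlDl in t_3.
have z1 : disc R z by apply: le_lt_trans r1.
have m1 := hd3 t t1 t_3.
have gsE : gsum X t z = (g X t z)%:E.
  rewrite gE// fineK// ge0_fin_numE ?gsum_fin//; apply: esum_ge0 => x _.
  by rewrite lee_fin ltW// gweight_gt0.
have [] := hd1 t t1 t_1 z zr; rewrite gsE !lee_fin => g1 g2.
have h1 : massr t * e1 <= massr t * 2^-1 by rewrite ler_wpM2l//; lra.
have g0 : 0 < g X t z by lra.
split=> // a b aa ab.
have one h : admissible mu h ->
    `|fine (nsum mu X t z h) - g X t z * fpint h z| <= massr t * e1 * (1 + A).
  move=> ah; have [] := hd2 t t1 t_2 z zr h ah.
  have -> : nsum mu X t z h = (fine (nsum mu X t z h))%:E.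
    rewrite fineK// ge0_fin_numE ?nsum_fin//; apply: esum_ge0 => x _.
    by rewrite mule_ge0 ?pint_ge0// lee_fin ltW// gweight_gt0.
  rewrite !lee_fin -/(fpint h z) => n1 n2.
  have p0 := fpint_ge0 z ah.
  have pA : fpint h z <= A.
    rewrite -lee_fin /fpint -pint_fin//; apply: le_trans (pint_le ah z1) _.
    rewrite -[leRHS]mule1; apply: lee_pmul; rewrite ?lee_fin ?circle_mean_ge0 ?circle_mean_le1//.
      by rewrite invr_ge0 ltW// hyp_gt0.
    rewrite /hyp invf_div /A; have z0 := normc_ge0 z.
    rewrite ler_pdivrMr ?subr_gt0// mulrAC ler_pdivlMr ?subr_gt0//.
    by move: (normc z) z0 zr => v; nra.
  have m10 : 0 <= massr t * e1 by rewrite mulr_ge0// ?ltW//; lra.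
  have q1 : (massr t * e1) * fpint h z <= (massr t * e1) * A by rewrite ler_wpM2l.
  have q2 : massr t * (1 - e1) * fpint h z <= g X t z * fpint h z by rewrite ler_wpM2r.
  have q3 : g X t z * fpint h z <= massr t * (1 + e1) * fpint h z by rewrite ler_wpM2r.
  by rewrite ler_norml; apply/andP; split; lra.
have oa := one a aa; have ob := one b ab.
have -> : (fine (nsum mu X t z a) - fine (nsum mu X t z b)) / g X t z
      - (fpint a z - fpint b z) =
    ((fine (nsum mu X t z a) - g X t z * fpint a z) -
     (fine (nsum mu X t z b) - g X t z * fpint b z)) / g X t z.
  by field; rewrite gt_eqF.
rewrite normrM normfV (gtr0_norm g0) ler_pdivrMr//.
apply: le_trans (ler_normB _ _) _; apply: le_trans (lerD oa ob) _.
have q4 : massr t * (e1 * (4 * (1 + A))) <= massr t * e by rewrite ler_wpM2l//; lra.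
have q5 : massr t * 2^-1 * e <= g X t z * e by rewrite ler_wpM2r ?(ltW e0)//; lra.
lra.
Qed.

Lemma complex_div_real (a b c : R) : c != 0 -> (a +i* b) / c%:C = (a / c) +i* (b / c).
Proof.
move=> c0; apply: (canLR (mulfK _)).
  by rewrite eq_complex/= negb_and c0.
by apply/eqP; rewrite eq_complex/= !mulr0 subr0 add0r !divfK ?eqxx.
Qed.

(** The bound d depends on f only through c, hence the convergence is uniform on
    the unit ball. *)
Lemma gratio_represented (r e : R) : 0 <= r -> r < 1 -> 0 < e ->
  exists2 d : R, 0 < d & forall t : R, 1 < t -> t <= 1 + d -> forall z, normc z <= r ->
    forall c f, 0 <= c -> represented mu c f -> normc (gratio X t z f - f z) <= c * e.
Proof.
move=> r0 r1 e0; have e2 : 0 < e / 2 by rewrite divr_gt0.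
have [d d0 hd] := ratio_part r0 r1 e2.
exists d => // t t1 td z zr c f c0 [a1 [b1 [a2 [b2 [[A1 B1] [A2 B2] fE]]]]].
have z1 : disc R z by apply: le_lt_trans r1.
have [g0 {}hd] := hd t t1 td z zr.
rewrite /gratio /gf /complex_sum.
have -> : (fun x => complex.Re ((gweight t z x)%:C * f x)) =
    (fun x => gweight t z x * complex.Re (f x)).
  by apply/funext => x; case: (f x) => u v /=; rewrite mul0r subr0.
have -> : (fun x => complex.Im ((gweight t z x)%:C * f x)) =
    (fun x => gweight t z x * complex.Im (f x)).
  by apply/funext => x; case: (f x) => u v /=; rewrite mul0r addr0.
rewrite (real_sum_pint c0 t1 z1 A1 B1); last by move=> x x1; rewrite fE.
rewrite (real_sum_pint c0 t1 z1 A2 B2); last by move=> x x1; rewrite fE.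
rewrite complex_div_real ?gt_eqF// fE//.
apply: le_trans (normc_le_ReIm _) _; rewrite /= -!/(fpint _ _) -!(mulrA c) -!mulrBr.
rewrite !normrM (ger0_norm c0) -mulrDr ler_wpM2l// [leRHS]splitr.
by rewrite lerD// hd.
Qed.

Lemma good_summable (t : R) z : 1 < t -> disc R z ->
  summable (points X) (fun x => (gweight t z x)%:E) /\
  forall f, harmonic_hardy mu f -> gf_summable X t z f.
Proof.
move=> t1 z1; split.
  apply: le_lt_trans (gsum_fin t1 z1); apply: le_esum => x _.
  by rewrite gee0_abs// lee_fin ltW// gweight_gt0.
move=> f /hardy_represented[c c0 cf].
exact: gf_summable_represented (ltW c0) t1 z1 cf.
Qed.

Lemma good_pointwise f z : harmonic_hardy mu f -> disc R z ->
  (gratio X t z f : R[i]^o) @[t --> 1^'+] --> (f z : R[i]^o).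
Proof.
move=> /hardy_represented[c c0 cf] z1 B /nbhs_normcP[e e0 eB].
have e2 : 0 < e / (2 * c) by rewrite divr_gt0// mulr_gt0.
have [d d0 hd] := gratio_represented (normc_ge0 z) z1 e2.
have d1 : 1 < 1 + d by rewrite ltrDl.
change (\forall t \near (1 : R)^'+, B (gratio X t z f)).
near=> t; apply: eB; rewrite normcC.
have t1 : 1 < t by near: t; exact: nbhs_right_gt.
have td : t <= 1 + d by near: t; exact: nbhs_right_le.
apply: le_lt_trans (hd t t1 td z (lexx _) c f (ltW c0) cf) _.
rewrite (_ : c * _ = e / 2); last by field; rewrite gt_eqF.
by rewrite ltr_pdivrMr// ltr_pMr// ltr1n.
Unshelve. all: by end_near. Qed.

Lemma good_uniform (D : set R[i]) : relatively_compact_in_disc D ->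
  sup_nneg (harmonic_hardy_ball mu) (fun f =>
    sup_nneg D (fun z => (normc (gratio X t z f - f z))%:E))
  @[t --> 1^'+] --> 0%E.
Proof.
move=> /relatively_compact_bounded[n Dn].
have r0 : 0 <= 1 - n.+1%:R^-1 :> R by rewrite subr_ge0 invf_le1 ?ler1n.
have r1 : 1 - n.+1%:R^-1 < 1 :> R by rewrite gtrBl invr_gt0.
pose S (t : R) := sup_nneg (harmonic_hardy_ball mu) (fun f =>
    sup_nneg D (fun z => (normc (gratio X t z f - f z))%:E)).
have S0 t : (0 <= S t)%E by apply: ereal_sup_ubound; left.
have Se e : 0 < e -> exists2 d : R, 0 < d & forall t, 1 < t -> t <= 1 + d -> (S t <= e%:E)%E.
  move=> e0; have [d d0 hd] := gratio_represented r0 r1 e0; exists d => // t t1 td.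
  have e00 : (0 <= e%:E)%E by rewrite lee_fin ltW.
  apply: ge_ereal_sup => _ [->//|[f hf <-]].
  apply: ge_ereal_sup => _ [->//|[z Dz <-]].
  rewrite lee_fin -[leRHS]mul1r; apply: hd => //; first exact: Dn.
  exact: ball_represented.
apply/fine_cvgP; split.
  have [d d0 hd] := Se 1 ltr01.
  have d1 : 1 < 1 + d by rewrite ltrDl.
  near=> t; have t1 : 1 < t by near: t; exact: nbhs_right_gt.
  have td : t <= 1 + d by near: t; exact: nbhs_right_le.
  by rewrite ge0_fin_numE ?S0//; exact: le_lt_trans (hd t t1 td) (ltry _).
apply/cvgrPdist_le => e e0; have [d d0 hd] := Se e e0.
have d1 : 1 < 1 + d by rewrite ltrDl.
near=> t; rewrite sub0r normrN ger0_norm; last exact: fine_ge0 (S0 t).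
have t1 : 1 < t by near: t; exact: nbhs_right_gt.
have td : t <= 1 + d by near: t; exact: nbhs_right_le.
have h := hd t t1 td.
by rewrite -lee_fin fineK// ge0_fin_numE ?S0//; exact: le_lt_trans h (ltry _).
Unshelve. all: by end_near. Qed.

End conclusions.

Theorem theorem1p11 (R : realType) (mu : probability (borelC R) R)
    (mu_circle : mu (circle R) = 1%E)
    (P : probability (Conf_space R) R) (P_dpp : is_bergman_dpp P) :
  {ae P, forall X : Conf_space R,
    [/\ (* the series defining g_X(s,z) and g_X(s,z;f) converge absolutely *)
        forall (s : R) (z : R[i]), 1 < s -> disc R z ->
          summable (points X) (fun x => (gweight s z x)%:E) /\
          forall f, harmonic_hardy mu f -> gf_summable X s z f,
        forall f, harmonic_hardy mu f -> forall z, disc R z ->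
          (gratio X s z f : R[i]^o) @[s --> 1^'+] --> (f z : R[i]^o) &
        forall D : set R[i], relatively_compact_in_disc D ->
          sup_nneg (harmonic_hardy_ball mu) (fun f =>
            sup_nneg D (fun z => (normc (gratio X s z f - f z))%:E))
          @[s --> 1^'+] --> 0%E]}.
Proof.
have [N hN] := @mass_level R.
have [s hs] := choice hN.
have s1 n : 1 < s n by have [] := hs n.
have sl n : mass (s n) = ((N + n).+1%:R ^+ 2)%:E by have [] := hs n.
apply: filterS3 (ae_kersum_fin P_dpp) (ae_circle_concentration P_dpp s1 sl mu)
  (ae_rational_concentration P_dpp s1 sl).
move=> X h1 h2 h3; split.
- by move=> t z; exact: good_summable h1 h2 t z.
- by move=> f hf z z1; exact: good_pointwise h1 h2 h3 _ _ hf z1.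
- by move=> D; exact: good_uniform.
Qed.
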